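(* Let $n:L\to\mathbb Z$ be a homomorphism of abelian groups, $p=p_1\delta_1+\dots+p_h\delta_h\in L^+$, and $\tau\in\mathbb C$. Define a linear map $x:Q_{n,\Delta}(\mathcal E,\tau)\to A_{p,\Delta}(\mathcal E,\tau)$ as follows: for $f\in Q_l$, $l=l_1\delta_1+\dots+l_h\delta_h$, $$x(f)=\sum_{\substack{\varphi_{1,1},\dots,\varphi_{p_h,h}\ge0\\ \varphi_{1,i}+\dots+\varphi_{p_i,i}=l_i\ (1\le i\le h)}}B_{\varphi_{1,1},\dots,\varphi_{p_h,h}}\;e_{1,1}^{\varphi_{1,1}}\cdots e_{p_1,1}^{\varphi_{p_1,1}}\cdots e_{1,h}^{\varphi_{1,h}}\cdots e_{p_h,h}^{\varphi_{p_h,h}},$$ where $$B_{\varphi_{1,1},\dots,\varphi_{p_h,h}}=f\bigl(y_{1,1},y_{1,1}+(\delta_1,\delta_1)\tau,\dots,y_{1,1}+(\varphi_{1,1}-1)(\delta_1,\delta_1)\tau,\dots,y_{p_h,h},\dots,y_{p_h,h}+(\varphi_{p_h,h}-1)(\delta_h,\delta_h)\tau;u_1,\dots,u_h\bigr)\prod\frac{\theta(y_{\alpha,i}+\mu(\delta_i,\delta_i)\tau-y_{\beta,j}-\nu(\delta_j,\delta_j)\tau)}{\theta(y_{\alpha,i}+\mu(\delta_i,\delta_i)\tau-y_{\beta,j}-\nu(\delta_j,\delta_j)\tau-(\delta_i,\delta_j)\tau)},$$ the product being over $1\le i\le j\le h$, $1\le\alpha\le p_i$, $1\le\beta\le p_j$,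 $0\le\mu\le\varphi_{\alpha,i}-1$, $0\le\nu\le\varphi_{\beta,j}-1$, subject to: if $i=j$ then $\alpha\le\beta$, and if $i=j$ and $\alpha=\beta$ then $\mu<\nu$. (The arguments of $f$ of type $i$ are the $y_{\alpha,i}+\mu(\delta_i,\delta_i)\tau$, $0\le\mu\le\varphi_{\alpha,i}-1$; if $\varphi_{\alpha,i}=0$ then $y_{\alpha,i}$ does not occur in $f$. In particular $x(f)=f$ for $f\in Q_0$ and $x(f)=\sum_{1\le\alpha\le p_i}f(y_{\alpha,i};u_1,\dots,u_h)e_{\alpha,i}$ for $f\in Q_{\delta_i}$.) Then $x$ is a homomorphism of algebras.
   Context: $\Delta$ is the root system of a Kac-Moody algebra with simple positive roots $\delta_1,\dots,\delta_h$, scalar product $(\cdot,\cdot)$ and Cartan matrix $a_{i,j}=2(\delta_i,\delta_j)/(\delta_i,\delta_i)$. $L=\bigoplus_i\mathbb Z\delta_i$, $L^+=\{\sum_i l_i\delta_i:\ l_i\ge0\}$. $\mathcal E=\mathbb C/\Gamma$, $\Gamma=\mathbb Z+\mathbb Z\eta$, $\mathrm{Im}\,\eta>0$, $\theta(z)=\sum_{\alpha\in\mathbb Z}(-1)^\alpha e^{2\pi i(\alpha z+\frac{\alpha(\alpha-1)}2\eta)}$. The algebra $F_\Delta(\mathcal E,\tau)=\bigoplus_{l\in L^+}F_l$: for $l=\sum_i l_i\delta_i$, $F_l$ is the space of everywhere meromorphic functions $f(x_{1,1},\dots,x_{l_1,1};\dots;x_{1,h},\dots,x_{l_h,h};u_1,\dots,u_h)$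 symmetric in each group $\{x_{1,i},\dots,x_{l_i,i}\}$. For $f\in F_l$, $g\in F_{l'}$ the product $f*g\in F_{l+l'}$ is $$\frac{1}{\prod_i l_i!\,l'_i!}\sum_{\sigma_i\in S_{l_i+l'_i},\,1\le i\le h} f(\{x_{\sigma_i(\alpha),i}\}_{1\le\alpha\le l_i};u_1,\dots,u_h)\, g(\{x_{\sigma_i(\beta),i}\}_{l_i<\beta\le l_i+l'_i};u_1-2(l,\delta_1)\tau,\dots,u_h-2(l,\delta_h)\tau)\prod_{\substack{1\le i,j\le h\\1\le\alpha\le l_i\\ l_j<\beta\le l_j+l'_j}}\frac{\theta(x_{\sigma_i(\alpha),i}-x_{\sigma_j(\beta),j}-(\delta_i,\delta_j)\tau)}{\theta(x_{\sigma_i(\alpha),i}-x_{\sigma_j(\beta),j})}.$$ Put $n_i=n(\delta_i)$. $Q_{n,\Delta}(\mathcal E,\tau)=\bigoplus_{l\in L^+}Q_l$ is the subalgebra of $F_\Delta(\mathcal E,\tau)$ where $Q_l\subset F_l$ is the space of functions $f$ such that: 1. As a function of the variables $x$, $f$ is holomorphic outside the divisors $\{x_{\alpha,i}-x_{\beta,j}=0\}$ (modulo $\Gamma$) with $i\ne j$, $(\delta_i,\delta_j)\ne0$, and has poles of order $\le1$ on these divisors. 2. For each variable $x_{\alpha,i}$: $f$ is unchanged under $x_{\alpha,i}\mapsto x_{\alpha,i}+1$, and under $x_{\alpha,i}\mapsto x_{\alpha,i}+\eta$ it is multiplied by $e^{-2\pi i(n_ix_{\alpha,i}+u_i-(\delta_i,l)\tau)}$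 (in the exponent the factor $i$ next to $2\pi$ is $\sqrt{-1}$). 3. For all $i,j$ with $a_{i,j}<0$, all distinct $\alpha_1,\dots,\alpha_{-a_{i,j}+1}\in\{1,\dots,l_i\}$ and all $\beta\in\{1,\dots,l_j\}$, $f$ vanishes on the affine subspace of codimension $-a_{i,j}+1$ given by $x_{\alpha_k,i}-x_{\alpha_{k+1},i}=(\delta_i,\delta_i)\tau$ for $1\le k\le -a_{i,j}$, $x_{\alpha_{-a_{i,j}+1},i}-x_{\beta,j}=(\delta_i,\delta_j)\tau$, $x_{\beta,j}-x_{\alpha_1,i}=(\delta_i,\delta_j)\tau$. 4. Whenever $\{\delta_{i_1},\dots,\delta_{i_q}\}$ generates an irreducible component of $\Delta$ and $\nu\in\mathbb C$, $f$ is invariant under the simultaneous substitution $x_{\alpha,i}\mapsto x_{\alpha,i}-\nu$ (all $\alpha$), $u_i\mapsto u_i+n_i\nu$ for $i\in\{i_1,\dots,i_q\}$, the other variables being unchanged. The algebra $A_{p,\Delta}(\mathcal E,\tau)$ is generated by $e_{\alpha,i}^{\pm1}$ ($1\le i\le h$, $1\le\alpha\le p_i$) and by all meromorphic functions $\varphi(y_{1,1},\dots,y_{p_1,1};\dots;y_{1,h},\dots,y_{p_h,h};u_1,\dots,u_h)$ which, as functions of the $y_{\alpha,i}$, have poles only on divisors of the form $\{y_{\alpha,i}-y_{\beta,j}-(\delta_i,\delta_j)\tau+\mu(\delta_i,\delta_i)\tau-\nu(\delta_j,\delta_j)\tau=0\}$ (modulo $\Gamma$) with $\mu,\nu\in\mathbb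 Z$, $(\delta_i,\delta_j)\ne0$. The $y_{\alpha,i}$ and $u_j$ all commute with one another, and the other relations are: for $(\alpha,i)\ne(\beta,j)$, $$e_{\alpha,i}e_{\beta,j}=-e^{2\pi i(y_{\beta,j}-y_{\alpha,i})}\frac{\theta(y_{\alpha,i}-y_{\beta,j}-(\delta_i,\delta_j)\tau)}{\theta(y_{\beta,j}-y_{\alpha,i}-(\delta_i,\delta_j)\tau)}\,e_{\beta,j}e_{\alpha,i},\qquad e_{\alpha,i}y_{\beta,j}=y_{\beta,j}e_{\alpha,i};$$ and $e_{\alpha,i}e_{\alpha,i}^{-1}=e_{\alpha,i}^{-1}e_{\alpha,i}=1$, $e_{\alpha,i}y_{\alpha,i}=(y_{\alpha,i}+(\delta_i,\delta_i)\tau)e_{\alpha,i}$, $e_{\alpha,i}u_j=(u_j-2(\delta_i,\delta_j)\tau)e_{\alpha,i}$ (so $e_{\alpha,i}\varphi$ equals the correspondingly shifted function times $e_{\alpha,i}$).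
   Formalization: Instead of arbitrary τ, it is assumed that k(δ_i,δ_i)τ is not in Γ for all k≥1 and all i with p_i>0; otherwise the constant denominators θ(-k(δ_i,δ_i)τ), k≥2, in B vanish and x is undefined (e.g. τ=0 gives θ(0)/θ(0)). *)

(* Defs.v *)
From HB Require Import structures.
From mathcomp Require Import all_boot all_order all_algebra.
From mathcomp.fingroup Require Import perm.
From mathcomp Require Import all_classical all_reals all_analysis.
From mathcomp Require Import complex.

Set Implicit Arguments.
Unset Strict Implicit.
Unset Printing Implicit Defensive.

Import Order.TTheory GRing.Theory Num.Theory.
Import numFieldNormedType.Exports.

Local Open Scope classical_set_scope.
Local Open Scope ring_scope.
Local Open Scope complex_scope.

(* A point of C^K is a function K -> R[i] on a finite type K of variables.  A
   meromorphic function is represented by a unique total function: the one which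
   at each point of holomorphy takes the value of the meromorphic function, and
   takes the value 0 at every other point.  [normalize] sends a formula which
   makes sense at generic points only to this representative, so equality of
   meromorphic functions is Leibniz equality. *)

Section Meromorphic.
Variables (R : realType) (K : finType).
Local Notation C := (R[i]).
Implicit Types (f g q : (K -> C) -> C) (z : K -> C).

Definition to_rV z : 'rV[C^o]_#|K| := \row_k z (enum_val k).
Definition of_rV (v : 'rV[C^o]_#|K|) : K -> C := fun k => v ord0 (enum_rank k).

Definition near_pt z (P : (K -> C) -> Prop) : Prop :=
  \forall v \near to_rV z, P (of_rV v).

(* [R[i]^o] is [R[i]] with its canonical structure of normed space over itself,
   so [differentiable] is complex (Frechet) differentiability. *)
Definition holo_at f z : Prop :=
  \forall v \near to_rV z, differentiable (f \o of_rV : _ -> C^o) v.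

(* q is holomorphic near z, and not identically zero on any nonempty open
   subset of some neighbourhood of z *)
Definition nonzero_germ q z : Prop :=
  holo_at q z /\ near_pt z (fun w => ~ near_pt w (fun w' => q w' = 0)).

Definition generically_eq z f g : Prop :=
  exists2 q, nonzero_germ q z & near_pt z (fun w => q w != 0 -> f w = g w).

Definition extends_at f z g : Prop := holo_at g z /\ generically_eq z f g.

Definition normalize f : (K -> C) -> C := fun z =>
  xget 0 [set c | exists2 g, extends_at f z g & c = g z].

Definition meromorphic f : Prop := forall z, exists P q,
  [/\ holo_at P z, nonzero_germ q z &
      near_pt z (fun w => q w != 0 -> f w = P w / q w)].

Definition is_mero f : Prop := meromorphic f /\ normalize f = f.

End Meromorphic.

Section JoinVars.
Variables (R : realType) (I J : finType).
Local Notation C := (R[i]).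

Definition join (x : I -> C) (u : J -> C) : I + J -> C :=
  fun k => match k with inl a => x a | inr j => u j end.

(* f(x; u), meromorphic in all variables, is holomorphic at z "as a function of
   the variables x": near z, its polar divisor comes from a divisor in the
   space of the parameters u *)
Definition holo_in_x (f : (I + J -> C) -> C) (z : I + J -> C) : Prop :=
  exists2 q : (J -> C) -> C, nonzero_germ q (z \o inr) &
  exists g, extends_at (fun w => q (w \o inr) * f w) z g.

End JoinVars.

Section Theta.
Variables (R : realType) (eta : R[i]).
Local Notation C := (R[i]).

Definition cexp (z : C) : C :=
  (expR (complex.Re z))%:C * (cos (complex.Im z) +i* sin (complex.Im z)).

Definition e2pi (z : C) : C := cexp ((0 +i* (2 * trigo.pi)) * z).

Definition Gamma : set C :=
  [set w | exists a b : int, w = a%:~R + b%:~R * eta].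

Definition theta_term (z : C) (a : int) : C :=
  (-1) ^ a * e2pi (a%:~R * z + (a * (a - 1))%:~R / 2 * eta).

Definition theta (z : C) : C :=
  (limn (series (fun k : nat => theta_term z k%:Z) : nat -> C^o) : C) +
  (limn (series (fun k : nat => theta_term z (- k.+1%:Z)) : nat -> C^o) : C).

End Theta.

(* The simple roots delta_i of a (symmetrizable) Kac-Moody algebra enter only
   through their scalar products [form i j] and the generalized Cartan matrix. *)
Record km_datum (R : realType) (h : nat) := KMDatum {
  form : 'M[R]_h;
  cartan : 'M[int]_h;
  form_sym : forall i j, form i j = form j i;
  form_pos : forall i, 0 < form i i;
  cartanE : forall i j, (cartan i j)%:~R = 2 * form i j / form i i;
  cartan_le0 : forall i j, i != j -> cartan i j <= 0 }.

(* [degree h] is L^+, an element being given by its coordinates l_i;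
   L itself is ['rV[int]_h], with delta_i = [delta_mx 0 i] *)
Definition degree (h : nat) := 'I_h -> nat.
HB.instance Definition _ h := Choice.on (degree h).

(* the pair (i, alpha) stands for the index (alpha, i) of x_{alpha, i} *)
Definition idx h (l : degree h) : finType := {i : 'I_h & 'I_(l i)}.

Definition mkidx h (l : degree h) i (k : 'I_(l i)) : idx l :=
  Tagged (fun i => 'I_(l i)) k.

Definition var h (l : degree h) : finType := (idx l + 'I_h)%type.

Section Algebras.
Variables (R : realType) (h : nat) (D : km_datum R h) (eta tau : R[i]).
Local Notation C := (R[i]).
Local Notation theta := (theta eta).
Local Notation Gamma := (Gamma eta).

Definition fn (l : degree h) := (var l -> C) -> C.

Definition sp (i j : 'I_h) : C := (form D i j)%:C.

(* (l, delta_j) *)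
Definition dpair (l : degree h) (j : 'I_h) : C := \sum_i (l i)%:R * sp i j.

Definition permute_x (l : degree h) (s : {dffun forall i : 'I_h, 'S_(l i)})
    (z : var l -> C) : var l -> C :=
  join (fun a => z (inl (mkidx (s (tag a) (tagged a))))) (z \o inr).

Definition Fcomp (l : degree h) (f : fn l) : Prop :=
  is_mero f /\ forall s z, f (permute_x s z) = f z.

Definition family := forall l : degree h, fn l.

Definition inF (f : family) : Prop :=
  (forall l, Fcomp (f l)) /\ finite_set [set l | f l <> (fun=> 0)].

Definition Flin (c : C) (f g : family) : family :=
  fun l => normalize (fun z => c * f l z + g l z).

Definition Fone : family := fun l _ => [forall i, l i == 0%N]%:R.

(* f * g for f of degree l and g of degree l', l + l' = m (before
   normalization) *)
Definition star (l l' m : degree h) (lm : forall i, (l i + l' i)%N = m i)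
    (f : fn l) (g : fn l') : fn m := fun z =>
  (\prod_(i < h) ((l i)`! * (l' i)`!))%:R^-1 *
  \sum_(s : {dffun forall i : 'I_h, 'S_(m i)})
    let u j := z (inr j) in
    let x (a : idx l) := z (inl (mkidx
      (s (tag a) (cast_ord (lm (tag a)) (lshift (l' (tag a)) (tagged a)))))) in
    let x' (b : idx l') := z (inl (mkidx
      (s (tag b) (cast_ord (lm (tag b)) (rshift (l (tag b)) (tagged b)))))) in
    f (join x u) * g (join x' (fun j => u j - 2 * dpair l j * tau)) *
    \prod_(a : idx l) \prod_(b : idx l')
      (theta (x a - x' b - sp (tag a) (tag b) * tau) / theta (x a - x' b)).

(* bilinear extension of [star]: the component of degree m is the sum over the
   decompositions m = k + (m - k) *)
Definition Fmul (f g : family) : family := fun m => normalize (fun z =>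
  \sum_(k : {dffun forall i : 'I_h, 'I_(m i).+1})
    star (fun i => subnKC (leq_ord (k i)))
      (f (fun i => nat_of_ord (k i))) (g (fun i => (m i - k i)%N)) z).

(* f multiplied by the product of the local equations of those polar divisors
   {x_a - x_b = 0} (modulo Gamma), tag a <> tag b, which pass through z0 *)
Definition numerator (l : degree h) (f : fn l) (z0 : var l -> C) : fn l :=
  fun z => f z *
  \prod_(a : idx l) \prod_(b : idx l | [&& (tag a < tag b)%N,
        sp (tag a) (tag b) != 0 & z0 (inl a) - z0 (inl b) \in Gamma])
    ((z (inl a) - z (inl b)) - (z0 (inl a) - z0 (inl b))).

(* outside of the divisors [numerator f z] is f; on them the condition says
   that the poles are simple *)
Definition Qpoles (l : degree h) (f : fn l) : Prop :=
  forall z, holo_in_x (numerator f z) z.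

Definition translate_x (l : degree h) (a : idx l) (c : C) (z : var l -> C) :
    var l -> C :=
  join (fun b => if b == a then z (inl b) + c else z (inl b)) (z \o inr).

Definition Qperiods (n : 'I_h -> int) (l : degree h) (f : fn l) : Prop :=
  forall (a : idx l) z,
    f (translate_x a 1 z) = f z /\
    f (translate_x a eta z) =
      e2pi (- ((n (tag a))%:~R * z (inl a) + z (inr (tag a))
               - dpair l (tag a) * tau)) * f z.

(* Vanishing is expressed through the numerator since the subspace may lie in
   one of the polar divisors; at its points outside of the polar divisors of f
   this is the vanishing of f. *)
Definition Qwheel (l : degree h) (f : fn l) : Prop :=
  forall (i j : 'I_h), cartan D i j < 0 ->
  forall (al : 'I_(`|cartan D i j|%N).+1 -> 'I_(l i)) (be : 'I_(l j)),
  injective al ->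
  forall z : var l -> C,
    let x k := z (inl (mkidx (al k))) in
    let y := z (inl (mkidx be)) in
    (forall k : 'I_(`|cartan D i j|%N),
       x (widen_ord (leqnSn _) k) - x (lift ord0 k) = sp i i * tau) ->
    x ord_max - y = sp i j * tau ->
    y - x ord0 = sp i j * tau ->
    normalize (numerator f z) z = 0.

(* the irreducible component of Delta containing delta_i, as a set of indices
   of simple roots *)
Definition component (i : 'I_h) : pred 'I_h :=
  connect (fun j k => form D j k != 0) i.

Definition Qinvariant (n : 'I_h -> int) (l : degree h) (f : fn l) : Prop :=
  forall (i : 'I_h) (nu : C) z,
    f (join
        (fun a => if component i (tag a) then z (inl a) - nu else z (inl a))
        (fun j => if component i j then z (inr j) + (n j)%:~R * nu
                  else z (inr j)))
    = f z.

Definition inQ (n : 'I_h -> int) (f : family) : Prop :=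
  inF f /\ forall l, [/\ Qpoles (f l), Qperiods n (f l), Qwheel (f l)
                       & Qinvariant n (f l)].

Variable p : degree h.

(* The condition excludes the pairs a = b, for which the equation of the
   "divisor" has no variable. *)
Definition admissible (phi : fn p) : Prop :=
  is_mero phi /\
  forall z,
    (forall (a b : idx p), a != b -> sp (tag a) (tag b) != 0 ->
     forall mu nu : int,
       ~ Gamma (z (inl a) - z (inl b) - sp (tag a) (tag b) * tau
                + mu%:~R * sp (tag a) (tag a) * tau
                - nu%:~R * sp (tag b) (tag b) * tau)) ->
    holo_in_x phi z.

(* the function phi' such that e_a phi = phi' e_a *)
Definition e_shift (a : idx p) (phi : fn p) : fn p := fun z =>
  phi (join
    (fun b => if b == a then z (inl b) + sp (tag a) (tag a) * tau
              else z (inl b))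
    (fun j => z (inr j) - 2 * sp (tag a) j * tau)).

Definition e_coef (a b : idx p) : fn p := fun z =>
  let ya := z (inl a) in let yb := z (inl b) in
  let c := sp (tag a) (tag b) * tau in
  - e2pi (yb - ya) * (theta (ya - yb - c) / theta (yb - ya - c)).

Inductive term :=
| T0 | T1
| Tadd of term & term
| Topp of term
| Tmul of term & term
| Tscale of C & term
| Te of idx p
| Tei of idx p
| Tfun of {phi : fn p | admissible phi}.

HB.instance Definition _ := gen_eqMixin term.
HB.instance Definition _ := gen_choiceMixin term.

Inductive rel : term -> term -> Prop :=
| rel_refl s : rel s s
| rel_sym s t : rel s t -> rel t s
| rel_trans s t r : rel s t -> rel t r -> rel s r
| rel_add s s' t t' : rel s s' -> rel t t' -> rel (Tadd s t) (Tadd s' t')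
| rel_opp s s' : rel s s' -> rel (Topp s) (Topp s')
| rel_mul s s' t t' : rel s s' -> rel t t' -> rel (Tmul s t) (Tmul s' t')
| rel_scale c s s' : rel s s' -> rel (Tscale c s) (Tscale c s')
| rel_addA s t r : rel (Tadd s (Tadd t r)) (Tadd (Tadd s t) r)
| rel_addC s t : rel (Tadd s t) (Tadd t s)
| rel_add0 s : rel (Tadd T0 s) s
| rel_addN s : rel (Tadd (Topp s) s) T0
| rel_mulA s t r : rel (Tmul s (Tmul t r)) (Tmul (Tmul s t) r)
| rel_mul1l s : rel (Tmul T1 s) s
| rel_mul1r s : rel (Tmul s T1) s
| rel_mulDl s t r : rel (Tmul (Tadd s t) r) (Tadd (Tmul s r) (Tmul t r))
| rel_mulDr s t r : rel (Tmul s (Tadd t r)) (Tadd (Tmul s t) (Tmul s r))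
| rel_scaleA a b s : rel (Tscale a (Tscale b s)) (Tscale (a * b) s)
| rel_scale1 s : rel (Tscale 1 s) s
| rel_scaleDr c s t :
    rel (Tscale c (Tadd s t)) (Tadd (Tscale c s) (Tscale c t))
| rel_scaleDl a b s :
    rel (Tscale (a + b) s) (Tadd (Tscale a s) (Tscale b s))
| rel_scaleAl c s t : rel (Tscale c (Tmul s t)) (Tmul (Tscale c s) t)
| rel_scaleAr c s t : rel (Tscale c (Tmul s t)) (Tmul s (Tscale c t))
(* sums and products of generators [Tfun] are those of functions; phi, psi and
   chi carry the admissibility proofs *)
| rel_fun_cst c phi : sval phi = (fun=> c) -> rel (Tfun phi) (Tscale c T1)
| rel_fun_add phi psi chi :
    sval chi = normalize (fun z => sval phi z + sval psi z) ->
    rel (Tadd (Tfun phi) (Tfun psi)) (Tfun chi)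
| rel_fun_mul phi psi chi :
    sval chi = normalize (fun z => sval phi z * sval psi z) ->
    rel (Tmul (Tfun phi) (Tfun psi)) (Tfun chi)
| rel_ee a b phi : a != b -> sval phi = normalize (e_coef a b) ->
    rel (Tmul (Te a) (Te b)) (Tmul (Tfun phi) (Tmul (Te b) (Te a)))
| rel_eei a : rel (Tmul (Te a) (Tei a)) T1
| rel_eie a : rel (Tmul (Tei a) (Te a)) T1
| rel_e_fun a phi psi : sval psi = e_shift a (sval phi) ->
    rel (Tmul (Te a) (Tfun phi)) (Tmul (Tfun psi) (Te a)).

Definition relb (s t : term) : bool := `[< rel s t >].

Lemma relb_refl : reflexive relb.
Proof. by move=> s; apply/asboolP; exact: rel_refl. Qed.

Lemma relb_sym : symmetric relb.
Proof. by move=> s t; apply/asboolP/asboolP; exact: rel_sym. Qed.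

Lemma relb_trans : transitive relb.
Proof.
by move=> t s r /asboolP st /asboolP tr; apply/asboolP; exact: rel_trans tr.
Qed.

Canonical rel_equiv := EquivRel relb relb_refl relb_sym relb_trans.

Definition algA : Type := {eq_quot rel_equiv}%qT.
HB.instance Definition _ := Choice.on algA.
HB.instance Definition _ := Quotient.on algA.

Definition algA_of (t : term) : algA := \pi_algA%qT t.

Lemma algA_ofP s t : algA_of s = algA_of t <-> rel s t.
Proof.
split=> [/eqP|st]; first by rewrite /algA_of eqmodE => /asboolP.
by apply/eqP; rewrite /algA_of eqmodE; apply/asboolP.
Qed.

Lemma algA_repr t : rel (repr (algA_of t)) t.
Proof. by apply/algA_ofP; rewrite /algA_of reprK. Qed.

Lemma algA_ofK (x : algA) : algA_of (repr x) = x.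
Proof. exact: reprK. Qed.

Definition A_add (x y : algA) := algA_of (Tadd (repr x) (repr y)).
Definition A_opp (x : algA) := algA_of (Topp (repr x)).
Definition A_mul (x y : algA) := algA_of (Tmul (repr x) (repr y)).
Definition A_scale (c : C) (x : algA) := algA_of (Tscale c (repr x)).

Lemma A_addE s t : A_add (algA_of s) (algA_of t) = algA_of (Tadd s t).
Proof. by apply/algA_ofP/rel_add; exact: algA_repr. Qed.
Lemma A_oppE s : A_opp (algA_of s) = algA_of (Topp s).
Proof. by apply/algA_ofP/rel_opp; exact: algA_repr. Qed.
Lemma A_mulE s t : A_mul (algA_of s) (algA_of t) = algA_of (Tmul s t).
Proof. by apply/algA_ofP/rel_mul; exact: algA_repr. Qed.
Lemma A_scaleE c s : A_scale c (algA_of s) = algA_of (Tscale c s).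
Proof. by apply/algA_ofP/rel_scale; exact: algA_repr. Qed.

Let elemP (P : algA -> Prop) : (forall t, P (algA_of t)) -> forall x, P x.
Proof. by move=> Pt x; rewrite -(algA_ofK x); exact: Pt. Qed.

Let AE := (A_addE, A_oppE, A_mulE, A_scaleE).

Lemma A_addA : associative A_add.
Proof.
elim/elemP=> s; elim/elemP=> t; elim/elemP=> r; rewrite !AE.
by apply/algA_ofP; exact: rel_addA.
Qed.
Lemma A_addC : commutative A_add.
Proof.
by elim/elemP=> s; elim/elemP=> t; rewrite !AE; apply/algA_ofP/rel_addC.
Qed.
Lemma A_add0 : left_id (algA_of T0) A_add.
Proof. by elim/elemP=> s; rewrite !AE; apply/algA_ofP/rel_add0. Qed.
Lemma A_addN : left_inverse (algA_of T0) A_opp A_add.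
Proof. by elim/elemP=> s; rewrite !AE; apply/algA_ofP/rel_addN. Qed.
Lemma A_mulA : associative A_mul.
Proof.
elim/elemP=> s; elim/elemP=> t; elim/elemP=> r; rewrite !AE.
by apply/algA_ofP; exact: rel_mulA.
Qed.
Lemma A_mul1l : left_id (algA_of T1) A_mul.
Proof. by elim/elemP=> s; rewrite !AE; apply/algA_ofP/rel_mul1l. Qed.
Lemma A_mul1r : right_id (algA_of T1) A_mul.
Proof. by elim/elemP=> s; rewrite !AE; apply/algA_ofP/rel_mul1r. Qed.
Lemma A_mulDl : left_distributive A_mul A_add.
Proof.
elim/elemP=> s; elim/elemP=> t; elim/elemP=> r; rewrite !AE.
by apply/algA_ofP; exact: rel_mulDl.
Qed.
Lemma A_mulDr : right_distributive A_mul A_add.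
Proof.
elim/elemP=> s; elim/elemP=> t; elim/elemP=> r; rewrite !AE.
by apply/algA_ofP; exact: rel_mulDr.
Qed.

(* [lalgType] and [algType] require 1 != 0, which is not an axiom of a
   presentation: algA is given the structures of a ring and of a vector space,
   whose compatibility is [A_scaleAl] and [A_scaleAr]. *)
HB.instance Definition _ := GRing.isPzRing.Build algA
  A_addA A_addC A_add0 A_addN A_mulA A_mul1l A_mul1r A_mulDl A_mulDr.

Lemma A_scaleA a b (x : algA) : A_scale a (A_scale b x) = A_scale (a * b) x.
Proof. by elim/elemP: x => s; rewrite !AE; apply/algA_ofP/rel_scaleA. Qed.
Lemma A_scale1 : left_id 1 A_scale.
Proof. by elim/elemP=> s; rewrite !AE; apply/algA_ofP/rel_scale1. Qed.
Lemma A_scaleDr : right_distributive A_scale +%R.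
Proof.
move=> c; elim/elemP=> s; elim/elemP=> t; rewrite -[+%R]/A_add !AE.
by apply/algA_ofP/rel_scaleDr.
Qed.
Lemma A_scaleDl (x : algA) : {morph A_scale^~ x : a b / a + b}.
Proof.
move=> a b; elim/elemP: x => s; rewrite -[X in _ = X]/(A_add _ _) !AE.
by apply/algA_ofP/rel_scaleDl.
Qed.

HB.instance Definition _ := GRing.Zmodule_isLmodule.Build C algA
  A_scaleA A_scale1 A_scaleDr A_scaleDl.

Lemma A_scaleAl (c : C) (x y : algA) : c *: (x * y) = (c *: x) * y.
Proof.
elim/elemP: x => s; elim/elemP: y => t; rewrite -[*%R]/A_mul -[*:%R]/A_scale.
by rewrite !AE; apply/algA_ofP/rel_scaleAl.
Qed.
Lemma A_scaleAr (c : C) (x y : algA) : c *: (x * y) = x * (c *: y).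
Proof.
elim/elemP: x => s; elim/elemP: y => t; rewrite -[*%R]/A_mul -[*:%R]/A_scale.
by rewrite !AE; apply/algA_ofP/rel_scaleAr.
Qed.

Definition A_e (a : idx p) : algA := algA_of (Te a).

(* a junk value when phi is not admissible *)
Definition A_fun (phi : fn p) : algA :=
  if pselect (admissible phi) is left adm then algA_of (Tfun (exist _ phi adm))
  else 0.

(* the order (1,1), ..., (p_1,1), ..., (1,h), ..., (p_h,h) of the indices *)
Definition idx_le (a b : idx p) : bool :=
  (tag a < tag b)%N ||
  (tag a == tag b) && (nat_of_ord (tagged a) <= nat_of_ord (tagged b))%N.

(* the arguments of type i of f in B_phi *)
Definition string_args (phi : idx p -> nat) (y : idx p -> C) (i : 'I_h) :
    seq C :=
  [seq y (mkidx al) + mu%:R * sp i i * tau |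
     al <- enum 'I_(p i), mu <- iota 0 (phi (mkidx al))].

Definition has_degree (phi : idx p -> nat) (l : degree h) : bool :=
  [forall i : 'I_h, \sum_(al < p i) phi (mkidx al) == l i]%N.

(* B_phi, meant for phi of degree l: the i-th list of arguments has then l_i
   elements, and the default value of [nth] is not used. *)
Definition B (l : degree h) (f : fn l) (phi : idx p -> nat) : fn p :=
  normalize (fun z =>
    let y a := z (inl a) in
    f (join (fun c : idx l => nth 0 (string_args phi y (tag c)) (tagged c))
            (z \o inr)) *
    \prod_(a : idx p) \prod_(b : idx p | idx_le a b)
    \prod_(mu < phi a) \prod_(nu < phi b | (a == b) ==> (mu < nu)%N)
      let w := y a + mu%:R * sp (tag a) (tag a) * tau
               - y b - nu%:R * sp (tag b) (tag b) * tau in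
      (theta w / theta (w - sp (tag a) (tag b) * tau))).

Definition e_monomial (phi : idx p -> nat) : algA :=
  \prod_(i < h) \prod_(al < p i) A_e (mkidx al) ^+ phi (mkidx al).

(* the exponents of degree l are bounded by l_1 + ... + l_h *)
Definition x_comp (l : degree h) (f : fn l) : algA :=
  \sum_(phi : {ffun idx p -> 'I_(\sum_i l i).+1}
        | has_degree (fun a => nat_of_ord (phi a)) l)
    A_fun (B f (fun a => nat_of_ord (phi a))) *
    e_monomial (fun a => nat_of_ord (phi a)).

Definition x_map (f : family) : algA :=
  \sum_(l \in [set: degree h]) x_comp (f l).

End Algebras.

(* Main.v *)
Require Import Defs.
From mathcomp Require Import all_boot all_order all_algebra.
From mathcomp Require Import all_classical all_reals all_analysis complex.
From mathcomp.fingroup Require Import fingroup perm.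
From mathcomp Require Import ring lra zify.
Import Order.TTheory GRing.Theory Num.Theory.
Import numFieldNormedType.Exports.
Set Implicit Arguments.
Unset Strict Implicit.
Unset Printing Implicit Defensive.
Local Open Scope classical_set_scope.
Local Open Scope ring_scope.
Local Open Scope complex_scope.

(** The coefficient of e^phi in x(f) is f evaluated on strings: the points
    y_a + mu (delta_i, delta_i) tau with 0 <= mu < phi_a, multiplied by one
    quotient of theta functions for each ordered pair of points.  The theorem
    compares, for a given exponent Phi, the coefficients of e^Phi in x(f * g)
    and in x(f) x(g); both are sums over the decompositions Phi = phi + psi.

    In x(f) x(g) the functions are moved to the left of the monomials.  Moving
    e^phi past a function translates it, by an amount which puts the string of
    length psi_a just after the string of length phi_a, so that together they
    form the string of length Phi_a.  Bringing e^phi e^psi to the normal order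
    produces one exchange coefficient for each pair made of a point P of the
    first strings and a point Q of the second ones such that Q precedes P
    ([term_mul]).

    In f * g, evaluated at the strings of lengths Phi, every permutation
    distributes the points among the arguments of f and those of g.  If a point
    goes to f while its predecessor on the same string goes to g, a factor
    theta(0) appears.  So f receives an initial part of every string, of some
    length phi_a, and each such phi comes from the same number of permutations,
    namely the number by which the product is divided ([star_strings]).

    For a given phi it remains to compare, for P among the points given to f
    and Q among those given to g, the factor of (P, Q) in the product f * g and
    the one in the coefficient of e^Phi.  They cancel when P precedes Q, and
    give the exchange coefficient when Q precedes P ([pair_identity]).

    Functions are total, normalized representatives of meromorphic functions,
    so these identities only have to hold outside of an analytic divisor near
    every point ([gen], [normalize_geneq]).  Genericity needs that the theta
    factors do not vanish identically.  For points of different strings this is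
    because the zeros of theta are exactly the points of the lattice
    ([theta_eq0]), which follows from the finite form of the Jacobi triple
    product by a passage to the limit; on a single string it is the hypothesis
    on tau.  The coefficients are elements of the algebra because the simple
    poles of f at the coincidences of two arguments of different types are
    cancelled by the zeros of the theta factors ([adm_sub_form]). *)

(** * Holomorphic germs and generic properties *)

Lemma differentiable_near_eq (K : numFieldType) (V W : normedModType K)
    (f g : V -> W) (v : V) :
  (\forall w \near v, f w = g w) -> differentiable g v -> differentiable f v.
Proof.
move=> fg dg.
have fgv : f v = g v by exact: (nbhs_singleton fg).
have [cg eg] := (diff_locallyP v g).1 dg.
have ef : f \o shift v = cst (f v) + 'd g v +o_ 0 id.
  apply/eqaddoP => e e0; have /eqaddoP /(_ e e0) := eg.
  apply: filterS2; last first.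
    have : \forall w \near (0:V), f (w + v) = g (w + v).
      rewrite (near_shift v) sub0r /=; apply: filterS fg => w.
      by rewrite /= subrK.
    exact.
  by move=> w /= fgw; rewrite !fctE /= fgw fgv.
have -> : differentiable f v <-> continuous ('d f v) /\ (f \o shift v = cst (f v) + 'd f v +o_ 0 id).
  exact: diff_locallyP.
by rewrite (diff_unique cg ef).
Qed.

(** Common form of the closure of a class of functions under finite sums and
    products. *)
Lemma fun_big_closed (T U I : Type) (x : U) (op : U -> U -> U) (K : (T -> U) -> Prop)
    (r : seq I) (P : pred I) (F : I -> T -> U) :
  K (fun=> x) -> (forall f g, K f -> K g -> K (fun w => op (f w) (g w))) ->
  (forall i, P i -> K (F i)) -> K (fun w => \big[op/x]_(i <- r | P i) F i w).
Proof.
move=> K1 Kop KF; elim: r => [|i r IH].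
  by under [X in K X]funext do rewrite big_nil.
under [X in K X]funext do rewrite big_cons.
by have [/KF Ki|] := boolP (P i); [exact: Kop|].
Qed.

Section Germs.
Variables (R : realType).
Local Notation C := (R[i]).

Section OneSpace.
Variable (K : finType).
Implicit Types (f g q : (K -> C) -> C) (z : K -> C).
Local Notation V := 'rV[C^o]_#|K|.

Lemma of_to_rV z : of_rV (to_rV z) = z.
Proof. by apply/funext => k; rewrite /of_rV /to_rV mxE enum_rankK. Qed.

Lemma to_of_rV (v : V) : to_rV (of_rV v) = v.
Proof. by apply/rowP => k; rewrite /of_rV /to_rV mxE enum_valK. Qed.

Lemma near_ptE z (P : (K -> C) -> Prop) :
  near_pt z P = nbhs (to_rV z) (fun v : V => P (of_rV v)).
Proof. by []. Qed.

Lemma near_pt_here z P : near_pt z P -> P z.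
Proof. by move=> /nbhs_singleton; rewrite of_to_rV. Qed.

Lemma near_ptS z (P Q : (K -> C) -> Prop) :
  (forall w, P w -> Q w) -> near_pt z P -> near_pt z Q.
Proof. by move=> PQ; apply: filterS => v; exact: PQ. Qed.

Lemma near_ptT z (P : (K -> C) -> Prop) : (forall w, P w) -> near_pt z P.
Proof.
move=> PT; rewrite near_ptE; apply: (@filterE _ (nbhs (to_rV z : V)) _ _) => v.
exact: PT.
Qed.

Lemma near_ptI z (P Q : (K -> C) -> Prop) :
  near_pt z P -> near_pt z Q -> near_pt z (fun w => P w /\ Q w).
Proof. by move=> zP zQ; apply: filterI. Qed.

Lemma near_ptS2 z (P Q S : (K -> C) -> Prop) :
  (forall w, P w -> Q w -> S w) -> near_pt z P -> near_pt z Q -> near_pt z S.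
Proof.
by move=> PQS zP zQ; apply: near_ptS (near_ptI zP zQ) => w [] /PQS; apply.
Qed.

Lemma near_pt_near z (P : (K -> C) -> Prop) :
  near_pt z P -> near_pt z (fun w => near_pt w P).
Proof.
rewrite 2!near_ptE => /(@near_join V) zP.
by apply: filterS zP => v; rewrite /near_pt to_of_rV.
Qed.

Lemma near_nbhs z (P : V -> Prop) :
  nbhs (to_rV z : V) P <-> near_pt z (fun w => P (to_rV w)).
Proof.
by rewrite near_ptE; split; apply: filterS => v; rewrite to_of_rV.
Qed.

Lemma holo_atP f z : holo_at f z <->
  near_pt z (fun w => differentiable (f \o @of_rV R K : V -> C^o) (to_rV w)).
Proof. exact: near_nbhs. Qed.

Lemma holo_at_near f z : holo_at f z -> near_pt z (holo_at f).
Proof.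
by move=> /holo_atP /near_pt_near; apply: near_ptS => w /holo_atP.
Qed.

Lemma holo_diff f z : holo_at f z -> 
  differentiable (f \o @of_rV R K : V -> C^o) (to_rV z).
Proof. by move=> /nbhs_singleton. Qed.

Lemma holo_cst (c : C) z : holo_at (fun=> c) z.
Proof. by apply/holo_atP/near_ptT => v; exact: differentiable_cst. Qed.

Lemma holo_coord (k : K) z : holo_at (fun w => w k) z.
Proof.
apply/holo_atP/near_ptT => v.
exact: (@differentiable_coord C 1 #|K| (to_rV v) ord0 (enum_rank k)).
Qed.

Lemma holoD f g z : holo_at f z -> holo_at g z ->
  holo_at (fun w => f w + g w) z.
Proof.
rewrite !holo_atP; apply: near_ptS2 => v vf vg; exact: (differentiableD vf vg).
Qed.

Lemma holoM f g z : holo_at f z -> holo_at g z ->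
  holo_at (fun w => f w * g w) z.
Proof.
rewrite !holo_atP; apply: near_ptS2 => v vf vg; exact: (differentiableM vf vg).
Qed.

Lemma holoN f z : holo_at f z -> holo_at (fun w => - f w) z.
Proof.
by rewrite !holo_atP; apply: near_ptS => v vf; exact: (differentiableN vf).
Qed.

Lemma holoB f g z : holo_at f z -> holo_at g z ->
  holo_at (fun w => f w - g w) z.
Proof. by move=> zf zg; apply: holoD => //; exact: holoN. Qed.

Lemma holo_nbhs f z (A : set C^o) : holo_at f z -> nbhs (f z : C^o) A ->
  near_pt z (fun w => A (f w)).
Proof.
move=> /holo_diff /differentiable_continuous zf fA.
by rewrite near_ptE; apply: (zf A); rewrite /= of_to_rV.
Qed.

Lemma holo_neq0 f z : holo_at f z -> f z != 0 -> near_pt z (fun w => f w != 0).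
Proof.
move=> zf fz0; apply: (holo_nbhs (A := [set x : C^o | x != 0])) zf _.
exact: (@cvgr_neq0 C C^o C^o (nbhs (f z : C^o)) _ id (f z)) _ fz0.
Qed.

Lemma holoV f z : holo_at f z -> f z != 0 -> holo_at (fun w => (f w)^-1) z.
Proof.
move=> zf f0; have := holo_neq0 zf f0; move: zf; rewrite !holo_atP.
apply: near_ptS2 => v vf vf0.
apply: (differentiableV vf); by rewrite /= of_to_rV.
Qed.

Lemma holo_div f g z : holo_at f z -> holo_at g z -> g z != 0 ->
  holo_at (fun w => f w / g w) z.
Proof. by move=> zf zg g0; apply: holoM => //; exact: holoV. Qed.

Lemma holo_prod (I : Type) (r : seq I) (P : pred I) (F : I -> (K -> C) -> C) z :
  (forall i, P i -> holo_at (F i) z) ->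
  holo_at (fun w => \prod_(i <- r | P i) F i w) z.
Proof. move=> FK; apply: (fun_big_closed (K := fun f => holo_at f z) r _ _ FK) => [|f g]; [exact: holo_cst|exact: holoM]. Qed.

Lemma holo_sum (I : Type) (r : seq I) (P : pred I) (F : I -> (K -> C) -> C) z :
  (forall i, P i -> holo_at (F i) z) ->
  holo_at (fun w => \sum_(i <- r | P i) F i w) z.
Proof. move=> FK; apply: (fun_big_closed (K := fun f => holo_at f z) r _ _ FK) => [|f g]; [exact: holo_cst|exact: holoD]. Qed.

(** [holo_at] requires differentiability in a whole neighbourhood, hence the
    passage from an equality near z to an equality near every nearby point. *)
Lemma holo_eq_near f g z : near_pt z (fun w => f w = g w) -> holo_at g z ->
  holo_at f z.
Proof.
move=> /near_pt_near; rewrite !holo_atP; apply: near_ptS2 => w fg.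
by apply: differentiable_near_eq.
Qed.

Lemma holo_comp1 (phi : C -> C) f z : holo_at f z ->
  nbhs (f z : C^o) (fun t => differentiable (phi : C^o -> C^o) t) ->
  holo_at (fun w => phi (f w)) z.
Proof.
move=> zf zphi; have := holo_nbhs zf zphi; move: zf; rewrite !holo_atP.
apply: near_ptS2 => v vf vphi.
have := @differentiable_comp _ _ C^o C^o _ phi _ vf; apply.
by rewrite /= of_to_rV.
Qed.

End OneSpace.

Section Comp.
Variables (K K' : finType) (s : K' -> option K) (c : K' -> C).
(** A change of variables in which a coordinate is either read off from the source
    or ([None]) frozen.  Frozen coordinates are what is needed to lift a
    perturbation of some coordinates back along an injective [csub]. *)
Definition osub (z : K -> C) : K' -> C := fun k => oapp z 0 (s k) + c k.
Local Notation V := 'rV[C^o]_#|K|.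
Local Notation V' := 'rV[C^o]_#|K'|.

Lemma osub_diff (v : V) :
  differentiable (fun v : V => to_rV (osub (of_rV v)) : V') v.
Proof.
pose G (k : 'I_#|K'|) (v : V) : C^o := oapp (of_rV v) 0 (s (enum_val k)) + c (enum_val k).
have -> : (fun v : V => to_rV (osub (of_rV v)) : V') =
   (\sum_(k < #|K'|) (fun v : V => (G k v : C) *: (delta_mx ord0 k : V'))).
  apply/funext => w; rewrite [LHS]row_sum_delta fct_sumE.
  by apply: eq_bigr => k _; rewrite mxE.
apply: differentiable_sum => k.
apply: (@differentiableZl C V V' (G k) (delta_mx ord0 k)).
apply: (@differentiableD C V C^o); last exact: differentiable_cst.
case: (s _) => [j|] /=; last exact: differentiable_cst.
exact: (@differentiable_coord C 1 #|K| v ord0 _).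
Qed.

Lemma near_osub z (P : (K' -> C) -> Prop) :
  near_pt (osub z) P -> near_pt z (fun w => P (osub w)).
Proof.
move=> zP; have /differentiable_continuous := @osub_diff (to_rV z).
rewrite /= => /(_ (fun v => P (of_rV v))); rewrite of_to_rV => /(_ zP).
move=> zP'.
have {}zP' : near_pt z (fun w => P (of_rV (to_rV (osub w)))) by exact: zP'.
by apply: near_ptS zP' => w; rewrite of_to_rV.
Qed.

Lemma holo_osub z f : holo_at f (osub z) -> holo_at (fun w => f (osub w)) z.
Proof.
rewrite !holo_atP => /near_osub; apply: near_ptS => w fw.
have := @differentiable_comp _ _ V' C^o _ (f \o @of_rV R K') _ (osub_diff (to_rV w)).
rewrite of_to_rV => /(_ fw).
rewrite (_ : _ \o _ = (fun w0 : K -> R[i] => f (osub w0)) \o @of_rV R K) //.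
by apply/funext => v /=; rewrite of_to_rV.
Qed.

End Comp.

(** All the substitutions of the proof are of this form: coordinates are copied,
    possibly several times, and translated. *)
Definition csub (K K' : finType) (s : K' -> K) (c : K' -> C) (z : K -> C)
  : K' -> C := fun k => z (s k) + c k.

Lemma csubE (K K' : finType) (s : K' -> K) (c : K' -> C) :
  csub s c = osub (fun k => Some (s k)) c.
Proof. by []. Qed.

Lemma near_csub (K K' : finType) (s : K' -> K) (c : K' -> C) z P :
  near_pt (csub s c z) P -> near_pt z (fun w => P (csub s c w)).
Proof. by rewrite csubE; exact: near_osub. Qed.

Lemma holo_csub (K K' : finType) (s : K' -> K) (c : K' -> C) z f :
  holo_at f (csub s c z) -> holo_at (fun w => f (csub s c w)) z.
Proof. by rewrite csubE; exact: holo_osub. Qed.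

Section Generic.
Variable (K : finType).
Implicit Types (f g q : (K -> C) -> C) (z : K -> C).

(** The properties used below hold outside of an analytic divisor; [gen z] is the
    filter of such properties near z. *)
Definition gen z (P : (K -> C) -> Prop) :=
  exists2 q, nonzero_germ q z & near_pt z (fun w => q w != 0 -> P w).

(** The positive form of non-vanishing: q takes a nonzero value in every nonempty
    open set near z. *)
Lemma nonzero_germP q z : nonzero_germ q z <->
  holo_at q z /\ near_pt z (fun w => forall P, near_pt w P ->
     exists w', P w' /\ q w' != 0).
Proof.
split=> -[hq nq]; split => //; apply: near_ptS nq => w.
  move=> nq P wP; apply: contrapT => noP; apply: nq.
  apply: near_ptS wP => w' Pw'; apply/eqP/negPn/negP => q0.
  by apply: noP; exists w'.
by move=> nq /nq [w' [->]]; rewrite eqxx.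
Qed.

(** Inside a given open set, q does not vanish on some smaller open set by
    continuity, and q' takes a nonzero value there. *)
Lemma nonzero_germM q q' z : nonzero_germ q z -> nonzero_germ q' z ->
  nonzero_germ (fun w => q w * q' w) z.
Proof.
move=> /nonzero_germP[hq nq] /nonzero_germP[hq' nq']; apply/nonzero_germP.
split; first exact: holoM.
have := near_ptI (holo_at_near hq) (near_ptI nq (near_pt_near nq')).
apply: near_ptS => w [{}hq [{}nq {}nq']] P wP.
have [w' [[[Pw' nq'w'] hqw'] qw']] :=
  nq _ (near_ptI (near_ptI (near_pt_near wP) nq') (holo_at_near hq)).
have [w'' [[Pw'' q0] q'0]] := nq'w' _ (near_ptI Pw' (holo_neq0 hqw' qw')).
by exists w''; split => //; rewrite mulf_neq0.
Qed.

Lemma nonzero_germ_neq0 q z : holo_at q z -> q z != 0 -> nonzero_germ q z.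
Proof.
move=> hq q0; apply/nonzero_germP; split => //.
apply: near_ptS (holo_neq0 hq q0) => w qw P /near_pt_here Pw.
by exists w.
Qed.

Lemma nonzero_germ1 z : nonzero_germ (fun=> 1) z.
Proof. by apply: nonzero_germ_neq0; [exact: holo_cst|exact: oner_neq0]. Qed.

Lemma nonzero_germ_near q z : nonzero_germ q z -> near_pt z (nonzero_germ q).
Proof.
move=> [/holo_at_near hq /near_pt_near nq].
by apply: near_ptS2 hq nq => w.
Qed.

Lemma nonzero_germ_prod (I : Type) (r : seq I) (P : pred I) (F : I -> (K -> C) -> C) z :
  (forall i, P i -> nonzero_germ (F i) z) ->
  nonzero_germ (fun w => \prod_(i <- r | P i) F i w) z.
Proof. move=> FK; apply: (fun_big_closed (K := fun f => nonzero_germ f z) r _ _ FK) => [|f g]; [exact: nonzero_germ1|exact: nonzero_germM]. Qed.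

Lemma gen_here z (P : (K -> C) -> Prop) : near_pt z P -> gen z P.
Proof.
by move=> zP; exists (fun=> 1); [exact: nonzero_germ1|apply: near_ptS zP].
Qed.

Lemma genI z (P Q : (K -> C) -> Prop) : gen z P -> gen z Q ->
  gen z (fun w => P w /\ Q w).
Proof.
move=> [q nq qP] [q' nq' qQ]; exists (fun w => q w * q' w).
  exact: nonzero_germM.
apply: near_ptS2 qP qQ => w qP qQ; rewrite mulf_eq0 => /norP[/qP Pw /qQ Qw].
by split.
Qed.

Lemma genS z (P Q : (K -> C) -> Prop) : (forall w, P w -> Q w) ->
  gen z P -> gen z Q.
Proof.
by move=> PQ [q nq qP]; exists q => //; apply: near_ptS qP => w qP /qP /PQ.
Qed.

Lemma genS2 z (P Q S : (K -> C) -> Prop) :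
  (forall w, P w -> Q w -> S w) -> gen z P -> gen z Q -> gen z S.
Proof.
by move=> PQS zP zQ; apply: genS (genI zP zQ) => w [] /PQS; apply.
Qed.

Lemma genT z (P : (K -> C) -> Prop) : (forall w, P w) -> gen z P.
Proof. by move=> PT; apply: gen_here; exact: near_ptT. Qed.

Lemma gen_all (I : finType) z (P : I -> (K -> C) -> Prop) :
  (forall i, gen z (P i)) -> gen z (fun w => forall i, P i w).
Proof.
move=> zP.
suff : gen z (fun w => forall i, i \in enum I -> P i w).
  by apply: genS => w H i; apply: H; rewrite mem_enum.
elim: (enum I) => [|i s IH]; first exact: genT.
apply: genS2 (zP i) IH => w Pi IH j; rewrite inE => /predU1P[->//|]; exact: IH.
Qed.

Lemma gen_neq0 q z : nonzero_germ q z -> gen z (fun w => q w != 0).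
Proof. by move=> nq; exists q => //; exact: near_ptT. Qed.

(** The exceptional divisor at z serves at all nearby points. *)
Lemma gen_near z (P : (K -> C) -> Prop) : gen z P -> near_pt z (fun w => gen w P).
Proof.
move=> [q nq /near_pt_near qP].
by apply: near_ptS2 (nonzero_germ_near nq) qP => w nqw qPw; exists q.
Qed.

(** A generic property meets every neighbourhood, since a nonzero germ does not
    vanish identically in it. *)
Lemma gen_dense z (P Q : (K -> C) -> Prop) : gen z P -> near_pt z Q ->
  exists w, P w /\ Q w.
Proof.
move=> [q /nonzero_germP[hq /near_pt_here nq] qP] zQ.
have [w [[Pw Qw] q0]] := nq _ (near_ptI qP zQ).
by exists w; split => //; exact: Pw.
Qed.

(** Otherwise the difference is nonzero in a neighbourhood, which contains points
    where the two functions agree. *)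
Lemma holo_gen_eq z f g : holo_at f z -> holo_at g z ->
  gen z (fun w => f w = g w) -> f z = g z.
Proof.
move=> hf hg fg; apply/eqP; rewrite -subr_eq0; apply/negPn/negP => fg0.
have [w [-> ]] := gen_dense fg (holo_neq0 (holoB hf hg) fg0).
by rewrite subrr eqxx.
Qed.

(** The value chosen by [normalize] does not depend on the extension, because two
    holomorphic extensions agree generically, hence at z. *)
Lemma normalizeP f z g : holo_at g z -> gen z (fun w => f w = g w) ->
  normalize f z = g z.
Proof.
move=> hg fg; rewrite /normalize; case: xgetP => [c -> [g' [hg' fg'] ->]|].
  apply: holo_gen_eq => //; apply: genS2 fg fg' => w; by move=> <- <-.
by move=> /(_ (g z)) []; exists g.
Qed.

Lemma normalize_holo f z : holo_at f z -> normalize f z = f z.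
Proof. by move=> hf; apply: normalizeP => //; exact: genT. Qed.

Definition geneq f g := forall z, gen z (fun w => f w = g w).

Lemma geneq_sym f g : geneq f g -> geneq g f.
Proof. by move=> fg z; apply: genS (fg z). Qed.

Lemma normalize_geneq f g : geneq f g -> normalize f = normalize g.
Proof.
move=> fg; apply/funext => z; rewrite /normalize; congr xget.
apply/seteqP; split=> c [e [he ee] ->]; exists e => //; split => //.
  by apply: genS2 (fg z) ee => w -> .
by apply: genS2 (fg z) ee => w ->.
Qed.

(** An extra denominator, on the zeros of which the formula is only generic, can be
    put into the numerator and the denominator. *)
Lemma meromorphicP f z : (exists P q, [/\ holo_at P z, nonzero_germ q z &
  gen z (fun w => f w = P w / q w)]) ->
  exists P q, [/\ holo_at P z, nonzero_germ q z & near_pt z (fun w => q w != 0 -> f w = P w / q w)].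
Proof.
move=> [P [q [hP nq [q' nq' e]]]]; exists (fun w => P w * q' w), (fun w => q w * q' w).
have [hq' _] := nq'.
split; [exact: holoM | exact: nonzero_germM | ].
apply: near_ptS e => w e; rewrite mulf_eq0 => /norP[q0 q'0].
by rewrite (e q'0) -mulf_div divff // mulr1.
Qed.

(** A meromorphic function is holomorphic off the zeros of a local denominator. *)
Lemma mero_gen_holo f z : meromorphic f -> gen z (holo_at f).
Proof.
move=> /(_ z) [P [q [hP nq e]]]; exists q => //.
have [hq _] := nq.
have := near_ptI (near_ptI (holo_at_near hP) (holo_at_near hq)) (near_pt_near e).
apply: near_ptS => w [[{}hP {}hq] {}e] q0.
apply: (@holo_eq_near K f (fun w => P w / q w)); last exact: holo_div.
by apply: near_ptS2 (holo_neq0 hq q0) e => w' q0'; apply.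
Qed.

Lemma mero_geneq f g : meromorphic f -> geneq f g -> meromorphic g.
Proof.
move=> mf fg z; apply: meromorphicP; have [P [q [hP nq e]]] := mf z.
exists P, q; split => //.
have gq := gen_neq0 nq; have ge := gen_here e.
by apply: genS2 (genI (fg z) gq) ge => w [<- q0]; apply.
Qed.

Lemma normalize_gen f : meromorphic f -> geneq (normalize f) f.
Proof.
move=> mf z; apply: genS (mero_gen_holo z mf) => w; exact: normalize_holo.
Qed.

Lemma is_mero_normalize f : meromorphic f -> is_mero (normalize f).
Proof.
move=> mf; split; last by apply: normalize_geneq; exact: normalize_gen.
by apply: (mero_geneq mf); apply: geneq_sym; exact: normalize_gen.
Qed.

(** A generic formula for a normalized function is an exact one wherever the
    denominator does not vanish: there the formula is a holomorphic extension. *)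
Lemma is_mero_value f q g z : normalize f = f -> holo_at q z -> holo_at g z ->
  gen z (fun w => q w * f w = g w) ->
  near_pt z (fun w => q w != 0 -> holo_at f w /\ f w = g w / q w).
Proof.
move=> nf hq hg e.
have := near_pt_near (near_ptI (gen_near e) (near_ptI (holo_at_near hq) (holo_at_near hg))).
apply: near_ptS => w H q0.
have [_ [hqw hgw]] := near_pt_here H.
have V : near_pt w (fun w => q w != 0 /\ f w = g w / q w).
  apply: near_ptS2 (holo_neq0 hqw q0) H => w' q0' [e' [hq' hg']]; split => //.
  rewrite -nf; apply: (normalizeP (holo_div hg' hq' q0')).
  apply: genS2 (gen_here (holo_neq0 hq' q0')) e' => w'' q0'' <-.
  by rewrite mulrC mulKf.
split; last by case: (near_pt_here V).
apply: (holo_eq_near (g := fun w => g w / q w)); last exact: holo_div.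
by apply: near_ptS V => w' [].
Qed.

End Generic.

Section GenComp.
Variables (K K' : finType) (s : K' -> K) (c : K' -> C).
Local Notation N := (csub s c).

Lemma gen_csub q z (P : (K' -> C) -> Prop) :
  nonzero_germ (fun w => q (N w)) z ->
  near_pt (N z) (fun w => q w != 0 -> P w) -> gen z (fun w => P (N w)).
Proof. by move=> nq /near_csub qP; exists (fun w => q (N w)). Qed.

Hypothesis s_inj : injective s.

(** An injective coordinate map is open: a point near [N w] is the image of the
    point obtained from w by changing the selected coordinates only. *)
Lemma nonzero_germ_csub q z : nonzero_germ q (N z) ->
  nonzero_germ (fun w => q (N w)) z.
Proof.
move=> /nonzero_germP[hq nq]; apply/nonzero_germP; split.
  exact: holo_csub.
apply: near_ptS (near_csub nq) => w {}nq P wP.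
pose t k := [pick k' | s k' == k].
(* M is a right inverse of the substitution which passes through w. *)
pose M : (K' -> C) -> K -> C :=
  osub t (fun k => if t k is Some k' then - c k' else w k).
have ts k' : t (s k') = Some k'.
  by rewrite /t; case: pickP => [k /eqP/s_inj ->//|/(_ k')]; rewrite eqxx.
have NM v : N (M v) = v.
  by apply/funext => k; rewrite /csub /M /osub ts /= subrK.
have MN : M (N w) = w.
  apply/funext => k; rewrite /M /osub /t.
  case: pickP => [k' /eqP <-|] /=; last by rewrite add0r.
  by rewrite /csub addrK.
rewrite -MN in wP; have [v [Pv qv]] := nq _ (near_osub wP).
by exists (M v); rewrite NM.
Qed.

Lemma gen_csub_inj z (P : (K' -> C) -> Prop) :
  gen (N z) P -> gen z (fun w => P (N w)).
Proof. by move=> [q nq qP]; apply: gen_csub qP; exact: nonzero_germ_csub. Qed.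

Lemma mero_csub f : meromorphic f -> meromorphic (fun w => f (N w)).
Proof.
move=> mf z; have [P [q [hP nq e]]] := mf (N z).
exists (fun w => P (N w)), (fun w => q (N w)); split; first exact: holo_csub.
  exact: nonzero_germ_csub.
by apply: near_ptS (near_csub e).
Qed.

End GenComp.

Section Translation.
Variables (K : finType) (c : K -> C).
Local Notation T := (csub id c).
Local Notation T' := (csub id (fun k => - c k)).

Lemma csubNK z : T' (T z) = z.
Proof. by apply/funext => k; rewrite /csub addrK. Qed.

Lemma csubKN z : T (T' z) = z.
Proof. by apply/funext => k; rewrite /csub addrNK. Qed.

(** Translations are invertible, so that holomorphic extensions of f at [T z] and
    of its translate at z correspond to each other. *)
Lemma normalize_translate f : normalize (fun w => f (T w)) = (fun w => normalize f (T w)).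
Proof.
apply/funext => z; have [[g [hg eg]]|nog] := pselect (exists g, extends_at f (T z) g).
  rewrite (normalizeP hg eg) (normalizeP (g := fun w => g (T w))) //.
    exact: holo_csub.
  by apply: (@gen_csub_inj _ _ id c (fun _ _ => id) z (fun w => f w = g w)).
transitivity (0 : C); rewrite /normalize; case: xgetP => // x -> [g [hg eg] _].
  exfalso; apply: nog; exists (fun w => g (T' w)); split.
    by apply: holo_csub; rewrite csubNK.
  have := @gen_csub_inj _ _ id (fun k => - c k) (fun _ _ => id) (T z) (fun w => f (T w) = g w).
  by rewrite csubNK => /(_ eg); apply: genS => w; rewrite csubKN.
by exfalso; apply: nog; exists g.
Qed.

End Translation.

Section MeroAlg.
Variable (K : finType).
Implicit Types (f g : (K -> C) -> C).

Lemma mero_holo f : (forall z, holo_at f z) -> meromorphic f.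
Proof.
move=> hf z; exists f, (fun=> 1); split => //; first exact: nonzero_germ1.
by apply: near_ptT => w _; rewrite divr1.
Qed.

Lemma meroM f g : meromorphic f -> meromorphic g -> meromorphic (fun w => f w * g w).
Proof.
move=> mf mg z; have [P [q [hP nq e]]] := mf z; have [P' [q' [hP' nq' e']]] := mg z.
exists (fun w => P w * P' w), (fun w => q w * q' w); split; [exact: holoM|exact: nonzero_germM|].
apply: near_ptS2 e e' => w e e'; rewrite mulf_eq0 => /norP[/e -> /e' ->].
by rewrite mulf_div.
Qed.

Lemma meroD f g : meromorphic f -> meromorphic g -> meromorphic (fun w => f w + g w).
Proof.
move=> mf mg z; have [P [q [hP nq e]]] := mf z; have [P' [q' [hP' nq' e']]] := mg z.
have [[hq _] [hq' _]] := (nq, nq').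
exists (fun w => P w * q' w + P' w * q w), (fun w => q w * q' w).
split; [by apply: holoD; exact: holoM|exact: nonzero_germM|].
apply: near_ptS2 e e' => w e e'; rewrite mulf_eq0 => /norP[q0 q'0].
by rewrite (e q0) (e' q'0) addf_div.
Qed.

Lemma mero_div f g : (forall z, holo_at f z) -> (forall z, nonzero_germ g z) ->
  meromorphic (fun w => f w / g w).
Proof. by move=> hf ng z; exists f, g; split => //; exact: near_ptT. Qed.

Lemma mero_prod (I : Type) (r : seq I) (P : pred I) (F : I -> (K -> C) -> C) :
  (forall i, P i -> meromorphic (F i)) ->
  meromorphic (fun w => \prod_(i <- r | P i) F i w).
Proof. move=> FK; apply: (fun_big_closed (K := @meromorphic R K) r _ _ FK) => [|f g]; [exact: (mero_holo (holo_cst 1))|exact: meroM]. Qed.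

Lemma geneqM f g f' g' : geneq f f' -> geneq g g' -> geneq (fun w => f w * g w) (fun w => f' w * g' w).
Proof. by move=> ff gg z; apply: genS2 (ff z) (gg z) => w -> ->. Qed.

Lemma geneqD f g f' g' : geneq f f' -> geneq g g' -> geneq (fun w => f w + g w) (fun w => f' w + g' w).
Proof. by move=> ff gg z; apply: genS2 (ff z) (gg z) => w -> ->. Qed.

End MeroAlg.
End Germs.

(** * Absolute values and geometrically convergent series of complex numbers *)

Section Norm.
Variable R : realType.
Local Notation C := (R[i]).

(** The absolute value, as a real number: in R[i] the norm is itself a complex
    number. *)
Definition nrm (z : C) : R := complex.Re `|z|.

Lemma nrmE z : `|z| = (nrm z)%:C.
Proof. by rewrite /nrm normc_def. Qed.

Lemma nrm_ge0 z : 0 <= nrm z.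
Proof. by rewrite -lecR -nrmE normr_ge0. Qed.

Lemma nrmM z z' : nrm (z * z') = nrm z * nrm z'.
Proof. by apply: (@complexI R); rewrite -nrmE normrM !nrmE rmorphM. Qed.

Lemma nrmD z z' : nrm (z + z') <= nrm z + nrm z'.
Proof. by rewrite -lecR rmorphD /= -!nrmE; exact: ler_normD. Qed.

Lemma nrmN z : nrm (- z) = nrm z.
Proof. by rewrite /nrm normrN. Qed.

Lemma nrmB z z' : nrm (z - z') <= nrm z + nrm z'.
Proof. by rewrite -(nrmN z'); exact: nrmD. Qed.

Lemma nrm0 : nrm 0 = 0.
Proof. by rewrite /nrm normr0. Qed.

Lemma nrm1 : nrm 1 = 1.
Proof. by rewrite /nrm normr1. Qed.

Lemma nrm_eq0 z : (nrm z == 0) = (z == 0).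
Proof. by rewrite -(inj_eq (@complexI R)) -nrmE rmorph0 normr_eq0. Qed.

Lemma nrm_gt0 z : (0 < nrm z) = (z != 0).
Proof. by rewrite lt_def nrm_ge0 nrm_eq0 andbT. Qed.

Lemma nrmX z n : nrm (z ^+ n) = nrm z ^+ n.
Proof. by elim: n => [|n IH]; rewrite ?expr0 ?nrm1 // !exprS nrmM IH. Qed.

Lemma nrmV z : nrm (z^-1) = (nrm z)^-1.
Proof. by apply: (@complexI R); rewrite -nrmE normfV nrmE fmorphV. Qed.

Lemma nrmR (x : R) : nrm x%:C = `|x|.
Proof. by rewrite /nrm normc_def /= expr0n addr0 sqrtr_sqr. Qed.

Lemma nrm_sum (I : Type) (r : seq I) (P : pred I) (F : I -> C) :
  nrm (\sum_(i <- r | P i) F i) <= \sum_(i <- r | P i) nrm (F i).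
Proof.
elim/big_ind2: _ => [|x a y b xa yb|//]; first by rewrite nrm0.
by apply: le_trans (nrmD _ _) _; exact: lerD.
Qed.

Lemma nrm_Re z : `|complex.Re z| <= nrm z.
Proof. by rewrite -lecR -nrmE; exact: normc_ge_Re. Qed.

Lemma nrm_Im z : `|complex.Im z| <= nrm z.
Proof.
rewrite /nrm normc_def /= -[X in X <= _]sqrtr_sqr ler_sqrt ?addr_ge0 ?sqr_ge0 //.
by rewrite lerDr sqr_ge0.
Qed.

Lemma nrm_le_ReIm z : nrm z <= `|complex.Re z| + `|complex.Im z|.
Proof.
rewrite /nrm normc_def /= -[leRHS]ger0_norm ?addr_ge0 // -sqrtr_sqr.
rewrite ler_sqrt ?sqr_ge0 // sqrrD !real_normK ?num_real //.
by rewrite addrAC lerDl mulrn_wge0 // mulr_ge0.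
Qed.

Lemma nbhs_nrmP (t : C) (A : set C^o) :
  nbhs (t : C^o) A <-> exists2 e : R, 0 < e & forall u, nrm (u - t) < e -> A u.
Proof.
split=> [/nbhs_ballP[e /= e0 eA]|[e e0 eA]]; last apply/nbhs_ballP.
  move: e0 eA; case: e => e e'; rewrite ltcE /= => /andP[/eqP -> e0] eA.
  exists e => // u ut; apply: eA; rewrite -ball_normE /= distrC nrmE.
  by rewrite -[(e +i* 0)]/(e%:C) ltcR.
exists e%:C; first by rewrite /= ltcR.
move=> u; rewrite -ball_normE /= distrC nrmE ltcR; exact: eA.
Qed.

Lemma cvg_nrmP (u : nat -> C) (s : C) :
  ((u : nat -> C^o) @ \oo --> (s : C^o)) <->
  forall e : R, 0 < e -> exists N, forall n, (N <= n)%N -> nrm (u n - s) < e.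
Proof.
split=> [us e e0|H].
  have /us [N _ Nu] : nbhs (s : C^o) [set x : C^o | nrm (x - s) < e].
    by apply/nbhs_nrmP; exists e.
  by exists N => n Nn; apply: Nu.
move=> A /nbhs_nrmP[e e0 eA]; have [N NH] := H _ e0.
by exists N => // n /NH /eA.
Qed.

End Norm.

Lemma pow_small (R : realType) (x e : R) : 0 <= x < 1 -> 0 < e ->
  exists N, forall n, (N <= n)%N -> x ^+ n < e.
Proof.
move=> /andP[x0 x1] e0; have x1' : `|x| < 1 by rewrite ger0_norm.
have /cvgrPdist_lt /(_ _ e0) [N _ H] := cvg_expr x1'.
by exists N => n /H /=; rewrite sub0r normrN ger0_norm // exprn_ge0.
Qed.

Section Series.
Variable R : realType.
Local Notation C := (R[i]).
Local Notation nrm := (@nrm R).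
Implicit Types (u v : nat -> C).

(** Every series below is dominated by a geometric one of ratio 1/2, which gives
    explicit bounds for the remainders. *)
Definition geo (A : R) u := forall k, nrm (u k) <= A / 2 ^+ k.

Definition csum u : C := limn (series u : nat -> C^o).

Lemma geo_series_R (A : R) (u : nat -> R) : (forall k, `|u k| <= A / 2 ^+ k) ->
  cvgn (series u) /\ `|limn (series u)| <= 2 * A.
Proof.
move=> uA.
have A0 : 0 <= A by have := le_trans (normr_ge0 _) (uA 0%N); rewrite expr0 divr1.
pose g := geometric A (2^-1 : R).
have h1 : `|2^-1 : R| < 1 by rewrite ger0_norm ?invr_ge0 // invf_lt1 // ltr1n.
have gE k : g k = A / 2 ^+ k by rewrite /g /geometric /= exprVn.
have gc : cvgn (series g) by exact: is_cvg_geometric_series.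
have nc : cvgn [normed series u].
  apply: (series_le_cvg _ _ _ gc) => n //=; first by rewrite gE divr_ge0 // exprn_ge0.
  by rewrite gE.
split; first exact: normed_cvg.
apply: le_trans (lim_series_norm nc) _.
apply: le_trans (lim_series_le nc gc _) _; first by move=> n /=; rewrite gE.
rewrite (cvg_lim _ (cvg_geometric_series h1)) //.
by have -> : A / (1 - 2^-1) = 2 * A by field.
Qed.

Lemma Re_series u n : complex.Re (series u n) = series (fun k => complex.Re (u k)) n.
Proof. by rewrite /series /= (raddf_sum (@complex.Re R)). Qed.

Lemma Im_series u n : complex.Im (series u n) = series (fun k => complex.Im (u k)) n.
Proof. by rewrite /series /= (raddf_sum (@complex.Im R)). Qed.

Lemma geo_cvg A u : geo A u -> (series u : nat -> C^o) @ \oo --> (csum u : C^o).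
Proof.
move=> uA.
have [cR _] := @geo_series_R A (fun k => complex.Re (u k)) (fun k => le_trans (nrm_Re _) (uA k)).
have [cI _] := @geo_series_R A (fun k => complex.Im (u k)) (fun k => le_trans (nrm_Im _) (uA k)).
set a := limn (series (fun k => complex.Re (u k))).
set b := limn (series (fun k => complex.Im (u k))).
suff cu : (series u : nat -> C^o) @ \oo --> (a +i* b : C^o).
  by rewrite /csum (cvg_lim _ cu).
apply/cvg_nrmP => e e0; have e2 : 0 < e / 2 by rewrite divr_gt0.
have /cvgrPdist_lt /(_ _ e2) [N1 _ H1] := cR.
have /cvgrPdist_lt /(_ _ e2) [N2 _ H2] := cI.
exists (maxn N1 N2) => n; rewrite geq_max => /andP[n1 n2].
apply: le_lt_trans (nrm_le_ReIm _) _; rewrite (splitr e).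
apply: ltrD.
  by rewrite (raddfB (@complex.Re R)) /= Re_series distrC; apply: (H1 n n1).
by rewrite (raddfB (@complex.Im R)) /= Im_series distrC; apply: (H2 n n2).
Qed.

Lemma csum_uniq u (s : C) : (series u : nat -> C^o) @ \oo --> (s : C^o) -> csum u = s.
Proof. exact: cvg_lim. Qed.

Lemma csumD A B u v : geo A u -> geo B v -> csum (fun k => u k + v k) = csum u + csum v.
Proof.
move=> /geo_cvg/cvg_nrmP cu /geo_cvg/cvg_nrmP cv; apply: csum_uniq.
apply/cvg_nrmP => e e0; have e2 : 0 < e / 2 by rewrite divr_gt0.
have [N1 H1] := cu _ e2; have [N2 H2] := cv _ e2.
exists (maxn N1 N2) => n; rewrite geq_max => /andP[/H1 {}H1 /H2 {}H2].
rewrite /series /= big_split /= opprD addrACA (splitr e).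
by apply: le_lt_trans (nrmD _ _) _; exact: ltrD.
Qed.

Lemma csumZ A u (c : C) : geo A u -> csum (fun k => c * u k) = c * csum u.
Proof.
move=> /geo_cvg cu; apply: csum_uniq.
rewrite (_ : series _ = (fun n => c * series u n : C^o)).
  by apply: (@cvgM C); [exact: cvg_cst | exact: cu].
by apply/funext => n; rewrite /series /= mulr_sumr.
Qed.

Lemma geoZ A u (c : C) : geo A u -> geo (nrm c * A) (fun k => c * u k).
Proof. by move=> uA k; rewrite nrmM -mulrA ler_wpM2l ?nrm_ge0. Qed.

Lemma geoD A B u v : geo A u -> geo B v -> geo (A + B) (fun k => u k + v k).
Proof.
by move=> uA vB k; apply: le_trans (nrmD _ _) _; rewrite mulrDl lerD.
Qed.

Lemma csumB A B u v : geo A u -> geo B v -> csum (fun k => u k - v k) = csum u - csum v.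
Proof.
move=> uA vB; have := csumD uA (geoZ (-1) vB); rewrite (csumZ _ vB) mulN1r => <-.
by congr csum; apply/funext => k; rewrite mulN1r.
Qed.

Lemma geo_ge0 A u : geo A u -> 0 <= A.
Proof. by move=> /(_ 0%N); rewrite expr0 divr1; apply: le_trans; exact: nrm_ge0. Qed.

Lemma geo_partial A u m n : geo A u -> nrm (\sum_(m <= k < n) u k) <= 2 * A / 2 ^+ m.
Proof.
move=> uA; have A0 := geo_ge0 uA.
have [mn|nm] := leqP m n; last first.
  by rewrite big_geq ?nrm0 ?divr_ge0 ?mulr_ge0 ?exprn_ge0 // ltnW.
apply: le_trans (nrm_sum _ _ _) _.
apply: (@le_trans _ _ (\sum_(m <= k < n) A / 2 ^+ k)); first exact: ler_sum.
have -> : \sum_(m <= k < n) A / 2 ^+ k = 2 * A / 2 ^+ m - 2 * A / 2 ^+ n.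
  rewrite (eq_bigr (fun i => (- (2 * A / 2 ^+ i.+1)) - (- (2 * A / 2 ^+ i)))).
    by rewrite telescope_sumr // opprK addrC.
  move=> i _; rewrite exprS; have : (2 ^+ i : R) != 0 by rewrite expf_neq0.
  by move=> ?; field.
by rewrite gerBl divr_ge0 // ?mulr_ge0 // exprn_ge0.
Qed.

(** Every later partial sum is within the bound, and the limit is approached by
    them. *)
Lemma csum_tail A u n : geo A u -> nrm (csum u - \sum_(k < n) u k) <= 2 * A / 2 ^+ n.
Proof.
move=> uA; apply/ler_addgt0Pr => e e0.
have /cvg_nrmP /(_ _ e0) [N NH] := geo_cvg uA.
have := NH (maxn N n) (leq_maxl _ _); rewrite /series /= => H.
rewrite (_ : csum u - _ = (csum u - \sum_(0 <= k < maxn N n) u k) + \sum_(n <= k < maxn N n) u k); last first.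
  rewrite -(big_mkord xpredT u) (@big_cat_nat _ _ _ n 0 (maxn N n)) ?leq_maxr //=.
  by ring.
apply: le_trans (nrmD _ _) _; rewrite addrC lerD //; first exact: geo_partial.
by rewrite -nrmN opprB; exact: ltW.
Qed.

Lemma csum_le A u : geo A u -> nrm (csum u) <= 2 * A.
Proof. by move=> uA; have := csum_tail 0 uA; rewrite big_ord0 subr0 expr0 divr1. Qed.

Lemma geo_shift A u : geo A u -> geo A (fun k => u k.+1).
Proof.
move=> uA k; apply: le_trans (uA _) _; have A0 := geo_ge0 uA.
by rewrite ler_wpM2l // lef_pV2 ?posrE ?exprn_gt0 // ler_weXn2l // ler1n.
Qed.

Lemma csum_recl A u : geo A u -> csum u = u 0%N + csum (fun k => u k.+1).
Proof.
move=> uA; have /cvg_nrmP c' := geo_cvg (geo_shift uA).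
apply: csum_uniq; apply/cvg_nrmP => e /c' [N NH].
exists N.+1 => -[//|n]; rewrite ltnS => /NH; rewrite /series /=.
by rewrite big_nat_recl // opprD addrACA subrr add0r.
Qed.

End Series.

(** * Divided differences of functions of one complex variable *)

Section Taylor.
Variable R : realType.
Local Notation C := (R[i]).
Local Notation nrm := (@nrm R).
Implicit Types (f g : C -> C) (c t : C).

Definition nearC c (P : C -> Prop) := nbhs (c : C^o) (P : set C^o).
Definition hol f t := differentiable (f : C^o -> C^o) (t : C^o).

Lemma nearCS c (P Q : C -> Prop) : (forall t, P t -> Q t) -> nearC c P -> nearC c Q.
Proof. by move=> PQ; apply: filterS. Qed.

Lemma nearCS2 c (P Q S : C -> Prop) : (forall t, P t -> Q t -> S t) ->
  nearC c P -> nearC c Q -> nearC c S.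
Proof. by move=> PQ; apply: filterS2. Qed.

Lemma nearCT c (P : C -> Prop) : (forall t, P t) -> nearC c P.
Proof. by move=> PT; apply: (@filterE _ (nbhs (c : C^o)) _ _). Qed.

(** A quadratic bound on the remainder of the first order expansion; since R[i] is
    its own space of scalars, derivability is differentiability. *)
Lemma hol_quad f c : (exists d B r, 0 < r /\ forall h, nrm h < r ->
  nrm (f (c + h) - f c - h * d) <= B * nrm h ^+ 2) -> hol f c.
Proof.
move=> [d [B [r [r0 H]]]]; apply/derivable1_diffP/cvg_ex; exists (d : C^o).
move=> A /nbhs_nrmP[e e0 eA].
have B0 : 0 < `|B| + 1 by rewrite ltr_pwDr.
rewrite /nbhs /=; apply/nbhs_nrmP.
exists (Num.min r (e / (`|B| + 1))); first by rewrite lt_min r0 divr_gt0.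
move=> h; rewrite subr0 lt_min => /andP[hr he] h0; apply: eA.
have nh : 0 < nrm h by rewrite nrm_gt0.
rewrite /= [_ *: 1]mulr1 [_ *: _]/(_ * _).
rewrite (_ : _ - d = h^-1 * (f (c + h) - f c - h * d)); last first.
  by rewrite (addrC h c) mulrBr mulKf.
rewrite nrmM nrmV mulrC ltr_pdivrMr //; apply: le_lt_trans (H h hr) _.
move: he; rewrite ltr_pdivlMr // => he.
have := ler_norm B; nra.
Qed.

Lemma hol_near_eq f g c : nearC c (fun t => f t = g t) -> hol g c -> hol f c.
Proof. exact: (@differentiable_near_eq C C^o C^o f g c). Qed.

Lemma holD1 f g c : hol f c -> hol g c -> hol (fun t => f t + g t) c.
Proof. exact: (@differentiableD C C^o C^o). Qed.

Lemma holN1 f c : hol f c -> hol (fun t => - f t) c.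
Proof. exact: (@differentiableN C C^o C^o). Qed.

Lemma holM1 f g c : hol f c -> hol g c -> hol (fun t => f t * g t) c.
Proof. exact: (@differentiableM C C^o). Qed.

Lemma holV1 f c : hol f c -> f c != 0 -> hol (fun t => (f t)^-1) c.
Proof. exact: (@differentiableV C C^o). Qed.

Lemma hol_cst1 (a : C) c : hol (fun=> a) c.
Proof. exact: differentiable_cst. Qed.

Lemma hol_id c : hol id c.
Proof.
apply: hol_quad; exists 1, 0, 1; split => // h _.
by rewrite /= (_ : c + h - c - h * 1 = 0) ?nrm0 ?mul0r //; ring.
Qed.

Lemma hol_comp f g c : hol f c -> hol g (f c) -> hol (fun t => g (f t)) c.
Proof. exact: (@differentiable_comp C C^o C^o C^o). Qed.

Lemma hol_cont f c (P : C -> Prop) : hol f c -> nearC (f c) P -> nearC c (fun t => P (f t)).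
Proof. by move=> /differentiable_continuous; apply. Qed.

(** The divided difference (f t - f c) / (t - c) extends holomorphically to t = c.
    This is how a zero of theta is divided out, without Cauchy theory. *)
Definition has_divdiff f c := exists g, nearC c (hol g) /\
  nearC c (fun t => f t - f c = (t - c) * g t).

(** An expansion of order two with a cubic remainder: one order more than
    differentiability, so that the divided difference is itself differentiable. *)
Definition taylor2 f c := exists d1 d2 B r, 0 < r /\ forall h, nrm h < r ->
  nrm (f (c + h) - f c - h * d1 - h ^+ 2 * d2) <= B * nrm h ^+ 3.

Lemma taylor2_hol f c : taylor2 f c -> hol f c.
Proof.
move=> [d1 [d2 [B [r [r0 H]]]]]; apply: hol_quad.
exists d1, (`|B| + nrm d2), (Num.min r 1); split; first by rewrite lt_min r0 ltr01.
move=> h; rewrite lt_min => /andP[hr h1].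
rewrite (_ : f (c + h) - f c - h * d1 = (f (c + h) - f c - h * d1 - h ^+ 2 * d2) + h ^+ 2 * d2); last by rewrite subrK.
apply: le_trans (nrmD _ _) _; have := H h hr; rewrite nrmM nrmX.
have := nrm_ge0 h; have := nrm_ge0 d2; have := ler_norm B; set x := nrm h.
move=> BB d0 x0 /le_trans H'; rewrite mulrDl (mulrC (x ^+ 2)) lerD2r; apply: H'.
apply: (@le_trans _ _ (`|B| * x ^+ 3)); first by rewrite ler_wpM2r ?exprn_ge0.
by rewrite ler_wpM2l // exprS ler_piMl ?sqr_ge0 // ltW.
Qed.

(** Away from c the divided difference is a quotient of holomorphic functions; at c
    dividing the remainder of the expansion by t - c leaves a quadratic one. *)
Lemma taylor2_divdiff f : (forall c, taylor2 f c) -> forall c, has_divdiff f c.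
Proof.
move=> tf c; have hf t := taylor2_hol (tf t).
have [d1 [d2 [B [r [r0 H]]]]] := tf c.
(* At t = c the divided difference is the derivative. *)
pose g t := if t == c then d1 else (f t - f c) / (t - c).
have gc : g c = d1 by rewrite /g eqxx.
have gE t : t != c -> g t = (f t - f c) / (t - c) by rewrite /g => /negbTE ->.
exists g; split; last first.
  apply: nearCT => t; have [->|theta_coef] := eqVneq t c; first by rewrite !subrr mul0r.
  by rewrite gE // mulrC divfK // subr_eq0.
apply: nearCT => t; have [->|theta_coef] := eqVneq t c.
  apply: hol_quad; exists d2, B, r; split => // h hr; rewrite gc.
  have [->|h0] := eqVneq h 0.
    by rewrite addr0 gc subrr sub0r mul0r oppr0 nrm0 expr0n /= mulr0.
  rewrite gE; last by rewrite -subr_eq0 addrAC subrr add0r.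
  rewrite -(ler_pM2l (x := nrm h)) ?nrm_gt0 //.
  rewrite -nrmM (_ : nrm h * (B * nrm h ^+ 2) = B * nrm h ^+ 3); last by ring.
  apply: le_trans (H h hr); rewrite (_ : c + h - c = h); last by ring.
  by rewrite le_eqVlt; apply/orP; left; apply/eqP; congr nrm; field.
apply: (hol_near_eq (g := fun t => (f t - f c) / (t - c))).
  have : nearC t (fun s => s - c != 0).
    apply: (hol_cont (f := fun s => s - c) (P := fun s => s != 0)).
      by apply: holD1; [exact: hol_id|exact: hol_cst1].
    have tc' : t - c != 0 by rewrite subr_eq0.
    exact: (@cvgr_neq0 C C^o C^o (nbhs (t - c : C^o)) _ id (t - c)) _ tc'.
  by apply: nearCS => s; rewrite subr_eq0 => /gE.
apply: holM1; first by apply: holD1 => //; exact: hol_cst1.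
by apply: holV1; [apply: holD1; [exact: hol_id|exact: hol_cst1]|rewrite subr_eq0].
Qed.

Lemma divdiff_hol f c : has_divdiff f c -> hol f c.
Proof.
move=> [g [hg e]]; apply: (hol_near_eq (g := fun t => f c + (t - c) * g t)).
  by apply: nearCS e => t <-; rewrite addrC subrK.
apply: holD1; first exact: hol_cst1.
apply: holM1; last exact: (nbhs_singleton hg).
by apply: holD1; [exact: hol_id|exact: hol_cst1].
Qed.

Lemma divdiffD f g c : has_divdiff f c -> has_divdiff g c -> has_divdiff (fun t => f t + g t) c.
Proof.
move=> [f' [hf ef]] [g' [hg eg]]; exists (fun t => f' t + g' t); split.
  by apply: nearCS2 hf hg => t; exact: holD1.
by apply: nearCS2 ef eg => t ef eg; rewrite mulrDr -ef -eg opprD addrACA.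
Qed.

Lemma divdiffN f c : has_divdiff f c -> has_divdiff (fun t => - f t) c.
Proof.
move=> [f' [hf ef]]; exists (fun t => - f' t); split.
  by apply: nearCS hf => t; exact: holN1.
by apply: nearCS ef => t ef; rewrite mulrN -ef opprB opprK addrC.
Qed.

Lemma divdiff_cst (a : C) c : has_divdiff (fun=> a) c.
Proof.
exists (fun=> 0); split; first by apply: nearCT => t; exact: hol_cst1.
by apply: nearCT => t; rewrite subrr mulr0.
Qed.

(** f t g t - f c g c = f t (g t - g c) + (f t - f c) g c; the factor f t of the first
    term is why f has to be holomorphic. *)
Lemma divdiffM f g c : nearC c (hol f) -> has_divdiff f c -> has_divdiff g c -> has_divdiff (fun t => f t * g t) c.
Proof.
move=> hhf [f' [hf ef]] [g' [hg eg]].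
exists (fun t => f t * g' t + f' t * g c); split.
  apply: nearCS2 (filterI hhf hg) hf => t [hft hg't] hf't.
  by apply: holD1; apply: holM1 => //; exact: hol_cst1.
apply: nearCS2 ef eg => t ef eg; rewrite mulrDr [_ * (f t * _)]mulrCA -eg mulrA -ef.
by ring.
Qed.

Lemma divdiff_comp f g c : nearC c (hol f) -> has_divdiff f c -> has_divdiff g (f c) ->
  has_divdiff (fun t => g (f t)) c.
Proof.
move=> hhf [f' [hf ef]] [g' [hg eg]].
have hfc : hol f c by exact: (nbhs_singleton hhf).
have hg' := hol_cont hfc hg; have eg' := hol_cont hfc eg.
exists (fun t => f' t * g' (f t)); split.
  apply: nearCS2 (filterI hhf hf) hg' => t [hft hf't] hg't.
  exact: (holM1 hf't (hol_comp hft hg't)).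
by apply: nearCS2 ef eg' => t ef eg''; rewrite eg'' ef mulrA.
Qed.

End Taylor.

(** * Entire power series *)

Section PowerSeries.
Variable R : realType.
Local Notation C := (R[i]).
Local Notation nrm := (@nrm R).
Variable d : nat -> C.

(** The coefficients decay faster than every geometric sequence: infinite radius of
    convergence. *)
Definition entire_coef := forall T : R, 0 <= T -> exists A, forall k, nrm (d k) * T ^+ k <= A.
Hypothesis d_entire : entire_coef.

Definition pser t : C := csum (fun k => d k * t ^+ k).

Lemma entire_coef_geo T : 0 <= T -> exists A, forall k, nrm (d k) * T ^+ k <= A / 2 ^+ k.
Proof.
move=> T0; have [A HA] := d_entire (mulr_ge0 (ler0n R 2) T0).
exists A => k; rewrite ler_pdivlMr ?exprn_gt0 // -mulrA -exprMn (mulrC T).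
exact: HA.
Qed.

Lemma pser_geo T : 0 <= T -> exists A, forall t, nrm t <= T -> geo A (fun k => d k * t ^+ k).
Proof.
move=> T0; have [A HA] := entire_coef_geo T0; exists A => t tT k.
apply: le_trans (HA k); rewrite nrmM nrmX ler_wpM2l ?nrm_ge0 //.
by rewrite lerXn2r // nnegrE ?nrm_ge0.
Qed.

(** [pow_coef1 t k] and [pow_coef2 t k] are the coefficients k t^(k-1) and
    C(k,2) t^(k-2) of h and h^2 in (t + h)^k; the recursive form makes them easy to
    bound. *)
Fixpoint pow_coef1 (t : C) k : C := if k is k'.+1 then t * pow_coef1 t k' + t ^+ k' else 0.
Fixpoint pow_coef2 (t : C) k : C := if k is k'.+1 then t * pow_coef2 t k' + pow_coef1 t k' else 0.

Lemma pow_coef1_le t k : nrm (pow_coef1 t k) <= (nrm t + 1) ^+ k.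
Proof.
have t0 := nrm_ge0 t.
elim: k => [|k IH] /=; first by rewrite nrm0 expr0.
apply: le_trans (nrmD _ _) _; rewrite nrmM nrmX exprS mulrDl mul1r.
apply: lerD; first by rewrite ler_wpM2l.
by rewrite lerXn2r ?nnegrE ?addr_ge0 // lerDl.
Qed.

Lemma pow_coef2_le t k : nrm (pow_coef2 t k) <= (nrm t + 1) ^+ k.
Proof.
have t0 := nrm_ge0 t.
elim: k => [|k IH] /=; first by rewrite nrm0 expr0.
apply: le_trans (nrmD _ _) _; rewrite nrmM exprS mulrDl mul1r.
by apply: lerD; [rewrite ler_wpM2l|exact: pow_coef1_le].
Qed.

(** By induction, multiplying the expansion of (t + h)^k by t + h. *)
Lemma pow_taylor2 t h k : nrm h <= 1 ->
  nrm ((t + h) ^+ k - t ^+ k - h * pow_coef1 t k - h ^+ 2 * pow_coef2 t k) <=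
    nrm h ^+ 3 * (nrm t + 2) ^+ k.
Proof.
have t0 := nrm_ge0 t; have h0 := nrm_ge0 h; move=> h1.
elim: k => [|k IH].
  by rewrite /= !expr0 subrr !mulr0 !subr0 nrm0 mulr1 exprn_ge0.
rewrite (_ : _ - _ = (t + h) * ((t + h) ^+ k - t ^+ k - h * pow_coef1 t k - h ^+ 2 * pow_coef2 t k) + h ^+ 3 * pow_coef2 t k); last first.
  by rewrite /= !exprS; ring.
apply: le_trans (nrmD _ _) _; rewrite (nrmM (t + h)) (nrmM (h ^+ 3)) (nrmX h 3).
have -> : nrm h ^+ 3 * (nrm t + 2) ^+ k.+1 = (nrm t + 1) * (nrm h ^+ 3 * (nrm t + 2) ^+ k) + nrm h ^+ 3 * (nrm t + 2) ^+ k.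
  by rewrite (exprS (nrm t + 2)); ring.
apply: lerD.
  apply: ler_pM => //; try exact: nrm_ge0.
  by apply: le_trans (nrmD _ _) _; rewrite lerD2l.
rewrite ler_wpM2l ?exprn_ge0 //; apply: le_trans (pow_coef2_le _ _) _.
by rewrite lerXn2r ?nnegrE ?addr_ge0 // lerD2l ler1n.
Qed.

Lemma geo_dominated (u : nat -> C) (M T : R) : 0 <= M -> 0 <= T ->
  (forall k, nrm (u k) <= M * (nrm (d k) * T ^+ k)) ->
  forall A, (forall k, nrm (d k) * T ^+ k <= A / 2 ^+ k) -> geo (M * A) u.
Proof.
move=> M0 T0 uM A HA k; apply: le_trans (uM k) _; rewrite -mulrA.
exact: ler_wpM2l.
Qed.

(** Sum the expansions of the monomials; the bounds on the coefficients are powers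
    of |t| + 2, against which the coefficients of the series are summable. *)
Lemma pser_taylor2 t : taylor2 pser t.
Proof.
have t0 := nrm_ge0 t.
have T0 : 0 <= nrm t + 2 by rewrite addr_ge0.
have [A HA] := entire_coef_geo T0.
have le2 k : (nrm t + 1) ^+ k <= (nrm t + 2) ^+ k.
  by rewrite lerXn2r ?nnegrE ?addr_ge0 // lerD2l ler1n.
pose u1 k := d k * pow_coef1 t k; pose u2 k := d k * pow_coef2 t k.
have g1 : geo (1 * A) u1.
  apply: (geo_dominated ler01 T0) HA => k; rewrite mul1r nrmM ler_wpM2l ?nrm_ge0 //.
  exact: le_trans (pow_coef1_le _ _) (le2 k).
have g2 : geo (1 * A) u2.
  apply: (geo_dominated ler01 T0) HA => k; rewrite mul1r nrmM ler_wpM2l ?nrm_ge0 //.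
  exact: le_trans (pow_coef2_le _ _) (le2 k).
have g0 s : nrm s <= nrm t + 2 -> geo (1 * A) (fun k => d k * s ^+ k).
  move=> st; apply: (geo_dominated ler01 T0) HA => k.
  by rewrite mul1r nrmM nrmX ler_wpM2l ?nrm_ge0 // lerXn2r ?nnegrE ?nrm_ge0.
exists (csum u1), (csum u2), (2 * A), 1; split => // h /ltW h1.
have gt := g0 t; have gth := g0 (t + h).
rewrite lerDl ler0n in gt; have {}gt := gt isT.
have {}gth : geo (1 * A) (fun k => d k * (t + h) ^+ k).
  apply: gth; apply: le_trans (nrmD _ _) _; rewrite lerD2l.
  by apply: le_trans h1 _; rewrite ler1n.
have e1 := csumB gth gt.
have gg1 := geoD gth (geoZ (-1) gt).
have {}gg1 : geo (1 * A + nrm (-1) * (1 * A)) (fun k => d k * (t + h) ^+ k - d k * t ^+ k).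
  by move=> k; have := gg1 k; rewrite mulN1r.
have e2 := csumB gg1 (geoZ h g1).
have gg2 : geo (1 * A + nrm (-1) * (1 * A) + nrm (-1) * (nrm h * (1 * A))) (fun k => d k * (t + h) ^+ k - d k * t ^+ k - h * u1 k).
  by move=> k; have := geoD gg1 (geoZ (-1) (geoZ h g1)) k; rewrite mulN1r.
have e3 := csumB gg2 (geoZ (h ^+ 2) g2).
rewrite (csumZ _ g2) e2 (csumZ _ g1) e1 in e3.
rewrite /pser -e3.
have -> : 2 * A * nrm h ^+ 3 = 2 * (nrm h ^+ 3 * A) by ring.
apply: csum_le; apply: (geo_dominated _ T0) HA; first by rewrite exprn_ge0 ?nrm_ge0.
move=> k; rewrite (_ : _ - _ = d k * ((t + h) ^+ k - t ^+ k - h * pow_coef1 t k - h ^+ 2 * pow_coef2 t k)); last first.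
  by rewrite /u1 /u2; ring.
by rewrite nrmM mulrCA ler_wpM2l ?nrm_ge0 //; exact: pow_taylor2.
Qed.

Lemma pser_divdiff t : has_divdiff pser t.
Proof. exact: taylor2_divdiff pser_taylor2 t. Qed.

End PowerSeries.

(** * The complex exponential *)

Section Exponential.
Variable R : realType.
Local Notation C := (R[i]).
Local Notation nrm := (@nrm R).

Lemma pow2_fact k : (2 ^ k <= 2 * k`!)%N.
Proof.
elim: k => // -[//|k] IH; rewrite expnS factS mulnCA leq_mul //.
Qed.

Lemma csum_real A (u : nat -> R) : geo A (fun k => (u k)%:C) ->
  csum (fun k => (u k)%:C) = (limn (series u))%:C.
Proof.
move=> uA; have [cu _] : cvgn (series u) /\ `|limn (series u)| <= 2 * A.
  by apply: geo_series_R => k; have := uA k; rewrite nrmR.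
apply: csum_uniq; apply/cvg_nrmP => e e0.
have /cvgrPdist_lt /(_ _ e0) [N _ H] := cu.
exists N => n /H /=; rewrite distrC -(nrmR (_ - _)) rmorphB /=; congr (nrm (_ - _) < _).
by rewrite /series /= rmorph_sum.
Qed.

(** The series of exp, cos and sin have terms at most |x|^k / k!; the terms of index
    at least 3 are compared with a geometric series. *)
Lemma real_tail (u : nat -> R) (x : R) : `|x| <= 1 ->
  (forall k, `|u k| <= `|x| ^+ k / k`!%:R) ->
  `|limn (series u) - (u 0%N + u 1%N + u 2%N)| <= 2 * `|x| ^+ 3.
Proof.
move=> x1 ux; have x0 := normr_ge0 x.
have fk k : (k`!%:R)^-1 <= 2 / 2 ^+ k :> R.
  rewrite ler_pdivlMr ?exprn_gt0 // ler_pdivrMl ?ltr0n ?fact_gt0 //.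
  by rewrite mulrC -natrX -natrM ler_nat pow2_fact.
have g0 : geo 2 (fun k => (u k)%:C).
  move=> k; rewrite nrmR; apply: le_trans (ux k) _; apply: le_trans (fk k).
  by rewrite ler_piMl ?invr_ge0 ?ler0n // exprn_ile1.
have g3 : geo (`|x| ^+ 3) (fun k => (u k.+3)%:C).
  move=> k; rewrite nrmR; apply: le_trans (ux _) _.
  rewrite -[k.+3]addn3 exprD mulrAC mulrC.
  have k1 : `|x| ^+ k / (k + 3)`!%:R <= (2 ^+ k)^-1.
    apply: (@le_trans _ _ ((k + 3)`!%:R)^-1).
      by rewrite ler_piMl ?invr_ge0 ?ler0n // exprn_ile1.
    apply: le_trans (fk _) _; rewrite exprD invfM mulrCA ler_piMr ?invr_ge0 ?exprn_ge0 //.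
    by rewrite ler_pdivrMr ?exprn_gt0 // mul1r -natrX ler_nat.
  by rewrite ler_wpM2l // exprn_ge0.
have e0 := csum_real g0.
have := csum_le g3; rewrite -(nrmR (limn _ - _)) rmorphB /= -e0.
rewrite (csum_recl g0) (csum_recl (geo_shift g0)) (csum_recl (geo_shift (geo_shift g0))).
rewrite !rmorphD /= (_ : _ - _ = csum (fun k : nat => (u k.+3)%:C)) //; ring.
Qed.

Lemma cexpD (a b : C) : cexp (a + b) = cexp a * cexp b.
Proof.
rewrite /cexp !raddfD /= expRD cosD sinD.
apply/eqP; rewrite eq_complex /=; apply/andP; split; apply/eqP; ring.
Qed.

Lemma cexp0 : cexp 0 = 1 :> C.
Proof.
rewrite /cexp /= expR0 cos0 sin0; apply/eqP; rewrite eq_complex /=.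
by rewrite !mulr0 !mul0r subr0 addr0 mulr1 !eqxx.
Qed.

Lemma nrm_cexp (z : C) : nrm (cexp z) = expR (complex.Re z).
Proof.
rewrite /cexp nrmM nrmR ger0_norm ?expR_ge0 //.
by rewrite /nrm normc_def /= cos2Dsin2 sqrtr1 mulr1.
Qed.

Lemma expR_tail (x : R) : `|x| <= 1 -> `|expR x - (1 + x + x ^+ 2 / 2)| <= 2 * `|x| ^+ 3.
Proof.
move=> x1; have := @real_tail (exp_coeff x) x x1.
rewrite /exp_coeff /= !expr0 !fact0 !divr1 expr1; apply => k.
by rewrite normrM normrX normfV normr_nat.
Qed.

Lemma cos_tail (x : R) : `|x| <= 1 -> `|cos x - (1 - x ^+ 2 / 2)| <= 2 * `|x| ^+ 3.
Proof.
move=> x1; have := @real_tail (cos_coeff x) x x1; rewrite -[limn _]/(limn (series (cos_coeff x))).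
rewrite cos.unlock /cos_coeff /= !expr0 !fact0 !divr1 expr1 !mul0r addr0 !mul1r mulN1r.
rewrite mulNr; apply => k.
rewrite normrM normfV normr_nat normrM ler_wpM2r ?invr_ge0 //.
rewrite normrX ler_piMl ?exprn_ge0 // normrM normrX normrN1 expr1n mulr1.
by case: odd => /=; rewrite ?normr1 ?normr0.
Qed.

Lemma sin_tail (x : R) : `|x| <= 1 -> `|sin x - x| <= 2 * `|x| ^+ 3.
Proof.
move=> x1; have := @real_tail (sin_coeff x) x x1; rewrite -[limn _]/(limn (series (sin_coeff x))).
rewrite sin.unlock /sin_coeff /= !mul0r add0r addr0 expr0 !mul1r expr1 divr1.
apply => k.
rewrite normrM normfV normr_nat normrM ler_wpM2r ?invr_ge0 //.
rewrite normrX ler_piMl ?exprn_ge0 // normrM normrX normrN1 expr1n mulr1.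
by case: odd => /=; rewrite ?normr1 ?normr0.
Qed.

(** Substitute the expansions of exp, cos and sin of order two.  The constant 40 is
    not sharp: it bounds the sum of the cross terms, each of which is at most a
    multiple of |h|^3. *)
Lemma cexp_taylor2 : taylor2 (@cexp R) 0.
Proof.
exists 1, ((2^-1)%:C), 40, 1; split => // h h1.
case: h h1 => x y; set n := nrm _ => n1.
have n0 : 0 <= n by exact: nrm_ge0.
have xn : `|x| <= n := nrm_Re (x +i* y).
have yn : `|y| <= n := nrm_Im (x +i* y).
have x1 : `|x| <= 1 by apply: le_trans xn (ltW n1).
have y1 : `|y| <= 1 by apply: le_trans yn (ltW n1).
have x3 : `|x| ^+ 3 <= n ^+ 3 by rewrite lerXn2r ?nnegrE.
have y3 : `|y| ^+ 3 <= n ^+ 3 by rewrite lerXn2r ?nnegrE.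
have n3 : 0 <= n ^+ 3 by exact: exprn_ge0.
have := expR_tail x1; set r := expR x - _ => hr.
have := cos_tail y1; set s := cos y - _ => hs.
have := sin_tail y1; set s' := sin y - _ => hs'.
have ex : expR x = 1 + x + x ^+ 2 / 2 + r by rewrite /r; ring.
have ey : cos y = 1 - y ^+ 2 / 2 + s by rewrite /s; ring.
have sy : sin y = y + s' by rewrite /s'; ring.
have m3 (a b c : R) : `|a| <= n -> `|b| <= n -> `|c| <= n -> `|a * b * c| <= n ^+ 3.
  move=> an bn cn; rewrite !normrM (_ : n ^+ 3 = n * n * n); last by ring.
  by rewrite !ler_pM // mulr_ge0.
have m1 (a b B A : R) : `|a| <= A -> `|b| <= B -> `|a * b| <= A * B.
  by move=> aA bB; rewrite normrM ler_pM.
have P1 := m3 x y y xn yn yn.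
have P2 := m3 x x y xn xn yn.
have P3 : `|x * y * y * x| <= n ^+ 3 by have := m1 _ _ _ _ P1 x1; rewrite mulr1.
have cb : `|cos y| <= 1 by rewrite ler_norml cos_geN1 cos_le1.
have sb : `|sin y| <= 1 by rewrite ler_norml sin_geN1 sin_le1.
have P4 := m1 _ _ _ _ hr cb; have P5 := m1 _ _ _ _ hr sb.
have xx1 : `|1 + x + x ^+ 2 / 2| <= 3.
  have := m1 _ _ _ _ x1 x1; move: x1; rewrite !ler_norml => /andP[? ?] /andP[? ?].
  by apply/andP; split; rewrite expr2; lra.
have P6 := m1 _ _ _ _ hs xx1; have P7 := m1 _ _ _ _ hs' xx1.
apply: le_trans (nrm_le_ReIm _) _ => /=.
have -> : 40 * n ^+ 3 = 20 * n ^+ 3 + 20 * n ^+ 3 by ring.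
rewrite !add0r expR0 cos0 sin0.
pose E := 1 + x + x ^+ 2 / 2.
set A1 := (X in `|X| + _); set A2 := (X in _ + `|X|).
rewrite (_ : A1 = - (x * y * y) / 2 - (x * y * y * x) / 4 + s * E + r * cos y); last first.
  by rewrite /A1 /E /s /r; field.
rewrite (_ : A2 = (x * x * y) / 2 + s' * E + r * sin y); last first.
  by rewrite /A2 /E /s' /r; field.
move: P1 P2 P3 P4 P5 P6 P7; rewrite -/E !ler_norml.
move=> /andP[? ?] /andP[? ?] /andP[? ?] /andP[? ?] /andP[? ?] /andP[? ?] /andP[? ?].
by apply: lerD; rewrite ler_norml; apply/andP; split; lra.
Qed.

(** The functional equation transports the expansion at 0 to c. *)
Lemma cexp_divdiff (c : C) : has_divdiff (@cexp R) c.
Proof.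
apply: taylor2_divdiff => {}c; have [d1 [d2 [B [r [r0 H]]]]] := cexp_taylor2.
exists (cexp c * d1), (cexp c * d2), (nrm (cexp c) * B), r; split => // h hr.
rewrite (_ : _ - _ = cexp c * (cexp (0 + h) - cexp 0 - h * d1 - h ^+ 2 * d2)); last first.
  by rewrite add0r cexpD cexp0; ring.
by rewrite nrmM -mulrA ler_wpM2l ?nrm_ge0 // H.
Qed.

Definition twopii : C := 0 +i* (2 * trigo.pi).

Lemma e2piD (a b : C) : e2pi (a + b) = e2pi a * e2pi b.
Proof. by rewrite /e2pi mulrDr cexpD. Qed.

Lemma e2pi0 : e2pi 0 = 1 :> C.
Proof. by rewrite /e2pi mulr0 cexp0. Qed.

Lemma nrm_e2pi (z : C) : nrm (e2pi z) = expR (- (2 * trigo.pi * complex.Im z)).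
Proof. by rewrite /e2pi nrm_cexp; case: z => x y /=; rewrite mul0r sub0r. Qed.

Lemma e2pi_neq0 (z : C) : e2pi z != 0.
Proof. by rewrite -nrm_gt0 nrm_e2pi expR_gt0. Qed.

Lemma e2piN (z : C) : e2pi (- z) = (e2pi z)^-1.
Proof.
by apply: (mulfI (e2pi_neq0 z)); rewrite -e2piD subrr e2pi0 divff // e2pi_neq0.
Qed.

Lemma e2pi_nat (z : C) (k : nat) : e2pi (k%:R * z) = e2pi z ^+ k.
Proof.
elim: k => [|k IH]; first by rewrite mul0r e2pi0.
by rewrite -natr1 mulrDl mul1r e2piD IH exprSr.
Qed.

Lemma e2pi1 : e2pi 1 = 1 :> C.
Proof.
rewrite /e2pi mulr1 /cexp /= expR0 mulr_natl cos2pi sin2pi.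
by rewrite mul1r.
Qed.

Lemma e2pi_divdiff (c : C) : has_divdiff (@e2pi R) c.
Proof.
have lin t : has_divdiff (fun z : C => twopii * z) t.
  exists (fun=> twopii); split; first by apply: nearCT => s; exact: hol_cst1.
  by apply: nearCT => s; ring.
apply: (divdiff_comp (f := fun z => twopii * z) (g := @cexp R)) => //.
  by apply: nearCT => s; exact: divdiff_hol.
exact: cexp_divdiff.
Qed.

(** The modulus shows that z is real; on the fractional part of z, in [0, 1), the
    equation cos (2 pi f) = 1 forces sin (pi f) = 0. *)
Lemma e2pi_eq1 (z : C) : e2pi z = 1 -> exists a : int, z = a%:~R.
Proof.
move=> e1; have pi0 := @trigo.pi_gt0 R.
have : expR (- (2 * trigo.pi * complex.Im z)) = expR 0.
  by rewrite expR0 -nrm_e2pi e1 nrm1.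
move=> /expR_inj /eqP; rewrite oppr_eq0 mulf_eq0 => /orP[|/eqP y0].
  by rewrite mulf_eq0 pnatr_eq0 /= gt_eqF.
move: e1; case: z y0 => x y /= -> e1.
pose f := x - (Num.floor x)%:~R.
have f01 : 0 <= f < 1 by have := Num.Theory.floor_itv x; rewrite /f intrD subr_ge0 ltrBlDl.
have per (b : int) : e2pi (b%:~R : C) = 1.
  case: b => k; first by have := e2pi_nat 1 k; rewrite mulr1 e2pi1 expr1n.
  by rewrite NegzE mulrNz e2piN; have := e2pi_nat 1 k.+1; rewrite mulr1 e2pi1 expr1n => ->; rewrite invr1.
have ef : e2pi (f%:C) = 1.
  rewrite -e1 (_ : (x +i* 0) = f%:C + (Num.floor x)%:~R); first by rewrite e2piD per mulr1.
  by rewrite /f rmorphB /= rmorph_int subrK.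
have : complex.Re (e2pi (f%:C)) = 1 by rewrite ef.
have -> : complex.Re (e2pi f%:C) = cos (2 * trigo.pi * f).
  by rewrite /e2pi /cexp /= (_ : 0 * f - _ = 0) ?expR0; [rewrite (_ : 0 * 0 + _ = 2 * trigo.pi * f); ring|ring].
have -> : 2 * trigo.pi * f = (trigo.pi * f) *+ 2 by rewrite mulr2n; ring.
rewrite cos_mulr2n => c1.
have s0 : sin (trigo.pi * f) = 0.
  apply/eqP; rewrite -sqrf_eq0 sin2cos2; apply/eqP; move: c1; rewrite mulr2n => c1; lra.
exists (Num.floor x); rewrite -[LHS]/(x%:C) -(rmorph_int (real_complex R)); congr (_%:C).
case/andP: f01 => f0 f1; move: f0; rewrite le_eqVlt => /predU1P[f0|f0].
  by apply/eqP; rewrite -subr_eq0 -/f -f0.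
have /sin_gt0_pi : 0 < trigo.pi * f < trigo.pi by rewrite mulr_gt0 //= gtr_pMr.
by rewrite s0 ltxx.
Qed.

End Exponential.

(** * The theta function *)

Section ThetaSeries.
Variable R : realType.
Local Notation C := (R[i]).
Local Notation nrm := (@nrm R).
Variable eta : C.
Hypothesis eta0 : 0 < complex.Im eta.
Let q : C := e2pi eta.
Let rho : R := nrm q.

Lemma q_neq0 : q != 0. Proof. exact: e2pi_neq0. Qed.

Lemma rho_gt0 : 0 < rho. Proof. by rewrite nrm_gt0 q_neq0. Qed.

Lemma rho_lt1 : rho < 1.
Proof.
rewrite /rho nrm_e2pi -[ltRHS]expR0 ltr_expR oppr_lt0.
by rewrite !mulr_gt0 // trigo.pi_gt0.
Qed.

Let rho01 : 0 <= rho < 1. Proof. by rewrite (ltW rho_gt0) rho_lt1. Qed.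

(** C(k,2) = k(k-1)/2: the coefficient of t^k in theta, written as a Laurent series
    in t = e2pi z.  The coefficients of negative index are the same up to a shift. *)
Definition theta_coef (k : nat) : C := (-1) ^+ k * e2pi eta ^+ 'C(k, 2).

(** The ratio of consecutive terms tends to 0, so that the terms decrease from some
    index on. *)
Lemma theta_coef_entire : entire_coef theta_coef.
Proof.
move=> T T0; pose a k := nrm (theta_coef k) * T ^+ k.
have a0 k : 0 <= a k by rewrite mulr_ge0 ?nrm_ge0 // exprn_ge0.
have aS k : a k.+1 = a k * (rho ^+ k * T).
  rewrite /a /theta_coef !nrmM !nrmX nrmN nrm1 !expr1n !mul1r binS bin1 -/q -/rho exprD exprS.
  by ring.
have T1 : 0 < (T + 1)^-1 by rewrite invr_gt0 ltr_pwDr.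
have [N HN] := pow_small rho01 T1.
have aN k : (N <= k)%N -> a k.+1 <= a k.
  move=> /HN /ltW H; rewrite aS ler_piMr //.
  apply: (@le_trans _ _ ((T + 1)^-1 * T)); first by rewrite ler_wpM2r.
  by rewrite ler_pdivrMl ?ltr_pwDr // mulr1 lerDl.
exists (\sum_(k < N.+1) a k) => k; rewrite -/(a k).
have [kN|kN] := leqP k N.
  rewrite (bigD1 (Ordinal (kN : (k < N.+1)%N))) //= lerDl.
  by apply: sumr_ge0.
have aNS : a N <= \sum_(k < N.+1) a k by rewrite big_ord_recr /= lerDr sumr_ge0.
apply: le_trans aNS; elim: k kN => // k IH; rewrite ltnS leq_eqVlt => /predU1P[<-|Nk].
  exact: aN.
by apply: le_trans (aN _ (ltnW Nk)) _; exact: IH.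
Qed.

Local Notation F := (pser theta_coef).

Lemma e2pi_half (m : nat) (b : int) : b = (m * 2)%:Z ->
  e2pi (b%:~R / 2 * eta) = e2pi eta ^+ m.
Proof.
move=> ->; rewrite -e2pi_nat -[_%:~R]/((m * 2)%:R) natrM mulfK //.
Qed.

Lemma theta_term_pos (z : C) (k : nat) : theta_term eta z k%:Z = theta_coef k * e2pi z ^+ k.
Proof.
rewrite /theta_term /theta_coef -[(-1) ^ k%:Z]/((-1) ^+ k) e2piD (@e2pi_half 'C(k, 2)).
  rewrite -[k%:Z%:~R]/(k%:R) e2pi_nat.
  by move: (e2pi z ^+ k) (e2pi eta ^+ _) => a b; ring.
rewrite bin2 muln2; case: k => [|k] //.
have -> : (k.+1%:Z - 1) = k%:Z by lia.
by rewrite -PoszM /= -[in LHS](odd_double_half (k.+1 * k)) oddM /= andNb.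
Qed.

(** The term of index -(k+1) is expressed by the coefficient of index k + 2 of the
    same power series, since both exponents of q equal (k+2)(k+1)/2. *)
Lemma theta_term_neg (z : C) (k : nat) : theta_term eta z (- k.+1%:Z) =
  - e2pi z * (theta_coef k.+2 * (e2pi z)^-1 ^+ k.+2).
Proof.
rewrite /theta_term /theta_coef -[(-1) ^ (- k.+1%:Z)]exprnN.
have -> : ((-1) ^- k.+1 : C) = - (-1) ^+ k.+2.
  by rewrite -exprVn invrN1 [in RHS]exprS mulN1r opprK.
rewrite e2piD; have -> : e2pi ((- k.+1%:Z)%:~R * z) = e2pi z * (e2pi z)^-1 ^+ k.+2.
  rewrite [in RHS]exprS mulrA divff ?e2pi_neq0 // mul1r -e2piN -e2pi_nat.
  by congr e2pi; rewrite rmorphN /= mulNr mulrN.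
rewrite (@e2pi_half 'C(k.+2, 2)).
  by move: ((e2pi z)^-1 ^+ k.+2) (e2pi eta ^+ _) (_ ^+ k.+2) (e2pi z) => a b c d; ring.
have -> : (- k.+1%:Z * (- k.+1%:Z - 1)) = (k.+2 * k.+1)%N by lia.
by rewrite bin2 muln2 -[in LHS](odd_double_half (k.+2 * k.+1)) oddM /= andNb.
Qed.

Lemma theta_coef_geo t : exists A, geo A (fun k => theta_coef k * t ^+ k).
Proof. by have [A /(_ t (lexx _))] := pser_geo theta_coef_entire (nrm_ge0 t); exists A. Qed.

Lemma theta_coef0 : theta_coef 0 = 1. Proof. by rewrite /theta_coef !expr0 mulr1. Qed.
Lemma theta_coef1 : theta_coef 1 = -1. Proof. by rewrite /theta_coef expr1 expr0 mulr1. Qed.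

(** The two halves of the Laurent series are the same entire power series at t and
    at 1/t; the last terms correct for the first two coefficients. *)
Lemma thetaE (z : C) : theta eta z = F (e2pi z) - e2pi z * F (e2pi z)^-1 + e2pi z - 1.
Proof.
set t := e2pi z; have [A gA] := theta_coef_geo t^-1.
have t0 : t != 0 by exact: e2pi_neq0.
rewrite /theta -[limn _]/(csum (fun k : nat => theta_term eta z k%:Z)).
rewrite -[X in _ + X]/(csum (fun k : nat => theta_term eta z (- k.+1%:Z))).
rewrite (_ : (fun k : nat => theta_term eta z k%:Z) = fun k => theta_coef k * t ^+ k); last first.
  by apply/funext => k; rewrite theta_term_pos.
rewrite (_ : (fun k : nat => theta_term eta z (- k.+1%:Z)) = fun k => (- t) * (theta_coef k.+2 * t^-1 ^+ k.+2)); last first.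
  by apply/funext => k; rewrite theta_term_neg.
rewrite (csumZ (- t) (geo_shift (geo_shift gA))) -/(pser theta_coef t).
have -> : csum (fun k => theta_coef k.+2 * t^-1 ^+ k.+2) = F t^-1 - 1 + t^-1.
  rewrite /pser (csum_recl gA) (csum_recl (geo_shift gA)) theta_coef0 theta_coef1 expr0 expr1.
  by ring.
by clearbody t; move: (F t) (F t^-1) => a b; field.
Qed.

Lemma thetaN (z : C) : theta eta (- z) = - e2pi (- z) * theta eta z.
Proof.
rewrite !thetaE e2piN invrK; have := e2pi_neq0 z; move: (e2pi z) => t t0.
by move: (F t) (F t^-1) => a b; field.
Qed.

Lemma theta0 : theta eta 0 = 0.
Proof. by rewrite thetaE e2pi0 invr1; ring. Qed.

Lemma thetaD1 (z : C) : theta eta (z + 1) = theta eta z.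
Proof. by rewrite !thetaE e2piD e2pi1 mulr1. Qed.

(** Multiplying t by q shifts the coefficients by one index. *)
Lemma F_shift (t : C) : t != 0 -> F (q * t) = t^-1 * (1 - F t).
Proof.
move=> t0; have [A gA] := theta_coef_geo t.
rewrite [F t]/pser (csum_recl gA) theta_coef0 expr0 mulr1 opprD addrA subrr sub0r mulrN -mulNr.
rewrite -(csumZ _ (geo_shift gA)) /pser; congr csum; apply/funext => k.
rewrite /theta_coef binS bin1 -/q; clearbody q.
rewrite exprMn exprD [t ^+ k.+1]exprS [(-1) ^+ k.+1]exprS.
move: (_ ^+ k) (_ ^+ _) (_ ^+ _) (_ ^+ _) => a b c d.
by field.
Qed.

Lemma thetaDeta (z : C) : theta eta (z + eta) = - e2pi (- z) * theta eta z.
Proof.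
rewrite !thetaE e2piD e2piN; have := e2pi_neq0 z; move: (e2pi z) => t t0.
have q0 := q_neq0; rewrite -/q mulrC F_shift //.
have qt0 : (q * t)^-1 != 0 by rewrite invr_eq0 mulf_neq0.
have := F_shift qt0; have -> : q * (q * t)^-1 = t^-1 by rewrite invfM mulVKf.
rewrite invrK => ->.
move: q0; move: (F t) (F _) => a b; clearbody q => q0.
by field.
Qed.

(** theta is built from an entire power series and exponentials. *)
Lemma theta_divdiff (c : C) : has_divdiff (theta eta) c.
Proof.
rewrite (_ : theta eta = fun z => F (e2pi z) + - (e2pi z * F (e2pi (- z))) + e2pi z + -1); last first.
  by apply/funext => z; rewrite thetaE e2piN.
have he t : nearC t (hol (@e2pi R)) by apply: nearCT => s; exact: divdiff_hol (e2pi_divdiff s).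
have dFe t : has_divdiff (fun z => F (e2pi z)) t.
  by apply: (divdiff_comp (he t) (e2pi_divdiff t)); exact: (pser_divdiff theta_coef_entire).
have dN t : has_divdiff (fun z : C => - z) t.
  exists (fun=> -1); split; first by apply: nearCT => s; exact: hol_cst1.
  by apply: nearCT => s; ring.
have dFeN t : has_divdiff (fun z => F (e2pi (- z))) t.
  apply: (divdiff_comp (f := fun z : C => - z) (g := fun z => F (e2pi z))) => //.
  by apply: nearCT => s; exact: divdiff_hol (dN s).
apply: divdiffD; last exact: divdiff_cst.
apply: divdiffD; last exact: e2pi_divdiff.
apply: divdiffD; first exact: dFe.
apply: divdiffN; apply: divdiffM; [exact: he|exact: e2pi_divdiff|exact: dFeN].
Qed.

Lemma theta_hol (c : C) : hol (theta eta) c.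
Proof. exact: divdiff_hol (theta_divdiff c). Qed.

Lemma GammaD a b : Gamma eta a -> Gamma eta b -> Gamma eta (a + b).
Proof.
move=> [x [y ->]] [x' [y' ->]]; exists (x + x'), (y + y').
by rewrite !rmorphD /=; ring.
Qed.

Lemma GammaN a : Gamma eta a -> Gamma eta (- a).
Proof. by move=> [x [y ->]]; exists (- x), (- y); rewrite !rmorphN /=; ring. Qed.

Lemma GammaB a b : Gamma eta a -> Gamma eta b -> Gamma eta (a - b).
Proof. by move=> ? /GammaN; exact: GammaD. Qed.

(** theta(0) = 0 and quasi-periodicity. *)
Lemma theta_Gamma (z : C) : Gamma eta z -> theta eta z = 0.
Proof.
move=> [a [b ->]].
have step1 (w : C) (k : nat) : theta eta w = 0 -> theta eta (w + k%:R) = 0.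
  by move=> w0; elim: k => [|k IH]; rewrite ?addr0 // -natr1 addrA thetaD1.
have step1' (w : C) (k : nat) : theta eta w = 0 -> theta eta (w - k%:R) = 0.
  move=> w0; elim: k => [|k IH]; rewrite ?subr0 //.
  by rewrite -[RHS]IH -thetaD1 -natr1 opprD addrA subrK.
have step2 (w : C) (k : nat) : theta eta w = 0 -> theta eta (w + k%:R * eta) = 0.
  move=> w0; elim: k => [|k IH]; first by rewrite mul0r addr0.
  by rewrite -natr1 mulrDl mul1r addrA thetaDeta IH mulr0.
have step2' (w : C) (k : nat) : theta eta w = 0 -> theta eta (w - k%:R * eta) = 0.
  move=> w0; elim: k => [|k IH]; first by rewrite mul0r subr0.
  move: IH; rewrite (_ : w - k%:R * eta = w - k.+1%:R * eta + eta); last first.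
    by rewrite -natr1; ring.
  by rewrite thetaDeta => /eqP; rewrite mulf_eq0 oppr_eq0 (negbTE (e2pi_neq0 _)) => /eqP.
have step a' : theta eta (a'%:~R : C) = 0.
  by case: a' => k; rewrite -[X in theta _ X]add0r ?NegzE ?rmorphN; [apply: step1|apply: step1']; exact: theta0.
by case: b => k; rewrite ?NegzE ?rmorphN /= ?mulNr; [apply: step2|apply: step2'].
Qed.

End ThetaSeries.

(** * The finite form of the Jacobi triple product *)

Lemma bin2D a b : 'C(a + b, 2) = ('C(a, 2) + 'C(b, 2) + a * b)%N.
Proof.
elim: b => [|b IH]; first by rewrite !addn0 muln0 addn0.
by rewrite addnS !binS !bin1 IH; lia.
Qed.

(** With [bin2_sub], the comparison of the exponents of q in the terms of the triple
    product at distance k from the middle one. *)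
Lemma bin2_add N k : (k <= N)%N ->
  ('C(N + k, 2) + N * (N - k) = N * N + 'C(N, 2) + 'C(k, 2))%N.
Proof.
move=> kN; rewrite bin2D mulnBr; have := leq_mul (leqnn N) kN; lia.
Qed.

Lemma bin2_sub N k : (k < N)%N ->
  ('C(N - k.+1, 2) + N * (N + k.+1) = N * N + 'C(N, 2) + 'C(k.+2, 2))%N.
Proof.
move=> kN; have [m Nm] : exists m, N = (m + k.+1)%N by exists (N - k.+1)%N; rewrite subnK.
have sq : (k.+1 * k.+1 = 'C(k.+1, 2) + 'C(k.+1, 2) + k.+1)%N.
  by elim: (k.+1) => // j IH; rewrite !binS !bin1; lia.
rewrite Nm addnK bin2D (binS k.+1 1) bin1.
move: sq; move: 'C(_, 2) 'C(_, 2) => c d; nia.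
Qed.

Section QBinomial.
Variable (K : fieldType) (q : K).

(** The q-Pochhammer symbol (x; q)_n. *)
Definition qpoch (x : K) n := \prod_(i < n) (1 - x * q ^+ i).

Lemma qpochS x n : qpoch x n.+1 = qpoch x n * (1 - x * q ^+ n).
Proof. by rewrite /qpoch big_ord_recr. Qed.

Lemma qpoch0 x : qpoch x 0 = 1.
Proof. by rewrite /qpoch big_ord0. Qed.

Lemma qpochD x m n : qpoch x (m + n) = qpoch x m * qpoch (x * q ^+ m) n.
Proof.
elim: n => [|n IH]; first by rewrite addn0 qpoch0 mulr1.
by rewrite addnS !qpochS IH exprD !mulrA.
Qed.

Hypothesis q_free : forall n, qpoch q n != 0.

(** The Gaussian binomial coefficient; [q_free] makes the denominators nonzero. *)
Definition qbin n j := qpoch q n / (qpoch q j * qpoch q (n - j)).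

Lemma qbin_pascal n j : (j < n)%N ->
  qbin n.+1 j.+1 = qbin n j.+1 + q ^+ (n - j) * qbin n j.
Proof.
move=> jn; rewrite /qbin subSS; have [m nE] : exists m, n = (j + m.+1)%N.
  by exists (n - j).-1; rewrite prednK ?subn_gt0 // subnKC // ltnW.
subst n; rewrite (_ : (j + m.+1 - j.+1)%N = m); last by lia.
rewrite (_ : (j + m.+1 - j)%N = m.+1); last by lia.
have cE k : qpoch q k.+1 = qpoch q k * (1 - q ^+ k.+1) by rewrite qpochS exprS.
have f0 k : 1 - q ^+ k.+1 != 0.
  by apply: contra (q_free k.+1) => /eqP f0; rewrite cE f0 mulr0.
rewrite !cE (_ : (j + m.+1).+1 = (j.+1 + m.+1)%N); last by lia.
rewrite [q ^+ (_ + _)]exprD; have := f0 j; have := f0 m.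
have := q_free m; have := q_free j.
move: (q ^+ j.+1) (q ^+ m.+1) (qpoch q j) (qpoch q m) (qpoch q (j + m.+1)).
by move=> a' b' c' d' e' *; field; apply/and4P.
Qed.

(** The q-binomial theorem, in the homogeneous form which allows the substitution of
    a power of q for y. *)
Lemma qbinomial (x y : K) n : \prod_(k < n) (y + x * q ^+ k) =
  \sum_(j < n.+1) q ^+ 'C(j, 2) * qbin n j * x ^+ j * y ^+ (n - j).
Proof.
have qb0 m : qbin m 0 = 1 by rewrite /qbin qpoch0 subn0 mul1r divff.
have qbn m : qbin m m = 1 by rewrite /qbin subnn qpoch0 mulr1 divff.
elim: n => [|n IH].
  by rewrite big_ord0 big_ord_recl big_ord0 /= qb0 !expr0 !mulr1 addr0.
rewrite big_ord_recr IH /= mulrDr.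
rewrite [in X in X * y]big_ord_recl [in X in X * (x * _)]big_ord_recr.
rewrite [RHS]big_ord_recl [X in _ = _ + X]big_ord_recr /=.
rewrite !qb0 !qbn !subn0 !subnn !expr0 !mulr1 !mul1r.
rewrite mulrDl [X in _ + X]mulrDl addrACA !addrA; congr (_ + _); last first.
  by rewrite binS bin1 exprD exprS; ring.
rewrite exprS -mulrC -!addrA; congr (_ + _).
rewrite addrC !mulr_suml -big_split /=; apply: eq_bigr => i _.
rewrite /bump /= !add1n subSS qbin_pascal //.
rewrite (_ : (n - i)%N = (n - i.+1).+1); last by rewrite subnSK.
rewrite binS bin1 exprD !exprS.
rewrite (_ : q ^+ n = q ^+ i * (q * q ^+ (n - i.+1))); last first.
  by rewrite -exprS -exprD; congr (_ ^+ _); have := ltn_ord i; lia.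
by ring.
Qed.

End QBinomial.

Section TripleProduct.
Variable (K : fieldType) (q : K).
Hypothesis q0 : q != 0.
Hypothesis q_free : forall n, qpoch q q n != 0.

(** The q-binomial theorem with 2N factors, x = -t and y = q^N: the first N factors
    give (q/t; q)_N and the others (t; q)_N, up to the common factor M, which also
    occurs in every term of the sum. *)
Lemma triple_product (t : K) N : t != 0 ->
  qpoch q t N * qpoch q (q / t) N =
  \sum_(k < N.+1) (- t) ^+ k * q ^+ 'C(k, 2) * qbin q (2 * N) (N + k) +
  \sum_(k < N) (- t) ^- k.+1 * q ^+ 'C(k.+2, 2) * qbin q (2 * N) (N - k.+1).
Proof.
(* The product of the powers of q and t taken out of the 2N factors. *)
move=> t0; pose M := q ^+ (N * N) * (- t) ^+ N * q ^+ 'C(N, 2).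
have nt0 : - t != 0 by rewrite oppr_eq0.
have M0 : M != 0 by rewrite !mulf_neq0 // expf_neq0.
apply: (mulfI M0).
have := qbinomial q_free (- t) (q ^+ N) (2 * N).
have -> : \prod_(k < 2 * N) (q ^+ N + - t * q ^+ k) = M * (qpoch q t N * qpoch q (q / t) N).
  rewrite mul2n -addnn big_split_ord /= (reindex_inj rev_ord_inj) /=.
  have -> : \prod_(i < N) (q ^+ N + - t * q ^+ (N + i)) = q ^+ (N * N) * qpoch q t N.
    have -> : q ^+ (N * N) = \prod_(i < N) q ^+ N by rewrite prodr_const card_ord exprM.
    by rewrite -big_split /=; apply: eq_bigr => i _; rewrite exprD; ring.
  have -> : \prod_(i < N) (q ^+ N + - t * q ^+ (N - i.+1)) = (- t) ^+ N * q ^+ 'C(N, 2) * qpoch q (q / t) N.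
    have -> : (- t) ^+ N = \prod_(i < N) (- t) by rewrite prodr_const card_ord.
    have -> : q ^+ 'C(N, 2) = \prod_(i < N) q ^+ (N - i.+1).
      rewrite -bin2_sum big_mkord -expr_sum (reindex_inj rev_ord_inj) /=.
      by [].
    rewrite -!big_split /=; apply: eq_bigr => i _.
    rewrite (_ : q ^+ N = q ^+ (N - i.+1) * (q * q ^+ i)); last first.
      by rewrite -exprS -exprD subnK.
    by field.
  by rewrite /M; ring.
move=> ->; rewrite mulrDr [in X in _ + X]mulr_sumr [in X in X + _]mulr_sumr.
have <- : (N + N.+1)%N = (2 * N).+1 by lia.
rewrite big_split_ord /= addrC; congr (_ + _).
  apply: eq_bigr => k _.
  rewrite (_ : (2 * N - (N + k))%N = (N - k)%N); last by lia.
  rewrite -exprM /M.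
  have -> : q ^+ 'C(N + k, 2) * qbin q (2 * N) (N + k) * (- t) ^+ (N + k) * q ^+ (N * (N - k))
     = (q ^+ 'C(N + k, 2) * q ^+ (N * (N - k))) * ((- t) ^+ N * (- t) ^+ k) * qbin q (2 * N) (N + k).
    by rewrite exprD; ring.
  rewrite -exprD (_ : ('C(N + k, 2) + N * (N - k))%N = (N * N + 'C(N, 2) + 'C(k, 2))%N).
    by rewrite !exprD; ring.
  have kN : (k <= N)%N by rewrite -ltnS.
  exact: bin2_add.
rewrite (reindex_inj rev_ord_inj) /=; apply: eq_bigr => k _.
have kN := ltn_ord k.
rewrite (_ : (2 * N - (N - k.+1))%N = (N + k.+1)%N); last by lia.
rewrite -exprM /M.
have -> : (- t) ^+ N = (- t) ^+ (N - k.+1) * (- t) ^+ k.+1 by rewrite -exprD subnK.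
have -> : q ^+ (N * N) * ((- t) ^+ (N - k.+1) * (- t) ^+ k.+1) * q ^+ 'C(N, 2) * ((- t) ^- k.+1 * q ^+ 'C(k.+2, 2) * qbin q (2 * N) (N - k.+1)) =
   (q ^+ (N * N) * q ^+ 'C(N, 2) * q ^+ 'C(k.+2, 2)) * (- t) ^+ (N - k.+1) * qbin q (2 * N) (N - k.+1).
  have := expf_neq0 k.+1 nt0; move: ((- t) ^+ k.+1) ((- t) ^+ (N - k.+1)) (qbin _ _ _) (_ ^+ _) (_ ^+ _) (_ ^+ _) => a b c d e f a0.
  by field.
rewrite -!exprD -bin2_sub //.
by rewrite exprD; ring.
Qed.

End TripleProduct.

(** * The zeros of theta *)

Section QPochBounds.
Variable R : realType.
Local Notation C := (R[i]).
Local Notation nrm := (@nrm R).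
Variable q : C.
Let rho : R := nrm q.
Hypothesis rho0 : 0 < rho.
Hypothesis rho1 : rho < 1.

(** A bound, uniform in n, for the product of the 1 + x rho^i over i < n. *)
Definition qE (x : R) : R := expR (x / (1 - rho)).

Let rho01 : 0 <= rho < 1. Proof. by rewrite ltW. Qed.

Let r1 : 0 < 1 - rho. Proof. by rewrite subr_gt0. Qed.

Lemma qE_le x y : x <= y -> qE x <= qE y.
Proof. by move=> xy; rewrite ler_expR ler_pM2r // invr_gt0. Qed.

Let geomS n : (1 - rho ^+ n) / (1 - rho) + rho ^+ n = (1 - rho ^+ n.+1) / (1 - rho).
Proof. by rewrite exprS; field; rewrite gt_eqF. Qed.

Let geom_le n : (1 - rho ^+ n) / (1 - rho) <= (1 - rho)^-1.
Proof. by rewrite ler_piMl ?invr_ge0 ?(ltW r1) // lerBlDr lerDl exprn_ge0 // ltW. Qed.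

Lemma qpoch_le x n : nrm (qpoch q x n) <= qE (nrm x).
Proof.
have x0 := nrm_ge0 x.
apply: (@le_trans _ _ (expR (nrm x * ((1 - rho ^+ n) / (1 - rho))))); last first.
  by rewrite ler_expR ler_wpM2l.
elim: n => [|n IH]; first by rewrite qpoch0 nrm1 expr0 subrr mul0r mulr0 expR0.
rewrite qpochS nrmM -geomS mulrDr expRD.
apply: ler_pM => //; try exact: nrm_ge0.
apply: le_trans (expR_ge1Dx _); apply: le_trans (nrmB _ _) _.
by rewrite nrm1 nrmM nrmX.
Qed.

Lemma qpoch_sub1 x n : nrm (qpoch q x n - 1) <= qE (nrm x) * nrm x / (1 - rho).
Proof.
have x0 := nrm_ge0 x; have E0 : 0 <= qE (nrm x) by exact: expR_ge0.
apply: (@le_trans _ _ (qE (nrm x) * nrm x * ((1 - rho ^+ n) / (1 - rho)))); last first.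
  by rewrite ler_wpM2l // mulr_ge0.
elim: n => [|n IH]; first by rewrite qpoch0 subrr nrm0 expr0 subrr mul0r mulr0.
rewrite qpochS -geomS [leRHS]mulrDr.
rewrite (_ : _ - 1 = (qpoch q x n - 1) - qpoch q x n * (x * q ^+ n)); last by ring.
apply: le_trans (nrmB _ _) _; apply: lerD => //.
rewrite nrmM nrmM nrmX -mulrA ler_wpM2r ?mulr_ge0 ?exprn_ge0 ?(ltW rho0) //.
exact: qpoch_le.
Qed.

(** The first m factors are nonzero and fixed; for m large the product of the
    following ones is within 1/2 of 1. *)
Lemma qpoch_lower x : (forall i, x * q ^+ i != 1) ->
  exists c, 0 < c /\ exists m, forall n, (m <= n)%N -> c <= nrm (qpoch q x n).
Proof.
move=> xq; have x0 := nrm_ge0 x.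
have E0 : 0 < qE (nrm x) by exact: expR_gt0.
pose B := qE (nrm x) * nrm x / (1 - rho) + 1.
have B0 : 0 < B by rewrite ltr_pwDr // divr_ge0 ?(ltW r1) // mulr_ge0 // ltW.
have [m Hm] := pow_small rho01 (divr_gt0 (ltr01 : (0 < 1 :> R)) (mulr_gt0 (ltr0n R 2) B0)).
have /ltW {}Hm := Hm m (leqnn _).
have nm : qpoch q x m != 0.
  by apply/prodf_neq0 => i _; rewrite subr_eq0 eq_sym.
exists (nrm (qpoch q x m) / 2); split; first by rewrite divr_gt0 // nrm_gt0.
exists m => n /subnK <-; rewrite addnC qpochD nrmM ler_wpM2l ?nrm_ge0 //.
have := qpoch_sub1 (x * q ^+ m) (n - m); set P := qpoch q _ _ => HP.
have xm : nrm (x * q ^+ m) = nrm x * rho ^+ m by rewrite nrmM nrmX.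
have : nrm (P - 1) <= 2^-1.
  apply: le_trans HP _; rewrite xm.
  have rm1 : rho ^+ m <= 1 by rewrite exprn_ile1 // ltW.
  have rm0 : 0 <= rho ^+ m by rewrite exprn_ge0 // ltW.
  apply: (@le_trans _ _ (B * rho ^+ m)).
    rewrite !mulrA mulrAC ler_wpM2r //; apply: (@le_trans _ _ (qE (nrm x) * nrm x / (1 - rho))); last by rewrite lerDl.
    rewrite ler_wpM2r ?invr_ge0 ?(ltW r1) // ler_wpM2r //.
    by apply: qE_le; rewrite ler_piMr.
  apply: le_trans (ler_wpM2l (ltW B0) Hm) _.
  by have -> : B * (1 / (2 * B)) = 2^-1 by field; rewrite gt_eqF.
have := nrmB P (P - 1); rewrite (_ : P - (P - 1) = 1) ?nrm1; last by ring.
by move=> ? ?; lra.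
Qed.

Lemma qpoch_free n : qpoch q q n != 0.
Proof.
apply/prodf_neq0 => i _; rewrite subr_eq0 eq_sym -exprS; apply/eqP => q1.
have : nrm (q ^+ i.+1) = 1 by rewrite q1 nrm1.
by rewrite nrmX; apply/eqP; rewrite lt_eqF // exprn_ilt1 // ltW.
Qed.

(** The coefficient (q; q)_N [2N, N + k] of the finite triple product; it tends to 1
    when N goes to infinity, with k fixed. *)
Definition qbeta N k := qpoch q q N * qbin q (2 * N) (N + k).

Lemma qbetaN N k : (k <= N)%N -> qpoch q q N * qbin q (2 * N) (N - k) = qbeta N k.
Proof.
move=> kN; rewrite /qbeta /qbin (_ : (2 * N - (N - k) = N + k)%N); last by lia.
by rewrite (_ : (2 * N - (N + k) = N - k)%N) 1?[_ * qpoch q q (N + k)]mulrC //; lia.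
Qed.

Definition qD := (qE 1 + 1) * qE 1 / (1 - rho).

Lemma qD_ge0 : 0 <= qD.
Proof. by rewrite divr_ge0 ?(ltW r1) // mulr_ge0 ?addr_ge0 // expR_ge0. Qed.

(** The coefficient is a product of two q-Pochhammer symbols with first arguments
    at most rho^(N - k), hence close to 1. *)
Lemma qbeta_sub1 N k : (k <= N)%N -> nrm (qbeta N k - 1) <= qD * rho ^+ (N - k).
Proof.
move=> kN; pose P m n := qpoch q (q * q ^+ m) n.
have fr := qpoch_free.
have -> : qbeta N k = P (N - k)%N k * P (N + k)%N (N - k)%N.
  rewrite /qbeta /qbin (_ : (2 * N - (N + k) = N - k)%N); last by lia.
  rewrite (_ : qpoch q q (2 * N) = qpoch q q (N + k) * P (N + k)%N (N - k)%N); last first.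
    by rewrite -qpochD; congr qpoch; lia.
  rewrite (_ : qpoch q q N = qpoch q q (N - k) * P (N - k)%N k); last first.
    by rewrite -qpochD subnK.
  have := fr (N - k)%N; have := fr (N + k)%N.
  move: (qpoch q q (N - k)) (qpoch q q (N + k)) (P _ _) (P _ _) => a b c d b0 a0.
  by field; rewrite a0.
have xm m : nrm (q * q ^+ m) = rho * rho ^+ m by rewrite nrmM nrmX.
have rm1 m : rho ^+ m <= 1 by rewrite exprn_ile1 // ltW.
have rm0 m : 0 <= rho ^+ m by rewrite exprn_ge0 // ltW.
have xm1 m : nrm (q * q ^+ m) <= rho ^+ m by rewrite xm ler_piMl // ltW.
have E1 m : qE (nrm (q * q ^+ m)) <= qE 1 by apply: qE_le; apply: le_trans (xm1 m) _.
have E0 : 0 <= qE 1 by exact: expR_ge0.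
have Ple m n : nrm (P m n) <= qE 1 by apply: le_trans (qpoch_le _ _) _.
have P1 m n : nrm (P m n - 1) <= qE 1 / (1 - rho) * rho ^+ m.
  apply: le_trans (qpoch_sub1 _ _) _; rewrite mulrAC.
  apply: ler_pM => //; [by rewrite divr_ge0 ?expR_ge0 // ltW|exact: nrm_ge0|].
  by rewrite ler_wpM2r ?invr_ge0 ?(ltW r1).
rewrite (_ : _ - 1 = P (N - k)%N k * (P (N + k)%N (N - k)%N - 1) + (P (N - k)%N k - 1)); last by ring.
apply: le_trans (nrmD _ _) _; rewrite nrmM.
have -> : qD * rho ^+ (N - k) = qE 1 * (qE 1 / (1 - rho) * rho ^+ (N - k)) + qE 1 / (1 - rho) * rho ^+ (N - k).
  by rewrite /qD; move: (rho ^+ _) => a; field; rewrite gt_eqF.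
apply: lerD => //; apply: ler_pM => //; try exact: nrm_ge0.
apply: le_trans (P1 _ _) _; rewrite ler_wpM2l //; first by rewrite divr_ge0 // ltW.
by apply: ler_wiXn2l => //; [exact: ltW|exact: ltW|lia].
Qed.

(** A quantitative form of the dominated convergence of the sums of u k b N k to
    the sum of u k, when b N k tends to 1: the weights of high index are far from
    1, and the decay of u, faster than rho^k, compensates for it. *)
Lemma weighted_sum (u : nat -> C) (A D : R) (b : nat -> nat -> C) (M N : nat) : 0 <= D ->
  (forall k, nrm (u k) <= A * rho ^+ k / 2 ^+ k) ->
  (forall k, (k < M)%N -> nrm (b N k - 1) * rho ^+ k <= D * rho ^+ N) ->
  nrm (\sum_(k < M) u k * b N k - csum u) <= 2 * A * D * rho ^+ N + 2 * A / 2 ^+ M.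
Proof.
move=> D0 uA bD.
have A0 : 0 <= A by have := le_trans (nrm_ge0 _) (uA 0%N); rewrite !expr0 mulr1 divr1.
have gu : geo A u.
  move=> k; apply: le_trans (uA k) _; rewrite ler_wpM2r ?invr_ge0 ?exprn_ge0 //.
  by rewrite ler_piMr // exprn_ile1 // ltW.
have := csum_tail M gu => T.
rewrite (_ : _ - csum u = \sum_(k < M) u k * (b N k - 1) - (csum u - \sum_(k < M) u k)); last first.
  by rewrite opprB addrA -big_split /=; congr (_ - _); apply: eq_bigr => k _; ring.
apply: le_trans (nrmB _ _) _; apply: lerD => //.
pose v k : C := if (k < M)%N then u k * (b N k - 1) else 0.
have gv : geo (A * D * rho ^+ N) v.
  move=> k; rewrite /v; case: ltnP => kM; last first.
    by rewrite nrm0 divr_ge0 ?mulr_ge0 ?exprn_ge0 // ltW.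
  rewrite nrmM; apply: le_trans (ler_wpM2r (nrm_ge0 _) (uA k)) _.
  rewrite (_ : _ * nrm (b N k - 1) = (A / 2 ^+ k) * (nrm (b N k - 1) * rho ^+ k)); last by ring.
  rewrite (_ : A * D * _ / _ = (A / 2 ^+ k) * (D * rho ^+ N)); last by ring.
  by rewrite ler_wpM2l ?divr_ge0 ?exprn_ge0 // bD.
have := geo_partial 0 M gv; rewrite expr0 divr1 big_mkord !mulrA.
rewrite (eq_bigr (fun k : 'I_M => u k * (b N k - 1))) // => k _.
by rewrite /v ltn_ord.
Qed.

End QPochBounds.

Lemma subn1_add (N k : nat) : (k < N)%N -> (N - k.+1 + k = N.-1)%N.
Proof. by lia. Qed.

(** A positive constant is not dominated by a sum of two sequences tending to 0. *)
Lemma two_geometric_bound (R : realType) (K1 K2 x c : R) m : 0 < c -> 0 <= x < 1 ->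
  ~ (forall N, (m <= N)%N -> c <= K1 * x ^+ N + K2 * 2^-1 ^+ N).
Proof.
move=> c0 x01 H; have x0 : 0 <= x by case/andP: x01.
have h01 : 0 <= (2^-1 : R) < 1 by rewrite invr_ge0 ler0n /= invf_lt1 // ltr1n.
have e0 (K : R) : 0 < c / (2 * (`|K| + 1)) by rewrite divr_gt0 // mulr_gt0 // ltr_pwDr.
have [N1 HN1] := pow_small x01 (e0 K1); have [N2 HN2] := pow_small h01 (e0 K2).
pose N := (m + N1 + N2)%N.
have half (K y : R) : 0 <= y -> y < c / (2 * (`|K| + 1)) -> K * y < c / 2.
  move=> y0 yc; have K1' : 0 < `|K| + 1 by rewrite ltr_pwDr.
  have -> : c / 2 = (`|K| + 1) * (c / (2 * (`|K| + 1))) by field; rewrite gt_eqF.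
  apply: le_lt_trans (_ : (`|K| + 1) * y < _); last by rewrite ltr_pM2l.
  by rewrite ler_wpM2r // (le_trans (ler_norm K)) // lerDl.
have {}HN1 : K1 * x ^+ N < c / 2.
  by apply: half; [exact: exprn_ge0|apply: HN1; rewrite /N addnAC leq_addl].
have {}HN2 : K2 * 2^-1 ^+ N < c / 2.
  by apply: half; [rewrite exprn_ge0 // invr_ge0|apply: HN2; rewrite /N leq_addl].
have /H : (m <= N)%N by rewrite /N -addnA leq_addr.
by move=> h; lra.
Qed.

Section ThetaZeros.
Variable R : realType.
Local Notation C := (R[i]).
Local Notation nrm := (@nrm R).
Variable eta : C.
Hypothesis eta0 : 0 < complex.Im eta.
Let q : C := e2pi eta.
Let rho : R := nrm q.

(** Suppose z is not in the lattice.  Then no factor of (t; q)_N (q/t; q)_N vanishes,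
    for t = e2pi z, so that these products are bounded below.  But the finite
    triple product identifies them, times (q; q)_N, with the partial sums of theta
    up to weights tending to 1, hence they tend to theta z = 0. *)
Lemma theta_eq0 (z : C) : theta eta z = 0 -> Gamma eta z.
Proof.
move=> th0; apply: contrapT => nG.
have r0 : 0 < rho by exact: rho_gt0.
have r1 : rho < 1 by exact: rho_lt1.
set t := e2pi z; have t0 : t != 0 by exact: e2pi_neq0.
have q0 : q != 0 by exact: e2pi_neq0.
have tq i : t * q ^+ i != 1.
  apply/eqP; rewrite /t /q -e2pi_nat -e2piD => /e2pi_eq1 [a za]; apply: nG.
  exists a, (- i%:Z); rewrite -za rmorphN /= -[i%:Z%:~R]/(i%:R); ring.
have qt i : q / t * q ^+ i != 1.
  apply/eqP; rewrite mulrAC -exprS /t /q -e2pi_nat -e2piN -e2piD => /e2pi_eq1 [a za]; apply: nG.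
  exists (- a), (i.+1%:Z); rewrite rmorphN /= -za -[i.+1%:Z%:~R]/(i.+1%:R); ring.
have qq i : q * q ^+ i != 1.
  apply/eqP => q1; have : nrm (q * q ^+ i) = 1 by rewrite q1 nrm1.
  by rewrite -exprS nrmX; apply/eqP; rewrite lt_eqF // exprn_ilt1 // ltW.
have [c1 [c10 [m1 H1]]] := qpoch_lower r0 r1 tq.
have [c2 [c20 [m2 H2]]] := qpoch_lower r0 r1 qt.
have [c3 [c30 [m3 H3]]] := qpoch_lower r0 r1 qq.
pose a k : C := theta_coef eta k * t ^+ k; pose b k : C := - t * (theta_coef eta k.+2 * t^-1 ^+ k.+2).
have [A HA] := entire_coef_geo (theta_coef_entire eta0) (divr_ge0 (nrm_ge0 t) (ltW r0)).
have [B HB] := entire_coef_geo (theta_coef_entire eta0) (divr_ge0 (nrm_ge0 t^-1) (ltW r0)).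
have right_deg k : 0 < rho ^+ k by exact: exprn_gt0.
have aA k : nrm (a k) <= A * rho ^+ k / 2 ^+ k.
  rewrite mulrAC -ler_pdivrMr //; apply: le_trans (HA k).
  by rewrite /a nrmM nrmX expr_div_n mulrA.
have B0 : 0 <= B.
  by have := le_trans (mulr_ge0 (nrm_ge0 _) (exprn_ge0 0 (divr_ge0 (nrm_ge0 t^-1) (ltW r0)))) (HB 0%N); rewrite expr0 divr1.
have bB k : nrm (b k) <= nrm t * B * rho ^+ k / 2 ^+ k.
  have -> : nrm t * B * rho ^+ k / 2 ^+ k = nrm t * (B * (rho ^+ k / 2 ^+ k)) by ring.
  rewrite /b (nrmM (- t)) nrmN ler_wpM2l ?nrm_ge0 //.
  have h := HB k.+2; rewrite expr_div_n mulrA ler_pdivrMr // in h.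
  rewrite (nrmM (theta_coef eta k.+2)) (nrmX t^-1); apply: le_trans h _.
  rewrite (_ : B / 2 ^+ k.+2 * rho ^+ k.+2 = B * (rho ^+ k.+2 / 2 ^+ k.+2)); last by rewrite [RHS]mulrA mulrAC.
  rewrite ler_wpM2l //.
  have r2 : rho ^+ k.+2 <= rho ^+ k by apply: ler_wiXn2l => //; [exact: ltW|exact: ltW|lia].
  have p2 : (2 ^+ k.+2)^-1 <= (2 ^+ k)^-1 :> R.
    rewrite lef_pV2 ?posrE ?exprn_gt0 // ler_weXn2l ?ler1n //.
    exact: leq_trans (leqnSn k) (leqnSn _).
  by apply: (ler_pM (ltW (right_deg k.+2)) _ r2 p2); rewrite invr_ge0 exprn_ge0.
have thE : csum a + csum b = 0.
  have -> : a = fun k : nat => theta_term eta z k%:Z.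
    by apply/funext => k; rewrite theta_term_pos.
  have -> : b = fun k : nat => theta_term eta z (- k.+1%:Z).
    by apply/funext => k; rewrite theta_term_neg.
  exact: th0.
have fr := qpoch_free r0 r1.
(* S N is computed by the triple product and, as N grows, tends to theta z. *)
pose S N := qpoch q q N * (qpoch q t N * qpoch q (q / t) N).
have SE N : S N = \sum_(k < N.+1) a k * qbeta q N k + \sum_(k < N) b k * qbeta q N k.+1.
  rewrite /S (triple_product q0 fr _ t0) mulrDr !mulr_sumr; congr (_ + _).
    apply: eq_bigr => k _; rewrite /a /theta_coef /qbeta -/q [(- t) ^+ _]exprNn.
    by clearbody q; move: (qbin _ _ _) (_ ^+ _) (_ ^+ _) (_ ^+ _) => x y z' w; ring.
  apply: eq_bigr => k _; rewrite /b /theta_coef -(qbetaN r0 r1) // -/q.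
  have -> : (- t) ^- k.+1 = - t * ((-1) ^+ k.+2 * t^-1 ^+ k.+2).
    by rewrite -exprMn mulN1r -invrN [in RHS]exprS [RHS]mulrA divff ?oppr_eq0 // mul1r exprVn.
  by move: (qbin q (2 * N) (N - k.+1)) ((-1 : C) ^+ k.+2) (t^-1 ^+ k.+2) (q ^+ 'C(k.+2, 2)) (qpoch q q N) => x y z' w v; ring.
have D0 := qD_ge0 r1; set D := qD q in D0.
have Sle N : nrm (S N) <= (2 * A * D * rho ^+ N + 2 * A / 2 ^+ N) + (2 * (nrm t * B) * (D / rho) * rho ^+ N + 2 * (nrm t * B) / 2 ^+ N).
  rewrite SE; set s1 := \sum_(k < N.+1) _; set s2 := \sum_(k < N) _.
  have -> : s1 + s2 = (s1 - csum a) + (s2 - csum b) by rewrite addrACA -opprD thE subr0.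
  apply: le_trans (nrmD _ _) _; rewrite /s1 /s2; apply: lerD.
    apply: le_trans (weighted_sum r0 r1 D0 aA _) _.
      move=> k kN; have kN' : (k <= N)%N by rewrite -ltnS.
      have := qbeta_sub1 r0 r1 kN'; rewrite -/D => h.
      by apply: le_trans (ler_wpM2r (ltW (right_deg k)) h) _; rewrite -mulrA -exprD subnK.
    have A0 : 0 <= A by have := le_trans (nrm_ge0 _) (aA 0%N); rewrite !expr0 mulr1 divr1.
    rewrite lerD2l ler_wpM2l ?mulr_ge0 // lef_pV2 ?posrE ?exprn_gt0 //.
    by rewrite ler_weXn2l ?ler1n.
  have Dr0 : 0 <= D / rho by rewrite divr_ge0 // ltW.
  apply: (weighted_sum (b := fun N k => qbeta q N k.+1) r0 r1 Dr0 bB).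
  move=> k kN; have := qbeta_sub1 r0 r1 kN; rewrite -/D => h.
  apply: le_trans (ler_wpM2r (ltW (right_deg k)) h) _.
  change (D * rho ^+ (N - k.+1) * rho ^+ k <= D / rho * rho ^+ N).
  have -> : D * rho ^+ (N - k.+1) * rho ^+ k = D * rho ^+ N.-1.
    by rewrite -mulrA -exprD subn1_add.
  case: (N) kN => // N' _ /=.
  by rewrite [rho ^+ N'.+1]exprS -mulrA mulKf ?gt_eqF.
(* S N is bounded by a sum of two geometric sequences, against its lower bound. *)
set K1 := 2 * A * D + 2 * (nrm t * B) * (D / rho); set K2 := 2 * A + 2 * (nrm t * B).
have {}Sle N : nrm (S N) <= K1 * rho ^+ N + K2 * 2^-1 ^+ N.
  apply: le_trans (Sle N) _; rewrite le_eqVlt exprVn; apply/orP; left; apply/eqP.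
  by rewrite /K1 /K2; ring.
have c0 : 0 < c3 * (c1 * c2) by rewrite !mulr_gt0.
have r01 : 0 <= rho < 1 by rewrite (ltW r0).
apply: (two_geometric_bound (m := maxn m3 (maxn m1 m2)) (K1 := K1) (K2 := K2) c0 r01) => N.
rewrite !geq_max => /and3P[/H3 {}H3 /H1 {}H1 /H2 {}H2]; apply: le_trans (Sle N).
rewrite /S (nrmM (qpoch q q N)) (nrmM (qpoch q t N)).
apply: (ler_pM (ltW c30) (mulr_ge0 (ltW c10) (ltW c20)) H3).
exact: (ler_pM (ltW c10) (ltW c20) H1 H2).
Qed.

End ThetaZeros.

(** * Divisors on which a difference of two coordinates is fixed *)

Section Lines.
Variables (R : realType) (K : finType).
Local Notation C := (R[i]).
Implicit Types (z w : K -> C).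

(** Restriction of a neighbourhood to a line parallel to a coordinate axis. *)
Lemma near_line w (a : K) (P : (K -> C) -> Prop) : near_pt w P ->
  exists2 e : R, 0 < e & forall t : C, nrm t < e ->
    P (fun k => if k == a then w k + t else w k).
Proof.
move=> wP; pose G (t : C^o) : 'rV[C^o]_#|K| := to_rV w + t *: delta_mx ord0 (enum_rank a).
have cG : {for (0 : C^o), continuous G}.
  apply: differentiable_continuous; apply: differentiableD; first exact: differentiable_cst.
  exact: ex_diff.
have GE t : of_rV (G t) = (fun k => if k == a then w k + t else w k).
  apply/funext => k; rewrite /of_rV /G !mxE enum_rankK eqxx /= (inj_eq enum_rank_inj).
  by case: eqP => _; rewrite ?mulr1 ?mulr0 ?addr0.
have G0 : G 0 = to_rV w by rewrite /G scale0r addr0.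
have := cG (fun v => P (of_rV v)); rewrite G0 => /(_ wP) H.
have {H} : nbhs (0 : C^o) (fun t : C^o => P (of_rV (G t))) by exact: H.
move=> /nbhs_nrmP[e e0 eP]; exists e => // t te.
by rewrite -GE; apply: eP; rewrite subr0.
Qed.

Lemma holo_lin (a b : K) (c : C) z : holo_at (fun w => w a - w b + c) z.
Proof. by apply: holoD; [apply: holoB; exact: holo_coord|exact: holo_cst]. Qed.

Lemma lin_line (a b : K) (c : C) w t : a != b ->
  (fun w : K -> C => w a - w b + c) (fun k => if k == a then w k + t else w k)
  = w a - w b + c + t.
Proof. by move=> ab; rewrite /= eqxx eq_sym (negbTE ab); ring. Qed.

Lemma small_real (e : R) : 0 < e -> exists r : R, [/\ 0 < r, r < 1 & r < e].
Proof.
move=> e0; exists (Num.min (2^-1) (e / 2)); rewrite lt_min !gt_min.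
by split; lra.
Qed.

Lemma nonzero_germ_lin (a b : K) (c : C) z : a != b ->
  nonzero_germ (fun w => w a - w b + c) z.
Proof.
move=> ab; apply/nonzero_germP; split; first exact: holo_lin.
apply: near_ptT => w P wP; have [e e0 He] := near_line a wP.
have [w0|w0] := eqVneq (w a - w b + c) 0; last first.
  by exists w; split => //; exact: near_pt_here wP.
have [r [r0 r1 re]] := small_real e0.
exists (fun k => if k == a then w k + r%:C else w k); split.
  by apply: He; rewrite nrmR gtr0_norm.
by rewrite (lin_line c w r%:C ab) w0 add0r fmorph_eq0 gt_eqF.
Qed.

Section Theta.
Variable eta : C.
Hypothesis eta0 : 0 < complex.Im eta.

(** The lattice contains no real number between 0 and 1, since the imaginary part
    of eta does not vanish. *)
Lemma real_not_Gamma (r : R) : 0 < r -> r < 1 -> ~ Gamma eta r%:C.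
Proof.
move=> r0 r1 [x [y e]].
have Im_e : 0 = y%:~R * complex.Im eta.
  have := congr1 (@complex.Im R) e.
  by rewrite -!(rmorph_int (real_complex R)) /=; case: (eta) => u v /=; rewrite mul0r addr0 add0r.
have y0 : y = 0.
  move/eqP: Im_e; rewrite eq_sym mulf_eq0 (gt_eqF eta0) orbF intr_eq0 => /eqP //.
move: e; rewrite y0 mul0r addr0 -(rmorph_int (real_complex R)) => /complexI e.
move: r0 r1; rewrite e ltr0z -[1]/(1%:~R) ltr_int; lia.
Qed.

Lemma holo_theta_lin (a b : K) (c : C) z : holo_at (fun w => theta eta (w a - w b + c)) z.
Proof.
apply: (holo_comp1 (f := fun w => w a - w b + c)); first exact: holo_lin.
by apply: nearCT => t; exact: theta_hol.
Qed.

(** If theta vanishes at a point, move the first coordinate by a real number smaller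
    than 1: the argument leaves the lattice. *)
Lemma nonzero_germ_theta (a b : K) (c : C) z : a != b ->
  nonzero_germ (fun w => theta eta (w a - w b + c)) z.
Proof.
move=> ab; apply/nonzero_germP; split; first exact: holo_theta_lin.
apply: near_ptT => w P wP; have [e e0 He] := near_line a wP.
have [/(theta_eq0 eta0) w0|w0] := eqVneq (theta eta (w a - w b + c)) 0; last first.
  by exists w; split => //; exact: near_pt_here wP.
have [r [r0 r1 re]] := small_real e0.
exists (fun k => if k == a then w k + r%:C else w k); split.
  by apply: He; rewrite nrmR gtr0_norm.
rewrite (lin_line c w r%:C ab); apply/eqP => /(theta_eq0 eta0) w1.
apply: (real_not_Gamma r0 r1).
rewrite (_ : r%:C = w a - w b + c + r%:C - (w a - w b + c)); last by ring.
by apply: GammaB => //; exact: w0.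
Qed.

End Theta.
End Lines.

(** * Functions holomorphic in a part of the variables *)

Section HoloInX.
Variables (R : realType) (I J : finType).
Local Notation C := (R[i]).
Implicit Types (f g : (I + J -> C) -> C) (z : I + J -> C).

(** [holo_in_x], in terms of [gen]. *)
Lemma holo_in_xP f z : holo_in_x f z <-> exists q : (J -> C) -> C, nonzero_germ q (z \o inr) /\
  exists g, holo_at g z /\ gen z (fun w => q (w \o inr) * f w = g w).
Proof.
split=> [[q nq [g [hg e]]]|[q [nq [g [hg e]]]]]; first by exists q; split => //; exists g.
by exists q => //; exists g.
Qed.

Lemma inr_csub z : z \o inr = csub (@inr I J) (fun=> 0) z.
Proof. by apply/funext => j; rewrite /csub /= addr0. Qed.

Lemma nonzero_germ_inr (q : (J -> C) -> C) z : nonzero_germ q (z \o inr) ->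
  nonzero_germ (fun w : I + J -> C => q (w \o inr)) z.
Proof.
rewrite inr_csub => /(nonzero_germ_csub (@inr_inj I J)).
by under [X in nonzero_germ X]funext do rewrite -inr_csub.
Qed.

Lemma holo_in_x_gen f g z : gen z (fun w => f w = g w) -> holo_in_x f z -> holo_in_x g z.
Proof.
move=> fg [q nq [g' [hg' e]]]; exists q => //; exists g'; split => //.
by apply: genS2 fg e => w ->.
Qed.

Lemma holo_in_x_holo f z : holo_at f z -> holo_in_x f z.
Proof.
move=> hf; exists (fun=> 1); first exact: nonzero_germ1.
by exists f; split => //; apply: genT => w; rewrite mul1r.
Qed.

Lemma holo_in_xM f g z : holo_in_x f z -> holo_in_x g z -> holo_in_x (fun w => f w * g w) z.
Proof.
move=> [q nq [f' [hf' e]]] [q' nq' [g' [hg' e']]].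
exists (fun u => q u * q' u); first exact: nonzero_germM.
exists (fun w => f' w * g' w); split; first exact: holoM.
by apply: genS2 e e' => w <- <-; ring.
Qed.

Lemma holo_in_xD f g z : holo_in_x f z -> holo_in_x g z -> holo_in_x (fun w => f w + g w) z.
Proof.
move=> [q nq [f' [hf' e]]] [q' nq' [g' [hg' e']]].
exists (fun u => q u * q' u); first exact: nonzero_germM.
have [hq _] := nonzero_germ_inr nq; have [hq' _] := nonzero_germ_inr nq'.
exists (fun w => q' (w \o inr) * f' w + q (w \o inr) * g' w); split.
  by apply: holoD; apply: holoM.
by apply: genS2 e e' => w <- <-; ring.
Qed.

End HoloInX.

(** * Points of the strings *)

Lemma big_idx (h : nat) (l : degree h) (T : Type) (x : T) (op : Monoid.com_law x) (F : idx l -> T) :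
  \big[op/x]_(a : idx l) F a = \big[op/x]_(i < h) \big[op/x]_(k < l i) F (mkidx k).
Proof. by rewrite sig_big_dep; apply: eq_bigr => -[i al] _. Qed.

Section Points.
Variables (R : realType) (h : nat) (D : km_datum R h) (eta tau : R[i]) (p : degree h).
Local Notation C := (R[i]).
Local Notation sp := (sp D).
Local Notation point := (idx p * nat)%type.
Implicit Types (P : point) (phi : idx p -> nat).

(** A point (a, mu) stands for the argument y_a + mu (delta_i, delta_i) tau of f. *)
Definition ptval (z : var p -> C) P : C :=
  z (inl P.1) + P.2%:R * sp (tag P.1) (tag P.1) * tau.

Definition pts phi (i : 'I_h) : seq point :=
  [seq (mkidx al, mu) | al <- enum 'I_(p i), mu <- iota 0 (phi (mkidx al))].

Definition deg phi : degree h := fun i => (\sum_(al < p i) phi (mkidx al))%N.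

Lemma has_degreeP phi (l : degree h) : reflect (deg phi = l) (has_degree phi l).
Proof.
apply: (iffP forallP) => [H|<- i //]; apply/funext => i; exact/eqP/H.
Qed.

Lemma size_pts phi i : size (pts phi i) = deg phi i.
Proof.
rewrite size_allpairs_dep sumnE big_map big_enum /=.
by apply: eq_bigr => al _; rewrite size_iota.
Qed.

Lemma string_argsE phi (z : var p -> C) i :
  string_args D tau phi (fun a => z (inl a)) i = map (ptval z) (pts phi i).
Proof. by rewrite /string_args /pts map_allpairs. Qed.

Lemma mem_pts phi i P : (P \in pts phi i) = (tag P.1 == i) && (P.2 < phi P.1)%N.
Proof.
apply/allpairsPdep/andP => [[al [mu [_ mm ->]]]|[/eqP]] /=.
  by rewrite eqxx; split => //; move: mm; rewrite mem_iota.
case: P => -[j al] mu /= <- m; exists al, mu; split => //; first by rewrite mem_enum.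
by rewrite mem_iota.
Qed.

Lemma mkidx_inj (l : degree h) i : injective (@mkidx h l i).
Proof.
move=> x y e; have := congr1 (fun u : idx l => tagged_as (mkidx x) u) e.
by rewrite !tagged_asE.
Qed.

Lemma uniq_pts phi i : uniq (pts phi i).
Proof.
apply: allpairs_uniq_dep; first exact: enum_uniq.
  by move=> al _; exact: iota_uniq.
move=> [al mu] [al' mu'] _ _ /= [e ->].
have e' : @mkidx h p i al = mkidx al' by exact: e.
by move: (mkidx_inj e') => ->.
Qed.

Variables (l : degree h) (phi : idx p -> nat).

Lemma has_degree_size (hd : has_degree phi l) i : l i = size (pts phi i).
Proof. by rewrite size_pts; move/has_degreeP: hd => ->. Qed.

(** The point at which the argument of f with index c is evaluated in the
    coefficient of e^phi; the order is the one of the list of arguments. *)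
Definition pt (hd : has_degree phi l) (c : idx l) : point :=
  tnth (in_tuple (pts phi (tag c))) (cast_ord (has_degree_size hd (tag c)) (tagged c)).

Variable hd : has_degree phi l.

Lemma mem_pt c : pt hd c \in pts phi (tag c).
Proof. exact: mem_tnth. Qed.

Lemma tag_pt c : tag (pt hd c).1 = tag c.
Proof. by have := mem_pt c; rewrite mem_pts => /andP[/eqP]. Qed.

Lemma nth_pt (z : var p -> C) c :
  nth 0 (string_args D tau phi (fun a => z (inl a)) (tag c)) (nat_of_ord (tagged c)) = ptval z (pt hd c).
Proof.
rewrite string_argsE /pt (nth_map (pt hd c)) ?size_pts; last first.
  by move/has_degreeP: hd => ->.
by rewrite (tnth_nth (pt hd c)).
Qed.

Lemma pt_inj : injective (pt hd).
Proof.
move=> c c' e; have t : tag c = tag c' by rewrite -!tag_pt e.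
case: c c' e t => i k [j k'] /= e t; subst j; congr (existT _ _ _).
have := e; rewrite /pt /= => /eqP.
rewrite !(tnth_nth (pt hd (existT _ i k))) nth_uniq ?uniq_pts //=; first by move=> /eqP /val_inj.
  by rewrite -has_degree_size.
by rewrite -has_degree_size.
Qed.

Lemma pt_surj P : (P.2 < phi P.1)%N -> exists c, pt hd c = P.
Proof.
move=> Pphi; set i := tag P.1; have : P \in in_tuple (pts phi i) by rewrite mem_pts eqxx.
move=> /tnthP [k ->].
exists (mkidx (cast_ord (esym (has_degree_size hd i)) k)).
by rewrite /pt /= cast_ordKV.
Qed.

Lemma big_pt_type (T : Type) (idx0 : T) (op : Monoid.com_law idx0) (F : point -> T) i :
  \big[op/idx0]_(k < l i) F (pt hd (mkidx k)) =
  \big[op/idx0]_(al < p i) \big[op/idx0]_(mu < phi (mkidx al)) F (mkidx al, nat_of_ord mu).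
Proof.
transitivity (\big[op/idx0]_(P <- pts phi i) F P).
  rewrite (big_tnth _ _ (pts phi i)) /=.
  rewrite [LHS](reindex (cast_ord (esym (has_degree_size hd i)))) /=; last first.
    by exists (cast_ord (has_degree_size hd i)) => k _; rewrite ?cast_ordK ?cast_ordKV.
  apply: eq_bigr => k _; rewrite /pt /=; congr (F (tnth _ _)).
  by apply: val_inj.
rewrite /pts big_allpairs_dep big_enum /=; apply: eq_bigr => al _.
by rewrite -(big_mkord xpredT (fun mu => F (mkidx al, mu))) /index_iota subn0.
Qed.

Lemma big_pt (T : Type) (idx0 : T) (op : Monoid.com_law idx0) (F : point -> T) :
  \big[op/idx0]_(c : idx l) F (pt hd c) =
  \big[op/idx0]_(a : idx p) \big[op/idx0]_(mu < phi a) F (a, nat_of_ord mu).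
Proof. by rewrite !big_idx; apply: eq_bigr => i _; exact: big_pt_type. Qed.

End Points.

(** * Formulas for the elements of the algebra *)

Section Admissible.
Variables (R : realType) (h : nat) (D : km_datum R h) (eta tau : R[i]) (p : degree h).
Hypothesis eta0 : 0 < complex.Im eta.
Local Notation C := (R[i]).
Local Notation sp := (sp D).
Local Notation theta := (theta eta).
Local Notation point := (idx p * nat)%type.
Local Notation ptval := (ptval D tau).
Implicit Types (P : point) (F G : (var p -> C) -> C) (z : var p -> C).

Lemma sp_sym i j : sp i j = sp j i.
Proof. by rewrite /Defs.sp form_sym. Qed.

Definition off_poles z := forall (a b : idx p), a != b -> sp (tag a) (tag b) != 0 ->
  forall mu nu : int, ~ Gamma eta (z (inl a) - z (inl b) - sp (tag a) (tag b) * tau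
                + mu%:~R * sp (tag a) (tag a) * tau
                - nu%:~R * sp (tag b) (tag b) * tau).

(** The conditions of [admissible] which make sense before normalization: a class of
    formulas closed under the ring operations and the translations of the algebra. *)
Definition adm F := meromorphic F /\ forall z, off_poles z -> holo_in_x F z.

Lemma adm_admissible F : adm F -> admissible D eta tau (normalize F).
Proof.
move=> [mF hF]; split; first exact: is_mero_normalize.
move=> z /hF; apply: holo_in_x_gen; exact: (geneq_sym (normalize_gen mF)).
Qed.

Lemma adm_holo F : (forall z, holo_at F z) -> adm F.
Proof.
move=> hF; split; first exact: mero_holo.
by move=> z _; exact: holo_in_x_holo.
Qed.

Lemma adm_cst (c : C) : adm (fun=> c).
Proof. by apply: adm_holo => z; exact: holo_cst. Qed.

Lemma admM F G : adm F -> adm G -> adm (fun z => F z * G z).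
Proof.
move=> [mF hF] [mG hG]; split; first exact: meroM.
by move=> z oz; apply: holo_in_xM; [exact: hF|exact: hG].
Qed.

Lemma admD F G : adm F -> adm G -> adm (fun z => F z + G z).
Proof.
move=> [mF hF] [mG hG]; split; first exact: meroD.
by move=> z oz; apply: holo_in_xD; [exact: hF|exact: hG].
Qed.

Lemma adm_prod (I : Type) (r : seq I) (Q : pred I) (F : I -> (var p -> C) -> C) :
  (forall i, Q i -> adm (F i)) -> adm (fun z => \prod_(i <- r | Q i) F i z).
Proof. move=> FK; apply: (fun_big_closed (K := adm) r _ _ FK) => [|f g]; [exact: adm_cst|exact: admM]. Qed.

Lemma adm_sum (I : Type) (r : seq I) (Q : pred I) (F : I -> (var p -> C) -> C) :
  (forall i, Q i -> adm (F i)) -> adm (fun z => \sum_(i <- r | Q i) F i z).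
Proof. move=> FK; apply: (fun_big_closed (K := adm) r _ _ FK) => [|f g]; [exact: adm_cst|exact: admD]. Qed.

(** A translation acts separately on the variables and on the parameters u, so the
    equation of the divisor in the parameters is translated too. *)
Lemma adm_csub F (c : var p -> C) : adm F ->
  (forall z, off_poles z -> off_poles (csub id c z)) -> 
  adm (fun z => F (csub id c z)).
Proof.
move=> [mF hF] oc; split; first exact: mero_csub.
move=> z /oc /hF /holo_in_xP [q [nq [g [hg e]]]]; apply/holo_in_xP.
pose cr j := c (inr j).
have Ec w : csub id c w \o inr = csub id cr (w \o inr) by [].
exists (fun u => q (csub id cr u)); split; first exact: nonzero_germ_csub.
exists (fun w => g (csub id c w)); split; first exact: holo_csub.
exact: (@gen_csub_inj _ _ _ id c (fun _ _ => id) z (fun w => q (w \o inr) * F w = g w)).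
Qed.

Definition shift_of (a : idx p) : var p -> C := fun k => match k with
  | inl b => if b == a then sp (tag a) (tag a) * tau else 0
  | inr j => - (2 * sp (tag a) j * tau) end.

Lemma e_shiftE (a : idx p) F : e_shift D tau a F = fun z => F (csub id (shift_of a) z).
Proof.
apply/funext => z; rewrite /e_shift; congr F; apply/funext => -[b|j] //=.
by rewrite /csub /=; case: eqP => // _; rewrite addr0.
Qed.

Lemma off_poles_shift (a : idx p) z : off_poles z -> off_poles (csub id (shift_of a) z).
Proof.
move=> oz b c bc s0 mu nu; rewrite /csub /=.
have := oz b c bc s0 (mu + (b == a)%:Z) (nu + (c == a)%:Z).
have E (d : idx p) : (if d == a then sp (tag a) (tag a) * tau else 0) = (d == a)%:Z%:~R * sp (tag d) (tag d) * tau.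
  by case: eqP => [->|_]; rewrite ?mul1r ?mul0r.
rewrite !E; apply: contra_not; congr (Gamma eta _).
by rewrite !rmorphD /=; ring.
Qed.

Lemma adm_e_shift a F : adm F -> adm (e_shift D tau a F).
Proof. by move=> aF; rewrite e_shiftE; apply: adm_csub => // z; exact: off_poles_shift. Qed.

Definition ptshift P : C := P.2%:R * sp (tag P.1) (tag P.1) * tau.

Lemma ptvalB P P' e z : ptval z P - ptval z P' + e =
  z (inl P.1) - z (inl P'.1) + (ptshift P - ptshift P' + e).
Proof. by rewrite /ptval /ptshift; ring. Qed.

Lemma inl_neq (a b : idx p) : a != b -> (inl a : var p) != inl b.
Proof. by apply: contra => /eqP [->]. Qed.

Lemma holo_ptval P P' e z : holo_at (fun z => ptval z P - ptval z P' + e) z.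
Proof. by under [X in holo_at X]funext do rewrite ptvalB; exact: holo_lin. Qed.

Lemma nonzero_ptval P P' e z : P.1 != P'.1 ->
  nonzero_germ (fun z => ptval z P - ptval z P' + e) z.
Proof.
move=> PP'; under [X in nonzero_germ X]funext do rewrite ptvalB.
exact/nonzero_germ_lin/inl_neq.
Qed.

Lemma holo_theta_ptval P P' e z : holo_at (fun z => theta (ptval z P - ptval z P' + e)) z.
Proof. by under [X in holo_at X]funext do rewrite ptvalB; exact: holo_theta_lin. Qed.

Lemma nonzero_theta_ptval P P' e z : P.1 != P'.1 ->
  nonzero_germ (fun z => theta (ptval z P - ptval z P' + e)) z.
Proof.
move=> PP'; under [X in nonzero_germ X]funext do rewrite ptvalB.
exact/(nonzero_germ_theta eta0)/inl_neq.
Qed.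

Definition B_ratio P P' z : C := theta (ptval z P - ptval z P') /
  theta (ptval z P - ptval z P' - sp (tag P.1) (tag P'.1) * tau).

(** On one string the difference of two points is a constant. *)
Lemma B_ratio_same P P' z z' : P.1 = P'.1 -> B_ratio P P' z = B_ratio P P' z'.
Proof.
move=> e; rewrite /B_ratio.
have -> : ptval z P - ptval z P' = ptval z' P - ptval z' P' by rewrite /ptval e; ring.
by [].
Qed.

Lemma holo_theta_ptval0 P P' z : holo_at (fun z => theta (ptval z P - ptval z P')) z.
Proof.
by under [X in holo_at X]funext do rewrite -[_ - _]addr0; exact: holo_theta_ptval.
Qed.

Lemma mero_B_ratio P P' : meromorphic (B_ratio P P').
Proof.
have [e|ne] := eqVneq P.1 P'.1.
  apply: mero_holo => z.
  rewrite (_ : B_ratio P P' = fun=> B_ratio P P' z); first exact: holo_cst.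
  by apply/funext => z'; exact: B_ratio_same.
apply: mero_div => z; first exact: holo_theta_ptval0.
exact: nonzero_theta_ptval.
Qed.

Lemma off_poles_theta P P' z : off_poles z -> P.1 != P'.1 -> sp (tag P.1) (tag P'.1) != 0 ->
  theta (ptval z P - ptval z P' - sp (tag P.1) (tag P'.1) * tau) != 0.
Proof.
move=> oz ne s0; apply/eqP => /(theta_eq0 eta0).
have := oz _ _ ne s0 P.2%:Z P'.2%:Z; apply: contra_not; congr (Gamma eta _).
by rewrite /ptval -![_%:Z%:~R]/(_%:R); ring.
Qed.

(** For orthogonal roots numerator and denominator agree. *)
Lemma B_ratio_gen1 P P' z : P.1 != P'.1 -> sp (tag P.1) (tag P'.1) = 0 ->
  gen z (fun w => B_ratio P P' w = 1).
Proof.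
move=> ne s0.
have := gen_neq0 (nonzero_theta_ptval 0 z ne); apply: genS => w.
by rewrite /B_ratio s0 mul0r subr0 addr0; exact: divff.
Qed.

Section Substitution.
Variables (l : degree h) (f : fn R l).
Hypothesis fF : Fcomp f.
Hypothesis fQ : Qpoles D eta f.

(** Locally at z0, the polar divisors allowed for f. *)
Definition polar (z0 : var l -> C) (c c' : idx l) : bool :=
  [&& (tag c < tag c')%N, sp (tag c) (tag c') != 0
    & z0 (inl c) - z0 (inl c') \in Gamma eta].

Definition polar_prod (z0 z : var l -> C) : C :=
  \prod_(c : idx l) \prod_(c' : idx l | polar z0 c c')
    ((z (inl c) - z (inl c')) - (z0 (inl c) - z0 (inl c'))).

(** Near z0 the function is a holomorphic germ divided by an equation in the
    parameters and by the equations of its polar divisors. *)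
Lemma Q_local (z0 : var l -> C) : exists q : ('I_h -> C) -> C, nonzero_germ q (z0 \o inr) /\
  exists g, holo_at g z0 /\ near_pt z0 (fun w => q (w \o inr) * polar_prod z0 w != 0 ->
    holo_at f w /\ f w = g w / (q (w \o inr) * polar_prod z0 w)).
Proof.
have [[mf nf] _] := fF.
have /holo_in_xP [q [nq [g [hg e]]]] := fQ z0.
exists q; split => //; exists g; split => //.
have [hq _] := nonzero_germ_inr nq.
apply: (is_mero_value nf (q := fun w => q (w \o inr) * polar_prod z0 w)) => //.
  apply: holoM => //; apply: holo_prod => c _; apply: holo_prod => c' _.
  by apply: holoB; [apply: holoB; exact: holo_coord|exact: holo_cst].
by apply: genS e => w <-; rewrite /numerator -/(polar_prod z0 w); ring.
Qed.

Variables (s : idx l -> point) (v : 'I_h -> C).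
Hypothesis s_tag : forall c, tag (s c).1 = tag c.

(** The substitution of points of strings for the arguments of f, the parameters
    being translated by v. *)
Definition msub z : var l -> C :=
  join (fun c => ptval z (s c)) (fun j => z (inr j) + v j).

Definition msub_idx (k : var l) : var p :=
  match k with inl c => inl (s c).1 | inr j => inr j end.
Definition msub_cst (k : var l) : C :=
  match k with inl c => ptshift (s c) | inr j => v j end.

Lemma msubE z : msub z = csub msub_idx msub_cst z.
Proof. by apply/funext => -[c|j]. Qed.

Definition polar_sub z0 z : C :=
  \prod_(c : idx l) \prod_(c' : idx l | polar (msub z0) c c')
    ((ptval z (s c) - ptval z (s c')) - (ptval z0 (s c) - ptval z0 (s c'))).

Lemma nonzero_polar_sub z0 : nonzero_germ (polar_sub z0) z0.
Proof.
apply: nonzero_germ_prod => c _; apply: nonzero_germ_prod => c' /andP[cc' _].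
apply: nonzero_ptval; apply/eqP => e; have := s_tag c; have := s_tag c'.
by rewrite e => -> e'; rewrite e' ltnn in cc'.
Qed.

Lemma Q_local_sub z0 : exists q : ('I_h -> C) -> C, nonzero_germ q (z0 \o inr) /\
  exists g, holo_at g z0 /\ near_pt z0 (fun z => q (z \o inr) * polar_sub z0 z != 0 ->
    holo_at f (msub z) /\ f (msub z) = g z / (q (z \o inr) * polar_sub z0 z)).
Proof.
have [q [nq [g [hg e]]]] := Q_local (msub z0).
exists (fun u => q (csub id v u)); split; first exact: nonzero_germ_csub.
exists (fun z => g (msub z)); split.
  by under [X in holo_at X]funext do rewrite msubE; apply: holo_csub; rewrite -msubE.
rewrite msubE in e; have {}e := near_csub e.
by apply: near_ptS e => z; rewrite -!msubE.
Qed.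

Lemma nonzero_qpolar (q : ('I_h -> C) -> C) z0 : nonzero_germ q (z0 \o inr) ->
  nonzero_germ (fun z => q (z \o inr) * polar_sub z0 z) z0.
Proof.
move=> nq; apply: nonzero_germM; [exact: nonzero_germ_inr|exact: nonzero_polar_sub].
Qed.

Lemma mero_sub : meromorphic (fun z => f (msub z)).
Proof.
move=> z0; have [q [nq [g [hg e]]]] := Q_local_sub z0.
exists g, (fun z => q (z \o inr) * polar_sub z0 z); split => //.
  exact: nonzero_qpolar.
by apply: near_ptS e => w e /e[].
Qed.

Lemma gen_holo_sub z0 : gen z0 (fun z => holo_at f (msub z)).
Proof.
have [q [nq [g [hg e]]]] := Q_local_sub z0.
exists (fun z => q (z \o inr) * polar_sub z0 z); first exact: nonzero_qpolar.
by apply: near_ptS e => w e /e[].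
Qed.

(** The pairs over which the product in [B] is taken. *)
Definition before P P' : bool :=
  idx_le P.1 P'.1 && ((P.1 == P'.1) ==> (P.2 < P'.2)%N).

Definition B_factor P P' z : C := if before P P' then B_ratio P P' z else 1.

Lemma mero_B_factor P P' : meromorphic (B_factor P P').
Proof.
rewrite /B_factor; case: before; first exact: mero_B_ratio.
by apply: mero_holo => z; exact: holo_cst.
Qed.

Lemma before_lt P P' : (tag P.1 < tag P'.1)%N -> before P P'.
Proof.
move=> lt; rewrite /before /idx_le lt /=; apply/implyP => /eqP e.
by rewrite e ltnn in lt.
Qed.

(** If the arguments c and c' are on a polar divisor of f, then theta vanishes there
    and the factor is divisible by the equation of the divisor.  The denominator
    does not vanish away from the poles allowed in the algebra. *)
Lemma B_factor_local (c c' : idx l) z0 : off_poles z0 -> exists H, holo_at H z0 /\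
  gen z0 (fun z => B_factor (s c) (s c') z = H z * (if polar (msub z0) c c'
    then (ptval z (s c) - ptval z (s c')) - (ptval z0 (s c) - ptval z0 (s c')) else 1)).
Proof.
move=> oz; have [po|npo] := boolP (polar (msub z0) c c'); last first.
  rewrite /B_factor; case: (before _ _); last first.
    exists (fun=> 1); split; first exact: holo_cst.
    by apply: genT => z; rewrite mulr1.
  have [e|ne] := eqVneq (s c).1 (s c').1.
    exists (fun=> B_ratio (s c) (s c') z0); split; first exact: holo_cst.
    by apply: genT => z; rewrite mulr1; exact: B_ratio_same.
  have [s0|s0] := eqVneq (sp (tag (s c).1) (tag (s c').1)) 0.
    exists (fun=> 1); split; first exact: holo_cst.
    by apply: genS (B_ratio_gen1 z0 ne s0) => z ->; rewrite mulr1.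
  exists (B_ratio (s c) (s c')); split; last by apply: genT => z; rewrite mulr1.
  apply: holo_div; [exact: holo_theta_ptval0|exact: holo_theta_ptval|exact: off_poles_theta].
case/and3P: po => lt s0 /set_mem; set d0 := _ - _ => /(theta_Gamma eta0) th0.
have lt' : (tag (s c).1 < tag (s c').1)%N by rewrite !s_tag.
have ne : (s c).1 != (s c').1 by apply/eqP => e; rewrite e ltnn in lt'.
rewrite /B_factor (before_lt lt').
have [g [hg e]] := theta_divdiff eta0 d0.
have hd : holo_at (fun z => ptval z (s c) - ptval z (s c')) z0.
  by under [X in holo_at X]funext do rewrite -[_ - _]addr0; exact: holo_ptval.
(* g is the divided difference of theta at the point d0 of the lattice. *)
exists (fun z => g (ptval z (s c) - ptval z (s c')) /
   theta (ptval z (s c) - ptval z (s c') - sp (tag (s c).1) (tag (s c').1) * tau)); split.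
  apply: holo_div; [|exact: holo_theta_ptval|by apply: off_poles_theta => //; rewrite !s_tag].
  exact: (holo_comp1 (phi := g) hd).
apply: gen_here; apply: near_ptS (holo_nbhs hd e) => z.
rewrite th0 subr0 /B_ratio => ->.
by rewrite [RHS]mulrAC; congr (_ * _); rewrite mulrC.
Qed.

Definition sub_form z : C := f (msub z) * \prod_(c : idx l) \prod_(c' : idx l) B_factor (s c) (s c') z.

(** By [B_factor_local], applied to each pair of arguments, the product of the theta
    factors is divisible by the product of the equations of the polar divisors of
    f, and f has simple poles. *)
Lemma adm_sub_form : adm sub_form.
Proof.
split.
  apply: meroM; first exact: mero_sub.
  by apply: mero_prod => c _; apply: mero_prod => c' _; exact: mero_B_factor.
move=> z0 oz; apply/holo_in_xP.
have [q [nq [g [hg e]]]] := Q_local_sub z0.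
have /choice [H HP] : forall cc : idx l * idx l, exists H, holo_at H z0 /\
  gen z0 (fun z => B_factor (s cc.1) (s cc.2) z = H z * (if polar (msub z0) cc.1 cc.2
    then (ptval z (s cc.1) - ptval z (s cc.2)) - (ptval z0 (s cc.1) - ptval z0 (s cc.2)) else 1)).
  by move=> [c c']; exact: B_factor_local.
exists q; split => //; exists (fun z => g z * \prod_(c : idx l) \prod_(c' : idx l) H (c, c') z); split.
  apply: holoM => //; apply: holo_prod => c _; apply: holo_prod => c' _.
  by have [] := HP (c, c').
have gH : gen z0 (fun z => forall cc : idx l * idx l, B_factor (s cc.1) (s cc.2) z = H cc z * (if polar (msub z0) cc.1 cc.2
    then (ptval z (s cc.1) - ptval z (s cc.2)) - (ptval z0 (s cc.1) - ptval z0 (s cc.2)) else 1)).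
  by apply: gen_all => cc; have [] := HP cc.
apply: genS2 gH (genI (gen_neq0 (nonzero_qpolar nq)) (gen_here e)) => z EH [q0 /(_ q0) [_ ef]].
rewrite /sub_form ef.
have -> : \prod_(c : idx l) \prod_(c' : idx l) B_factor (s c) (s c') z =
   (\prod_(c : idx l) \prod_(c' : idx l) H (c, c') z) * polar_sub z0 z.
  rewrite -big_split /=; apply: eq_bigr => c _.
  rewrite [X in _ * X]big_mkcond -big_split /=; apply: eq_bigr => c' _.
  exact: (EH (c, c')).
move: q0; rewrite mulf_eq0 => /norP[q0 l0].
by field; rewrite l0.
Qed.

End Substitution.

End Admissible.

(** * Commutation relations in the algebra *)

Section AlgebraA.
Variables (R : realType) (h : nat) (D : km_datum R h) (eta tau : R[i]) (p : degree h).
Hypothesis eta0 : 0 < complex.Im eta.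
Local Notation C := (R[i]).
Local Notation sp := (sp D).
Local Notation theta := (theta eta).
Local Notation point := (idx p * nat)%type.
Local Notation ptval := (ptval D tau).
Local Notation adm := (@adm R h D eta tau p).
Local Notation A := (algA D eta tau p).
Local Notation shift_of := (@shift_of R h D tau p).
Implicit Types (P : point) (F G : (var p -> C) -> C) (z : var p -> C).

(** The element of the algebra given by a formula which makes sense generically. *)
Definition A_mero F : A := A_fun D eta tau (normalize F).
Local Notation e := (@A_e R h D eta tau p).

Lemma A_funE F (aF : admissible D eta tau F) :
  A_fun D eta tau F = algA_of (Tfun (exist _ F aF)).
Proof.
rewrite /A_fun; case: pselect => // aF'.
by congr (algA_of (Tfun (exist _ _ _))); exact: Prop_irrelevance.
Qed.

Local Notation of_term := (@algA_of R h D eta tau p).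

Lemma algA_addE s t : of_term s + of_term t = of_term (Tadd s t).
Proof. exact: A_addE. Qed.

Lemma algA_mulE s t : of_term s * of_term t = of_term (Tmul s t).
Proof. exact: A_mulE. Qed.

Lemma algA_scaleE c s : c *: of_term s = of_term (Tscale c s).
Proof. exact: A_scaleE. Qed.

Lemma A_mero_geneq F G : geneq F G -> A_mero F = A_mero G.
Proof. by move=> FG; rewrite /A_mero (normalize_geneq FG). Qed.

Lemma A_mero_ext F G : F =1 G -> A_mero F = A_mero G.
Proof. by move=> /funext ->. Qed.

Lemma normalize_cst (c : C) : normalize (fun _ : var p -> C => c) = fun=> c.
Proof. by apply/funext => z; rewrite normalize_holo //; exact: holo_cst. Qed.

Lemma A_mero_cst (c : C) : A_mero (fun=> c) = c *: (1 : A).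
Proof.
rewrite /A_mero (A_funE (adm_admissible (adm_cst D eta tau p c))).
rewrite -[1]/(of_term (@T1 R h D eta tau p)) algA_scaleE.
by apply/algA_ofP/rel_fun_cst; rewrite /= normalize_cst.
Qed.

Lemma A_mero1 : A_mero (fun=> 1) = 1.
Proof. by rewrite A_mero_cst scale1r. Qed.

Lemma A_meroD F G : adm F -> adm G -> A_mero (fun z => F z + G z) = A_mero F + A_mero G.
Proof.
move=> aF aG; have aFG := admD aF aG.
rewrite /A_mero (A_funE (adm_admissible aF)) (A_funE (adm_admissible aG)) (A_funE (adm_admissible aFG)).
rewrite algA_addE.
apply/algA_ofP/rel_sym/rel_fun_add => /=; apply: normalize_geneq.
by apply: geneqD; apply: geneq_sym; apply: normalize_gen; [case: aF|case: aG].
Qed.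

Lemma A_meroM F G : adm F -> adm G -> A_mero (fun z => F z * G z) = A_mero F * A_mero G.
Proof.
move=> aF aG; have aFG := admM aF aG.
rewrite /A_mero (A_funE (adm_admissible aF)) (A_funE (adm_admissible aG)) (A_funE (adm_admissible aFG)).
rewrite algA_mulE.
apply/algA_ofP/rel_sym/rel_fun_mul => /=; apply: normalize_geneq.
by apply: geneqM; apply: geneq_sym; apply: normalize_gen; [case: aF|case: aG].
Qed.

Lemma A_meroZ (c : C) F : adm F -> A_mero (fun z => c * F z) = c *: A_mero F.
Proof.
move=> aF; rewrite (A_meroM (adm_cst D eta tau p c) aF) A_mero_cst -A_scaleAl.
by rewrite mul1r.
Qed.

Lemma A_mero0 : A_mero (fun=> 0) = 0.
Proof. by rewrite A_mero_cst scale0r. Qed.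

Lemma A_mero_sum (I : Type) (r : seq I) (Q : pred I) (F : I -> (var p -> C) -> C) :
  (forall i, Q i -> adm (F i)) ->
  A_mero (fun z => \sum_(i <- r | Q i) F i z) = \sum_(i <- r | Q i) A_mero (F i).
Proof.
move=> aF; elim: r => [|i r IH].
  by rewrite big_nil -A_mero0; congr A_mero; apply/funext => z; rewrite big_nil.
rewrite big_cons; have [Qi|Qi] := boolP (Q i); last first.
  by rewrite -IH; congr A_mero; apply/funext => z; rewrite big_cons (negbTE Qi).
rewrite -IH -A_meroD; [|exact: aF|exact: adm_sum].
by congr A_mero; apply/funext => z; rewrite big_cons Qi.
Qed.

(** A translation commutes with normalization, so the relation for normalized
    functions holds for formulas. *)
Lemma e_A_mero (a : idx p) F : adm F -> e a * A_mero F = A_mero (fun z => F (csub id (shift_of a) z)) * e a.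
Proof.
move=> aF; have aG := adm_e_shift a aF; rewrite e_shiftE in aG.
rewrite /A_mero (A_funE (adm_admissible aF)) (A_funE (adm_admissible aG)).
rewrite /A_e !algA_mulE.
apply/algA_ofP/rel_e_fun => /=.
by rewrite normalize_translate e_shiftE.
Qed.

(** The translation by which e_a^n acts on functions. *)
Definition power_shift (a : idx p) (n : nat) : var p -> C := fun k => n%:R * shift_of a k.

Lemma csub_csub (c c' : var p -> C) z : csub id c (csub id c' z) = csub id (fun k => c' k + c k) z.
Proof. by apply/funext => k; rewrite /csub addrA. Qed.

Lemma off_poles_power_shift a n z : off_poles D eta tau z -> off_poles D eta tau (csub id (power_shift a n) z).
Proof.
move=> oz; elim: n => [|n IH].
  rewrite (_ : csub _ _ _ = z) //; apply/funext => k.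
  by rewrite /csub /power_shift mul0r addr0.
have := off_poles_shift (a := a) IH; rewrite csub_csub.
congr (off_poles _ _ _ _); congr (csub _ _ _); apply/funext => k.
by rewrite /power_shift -natr1 mulrDl mul1r.
Qed.

Lemma adm_power_shift a n F : adm F -> adm (fun z => F (csub id (power_shift a n) z)).
Proof. by move=> aF; apply: adm_csub => // z; exact: off_poles_power_shift. Qed.

Lemma eX_A_mero a n F : adm F -> e a ^+ n * A_mero F = A_mero (fun z => F (csub id (power_shift a n) z)) * e a ^+ n.
Proof.
move=> aF; elim: n => [|n IH].
  rewrite !expr0 mul1r mulr1; congr A_mero; apply/funext => z; congr F.
  by apply/funext => k; rewrite /csub /power_shift mul0r addr0.
rewrite exprS -mulrA IH mulrA e_A_mero; last exact: adm_power_shift.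
rewrite -mulrA; congr (A_mero _ * _); apply/funext => z; rewrite csub_csub; congr (F (csub _ _ _)).
by apply/funext => k; rewrite /power_shift -natr1 mulrDl mul1r addrC.
Qed.

Lemma ptval_power_shift a n z (b : idx p) mu : ptval (csub id (power_shift a n) z) (b, mu) =
  ptval z (b, (if b == a then n + mu else mu)%N).
Proof.
rewrite /ptval /csub /power_shift /shift_of /=; case: eqP => [->|_]; last by rewrite mulr0 addr0.
by rewrite natrD; ring.
Qed.

(** The coefficient exchanging e_a and e_b, with the points P and Q in place of
    y_a and y_b; powers of e_a and e_b produce all the pairs of points of two
    strings. *)
Definition exchange_coef P P' z : C :=
  - e2pi (ptval z P' - ptval z P) *
  (theta (ptval z P - ptval z P' - sp (tag P.1) (tag P'.1) * tau) /
   theta (ptval z P' - ptval z P - sp (tag P.1) (tag P'.1) * tau)).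

Lemma exchange_coef_shift a n P P' z : exchange_coef P P' (csub id (power_shift a n) z) =
  exchange_coef (P.1, (if P.1 == a then n + P.2 else P.2)%N) (P'.1, (if P'.1 == a then n + P'.2 else P'.2)%N) z.
Proof. by case: P P' => [b m] [b' m']; rewrite /exchange_coef !ptval_power_shift. Qed.

(** For orthogonal roots the coefficient is 1 by the parity of theta. *)
Lemma adm_exchange_coef P P' : P.1 != P'.1 -> adm (exchange_coef P P').
Proof.
move=> ne; have ne' : P'.1 != P.1 by rewrite eq_sym.
have he z : holo_at (fun z => - e2pi (ptval z P' - ptval z P)) z.
  apply: holoN; apply: (holo_comp1 (phi := @e2pi R) (f := fun z => ptval z P' - ptval z P)).
    by under [X in holo_at X]funext do rewrite -[_ - _]addr0; exact: holo_ptval.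
  by apply: nearCT => t; exact: divdiff_hol (e2pi_divdiff t).
split.
  apply: meroM; first exact: mero_holo.
  by apply: mero_div => z; [exact: holo_theta_ptval|exact: nonzero_theta_ptval].
move=> z oz; have [s0|s0] := eqVneq (sp (tag P.1) (tag P'.1)) 0.
  apply: (holo_in_x_gen (f := fun=> 1)); last exact/holo_in_x_holo/holo_cst.
  have := gen_neq0 (nonzero_theta_ptval D tau eta0 0 z ne'); apply: genS => w.
  rewrite /exchange_coef s0 mul0r !subr0 addr0; set u := ptval w P' - ptval w P => u0.
  rewrite (_ : ptval w P - ptval w P' = - u); last by rewrite /u opprB.
  rewrite thetaN // mulfK // mulrNN -e2piD subrr e2pi0 //.
apply: holo_in_x_holo; apply: holoM => //; apply: holo_div.
- exact: holo_theta_ptval.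
- exact: holo_theta_ptval.
- by rewrite sp_sym; apply: off_poles_theta => //; rewrite sp_sym.
Qed.

Lemma ee (a b : idx p) : a != b -> e a * e b = A_mero (exchange_coef (a, 0%N) (b, 0%N)) * (e b * e a).
Proof.
move=> ab; have aE : adm (exchange_coef (a, 0%N) (b, 0%N)) by exact: adm_exchange_coef.
rewrite /A_mero (A_funE (adm_admissible aE)).
rewrite /A_e !algA_mulE.
have E : exchange_coef (a, 0%N) (b, 0%N) = e_coef D eta tau a b.
  by apply/funext => z; rewrite /exchange_coef /e_coef /ptval /= !mul0r !addr0.
apply/algA_ofP; apply: (rel_ee ab); exact: (congr1 (@normalize R (var p)) E).
Qed.

Lemma adm_exchange_prod (b a : idx p) m n k k' : b != a ->
  adm (fun z => \prod_(mu < m) \prod_(nu < n) exchange_coef (b, k + mu)%N (a, k' + nu)%N z).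
Proof.
by move=> ba; apply: adm_prod => mu _; apply: adm_prod => nu _; exact: adm_exchange_coef.
Qed.

(** Induction on both exponents: moving one more generator through translates the
    coefficients already there, which replaces a point by the next one. *)
Lemma eXeX (b a : idx p) m n : b != a -> e b ^+ m * e a ^+ n =
  A_mero (fun z => \prod_(mu < m) \prod_(nu < n) exchange_coef (b, nat_of_ord mu) (a, nat_of_ord nu) z) * (e a ^+ n * e b ^+ m).
Proof.
move=> ba; have ab : a != b by rewrite eq_sym.
have a1 k k' : adm (exchange_coef (b, k) (a, k')) by exact: adm_exchange_coef.
have aP k r : adm (fun z => \prod_(nu < r) exchange_coef (b, k) (a, nat_of_ord nu) z).
  by apply: adm_prod => nu _.
have step r : e b * e a ^+ r = A_mero (fun z => \prod_(nu < r) exchange_coef (b, 0%N) (a, nat_of_ord nu) z) * (e a ^+ r * e b).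
  elim: r => [|r IH].
    rewrite !expr0 mulr1 mul1r (_ : (fun _ => _) = fun=> 1) ?A_mero1 ?mul1r //.
    by apply/funext => z; rewrite big_ord0.
  rewrite exprSr mulrA IH -!mulrA (ee ba) [e a ^+ r * (A_mero _ * _)]mulrA eX_A_mero //.
  rewrite (A_mero_ext (F := fun z => exchange_coef (b, 0%N) (a, 0%N) (csub id (power_shift a r) z)) (G := exchange_coef (b, 0%N) (a, r))); last first.
    by move=> z; rewrite exchange_coef_shift /= (negbTE ba) eqxx addn0.
  rewrite [X in _ = A_mero X * _](_ : _ = fun z => (\prod_(nu < r) exchange_coef (b, 0%N) (a, nat_of_ord nu) z) * exchange_coef (b, 0%N) (a, r) z); last first.
    by apply/funext => z; rewrite big_ord_recr.
  by rewrite A_meroM // !mulrA.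
elim: m => [|m IH].
  rewrite !expr0 mul1r mulr1 (_ : (fun _ => _) = fun=> 1) ?A_mero1 ?mul1r //.
  by apply/funext => z; rewrite big_ord0.
rewrite exprSr -mulrA step mulrA eX_A_mero // -mulrA [e b ^+ m * _]mulrA IH.
rewrite (_ : (fun z => \prod_(mu < m.+1) _) = fun z => (\prod_(nu < n) exchange_coef (b, m) (a, nat_of_ord nu) z) * \prod_(mu < m) \prod_(nu < n) exchange_coef (b, nat_of_ord mu) (a, nat_of_ord nu) z); last first.
  by apply/funext => z; rewrite big_ord_recr mulrC.
rewrite A_meroM //; last exact: (adm_exchange_prod m n 0 0 ba).
rewrite (A_mero_ext (G := fun z => \prod_(nu < n) exchange_coef (b, m) (a, nat_of_ord nu) z)); last first.
  by move=> z; apply: eq_bigr => nu _; rewrite exchange_coef_shift /= eqxx (negbTE ab) addn0.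
by rewrite !mulrA.
Qed.

Definition monomial_seq (s : seq (idx p)) (phi : idx p -> nat) : A := \prod_(a <- s) e a ^+ phi a.

(** The coefficient for e_b^(phi b) and e_a^n; the offset k accounts for a power
    e_a^k standing to the left. *)
Definition cross_coef (phi : idx p -> nat) (b a : idx p) k n z : C :=
  \prod_(mu < phi b) \prod_(nu < n) exchange_coef (b, nat_of_ord mu) (a, (k + nu)%N) z.

Lemma adm_cross_coef phi b a k n : b != a -> adm (cross_coef phi b a k n).
Proof. exact: (adm_exchange_prod (phi b) n 0 k). Qed.

Lemma cross_coef_shift phi b a k n c m z : b != c -> a != c -> cross_coef phi b a k n (csub id (power_shift c m) z) = cross_coef phi b a k n z.
Proof.
move=> bc ac; apply: eq_bigr => mu _; apply: eq_bigr => nu _.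
by rewrite exchange_coef_shift /= (negbTE bc) (negbTE ac).
Qed.

Lemma neq_notin (T : eqType) (x y : T) (s : seq T) : x \notin s -> y \in s -> y != x.
Proof. by move=> xs ys; apply: contraNneq xs => <-. Qed.

Lemma monomial_seq_eX s phi a n : a \notin s -> uniq s ->
  monomial_seq s phi * e a ^+ n = A_mero (fun z => \prod_(b <- s) cross_coef phi b a 0 n z) * (e a ^+ n * monomial_seq s phi).
Proof.
elim: s => [|b s IH].
  rewrite /monomial_seq !big_nil mul1r mulr1 (_ : (fun _ => _) = fun=> 1) ?A_mero1 ?mul1r //.
  by move=> *; apply/funext => z; rewrite big_nil.
rewrite inE negb_or => /andP[ab as_] /= /andP[bs us].
have ba : b != a by rewrite eq_sym.
have acs : adm (fun z => \prod_(b <- s) cross_coef phi b a 0 n z).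
  rewrite (_ : (fun _ => _) = fun z => \prod_(b <- s | b != a) cross_coef phi b a 0 n z).
    by apply: adm_prod => c; exact: adm_cross_coef.
  apply/funext => z; rewrite big_seq [RHS]big_seq_cond; apply: eq_bigl => c.
  by have [/(neq_notin as_) ->|] := boolP (c \in s).
rewrite /monomial_seq !big_cons -/(monomial_seq s phi) -mulrA IH // mulrA eX_A_mero //.
rewrite -mulrA [e b ^+ _ * (e a ^+ n * _)]mulrA eXeX //.
rewrite (_ : (fun z => \prod_(c <- b :: s) _) = fun z => (\prod_(c <- s) cross_coef phi c a 0 n z) * cross_coef phi b a 0 n z); last first.
  by apply/funext => z; rewrite big_cons mulrC.
rewrite A_meroM //; last exact: adm_cross_coef.
rewrite (A_mero_ext (G := fun z => \prod_(c <- s) cross_coef phi c a 0 n z)); last first.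
  by move=> z; rewrite !big_seq; apply: eq_bigr => c cs; rewrite cross_coef_shift // (neq_notin bs).
by rewrite !mulrA.
Qed.

Fixpoint reorder_coef_seq (s : seq (idx p)) (phi psi : idx p -> nat) z : C :=
  if s is a :: s' then (\prod_(b <- s') cross_coef phi b a (phi a) (psi a) z) * reorder_coef_seq s' phi psi z
  else 1.

Lemma adm_cross_coefs s phi a k n : a \notin s -> adm (fun z => \prod_(b <- s) cross_coef phi b a k n z).
Proof.
move=> as_; rewrite (_ : (fun _ => _) = fun z => \prod_(b <- s | b != a) cross_coef phi b a k n z).
  by apply: adm_prod => c; exact: adm_cross_coef.
apply/funext => z; rewrite big_seq [RHS]big_seq_cond; apply: eq_bigl => c.
by have [/(neq_notin as_) ->|] := boolP (c \in s).
Qed.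

Lemma adm_reorder_coef_seq s phi psi : uniq s -> adm (reorder_coef_seq s phi psi).
Proof.
elim: s => [|a s IH] /=; first by move=> _; exact: adm_cst.
by move=> /andP[as_ us]; apply: admM; [exact: adm_cross_coefs|exact: IH].
Qed.

Lemma reorder_coef_seq_shift s phi psi c m z : c \notin s -> reorder_coef_seq s phi psi (csub id (power_shift c m) z) = reorder_coef_seq s phi psi z.
Proof.
elim: s => //= a s IH; rewrite inE negb_or => /andP[ca cs]; rewrite IH //; congr (_ * _).
rewrite !big_seq; apply: eq_bigr => b bs; rewrite cross_coef_shift ?(neq_notin cs bs) //.
by rewrite eq_sym.
Qed.

(** The factor e_a^(psi a) is moved to the left through the monomial of the remaining
    generators; the coefficient so obtained is then moved to the left of
    e_a^(phi a), which adds the offset phi a to the points of a. *)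
Lemma monomial_seq_mul s phi psi : uniq s ->
  monomial_seq s phi * monomial_seq s psi = A_mero (reorder_coef_seq s phi psi) * monomial_seq s (fun a => phi a + psi a)%N.
Proof.
elim: s => [|a s IH] /=; first by rewrite /monomial_seq !big_nil A_mero1 !mulr1.
move=> /andP[as_ us]; rewrite /monomial_seq !big_cons -!/(monomial_seq s _).
have aS := adm_cross_coefs phi 0 (psi a) as_; have aC := adm_reorder_coef_seq phi psi us.
pose F z := \prod_(b <- s) cross_coef phi b a (phi a) (psi a) z.
have E1 : e a ^+ phi a * A_mero (fun z => \prod_(b <- s) cross_coef phi b a 0 (psi a) z) = A_mero F * e a ^+ phi a.
  have EF : (fun z => \prod_(b <- s) cross_coef phi b a 0 (psi a) (csub id (power_shift a (phi a)) z)) = F.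
    apply/funext => z; rewrite /F !big_seq; apply: eq_bigr => b bs; apply: eq_bigr => mu _.
    apply: eq_bigr => nu _.
    by rewrite exchange_coef_shift /= eqxx (negbTE (neq_notin as_ bs)).
  by rewrite (eX_A_mero a (phi a) aS) EF.
have E2 n : e a ^+ n * A_mero (reorder_coef_seq s phi psi) = A_mero (reorder_coef_seq s phi psi) * e a ^+ n.
  have EF : (fun z => reorder_coef_seq s phi psi (csub id (power_shift a n) z)) = reorder_coef_seq s phi psi.
    by apply/funext => z; rewrite reorder_coef_seq_shift.
  by rewrite (eX_A_mero a n aC) EF.
rewrite (A_meroM (adm_cross_coefs phi (phi a) (psi a) as_) aC).
rewrite -mulrA [monomial_seq s phi * _]mulrA monomial_seq_eX // -!mulrA [monomial_seq s phi * _]IH //.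
rewrite mulrA E1 -mulrA; congr (_ * _).
by rewrite mulrA -exprD mulrA E2 -mulrA.
Qed.

End AlgebraA.

(** * Products of ordered monomials *)

Section Monomials.
Variables (R : realType) (h : nat) (D : km_datum R h) (eta tau : R[i]) (p : degree h).
Hypothesis eta0 : 0 < complex.Im eta.
Local Notation C := (R[i]).
Local Notation sp := (sp D).
Local Notation shift_of := (@shift_of R h D tau p).
Local Notation power_shift := (@power_shift R h D tau p).
Local Notation A_mero := (@A_mero R h D eta tau p).
Local Notation monomial_seq := (@monomial_seq R h D eta tau p).
Local Notation cross_coef := (@cross_coef R h D eta tau p).
Local Notation reorder_coef_seq := (@reorder_coef_seq R h D eta tau p).
Implicit Types (F G : (var p -> C) -> C) (z : var p -> C) (phi psi : idx p -> nat).

(** The order of the generators in [e_monomial]. *)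
Definition idx_seq : seq (idx p) := [seq mkidx al | i <- enum 'I_h, al <- enum 'I_(p i)].

Lemma mem_idx_seq a : a \in idx_seq.
Proof.
case: a => i al; apply/allpairsPdep; exists i, al.
by split; rewrite ?mem_enum.
Qed.

Lemma uniq_idx_seq : uniq idx_seq.
Proof.
apply: allpairs_uniq_dep; [exact: enum_uniq|by move=> i _; exact: enum_uniq|].
by move=> [i al] [i' al'] _ _ [].
Qed.

Lemma big_idx_seq (T : Type) (x : T) (op : Monoid.com_law x) (F : idx p -> T) :
  \big[op/x]_(a <- idx_seq) F a = \big[op/x]_(a : idx p) F a.
Proof.
rewrite -big_enum; apply: perm_big; apply: uniq_perm; [exact: uniq_idx_seq|exact: enum_uniq|].
by move=> a; rewrite mem_idx_seq mem_enum.
Qed.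

Lemma e_monomialE phi : e_monomial D eta tau phi = monomial_seq idx_seq phi.
Proof.
rewrite /monomial_seq /idx_seq big_allpairs_dep enumT -[Finite.enum _](unlock _ : index_enum _ = _).
by apply: eq_bigr => i _; rewrite enumT -[Finite.enum _](unlock _ : index_enum _ = _).
Qed.

Definition idx_lt (a b : idx p) := idx_le a b && (a != b).

Lemma idx_lt_asym a b : idx_lt a b -> ~~ idx_lt b a.
Proof.
rewrite /idx_lt /idx_le; case: a b => i al [j be] /=.
move=> /andP[ab ne]; apply/negP => /andP[ba _]; move/negP: ne; apply.
have ij : i = j.
  apply: val_inj => /=; case/orP: ab => [ij|/andP[/eqP/(congr1 val)] //].
  case/orP: ba => [ji|/andP[/eqP/(congr1 val) /esym] //].
  by have := ltn_trans ij ji; rewrite ltnn.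
subst j; move: ab ba; rewrite ltnn eqxx /= => ab ba; apply/eqP; congr (existT _ _ _).
by apply: val_inj; apply/eqP; rewrite eqn_leq ab.
Qed.

Lemma pairwise_idx_seq : pairwise idx_lt idx_seq.
Proof.
have : pairwise (fun i j : 'I_h => (i < j)%N) (enum 'I_h).
  by have := iota_ltn_sorted 0 h; rewrite -val_enum_ord sorted_pairwise ?pairwise_map //; exact: ltn_trans.
rewrite /idx_seq; elim: (enum 'I_h) => //= i s IH /andP[/allP is_ /IH {}IH].
rewrite pairwise_cat IH andbT; apply/andP; split.
  apply/allrelP => a b /mapP[al _ ->] /allpairsPdep[j [be [js _ ->]]].
  have ij := is_ _ js; rewrite /idx_lt /idx_le /= ij /=; apply/eqP => /(congr1 tag) /= e.
  by rewrite e ltnn in ij.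
rewrite pairwise_map.
have : pairwise (fun k l : 'I_(p i) => (k < l)%N) (enum 'I_(p i)).
  by have := iota_ltn_sorted 0 (p i); rewrite -val_enum_ord sorted_pairwise ?pairwise_map //; exact: ltn_trans.
apply: sub_pairwise => k l kl; rewrite /idx_lt /idx_le /= ltnn eqxx /= (ltnW kl) /=.
by apply/eqP => /mkidx_inj e; rewrite e ltnn in kl.
Qed.

Lemma reorder_coef_seq_pairwise phi psi z s : pairwise idx_lt s -> uniq s -> reorder_coef_seq s phi psi z =
  \prod_(a <- s) \prod_(b <- s | idx_lt a b) cross_coef phi b a (phi a) (psi a) z.
Proof.
elim: s => [|a s IH] /=; first by rewrite big_nil.
move=> /andP[/allP ra /IH {}IH] /andP[as_ /IH ->]; rewrite !big_cons.
rewrite {2}/idx_lt eqxx andbF; congr (_ * _).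
  rewrite big_seq [RHS]big_seq_cond; apply: eq_bigl => b.
  by have [/ra ->|] := boolP (b \in s).
rewrite !big_seq; apply: eq_bigr => b bs; rewrite big_cons.
by rewrite (negbTE (idx_lt_asym (ra _ bs))).
Qed.

(** The result of bringing the product of two ordered monomials into the normal
    order, as a product over pairs of generators rather than along the sequence. *)
Definition reorder_coef phi psi z : C :=
  \prod_(a : idx p) \prod_(b : idx p | idx_lt a b) cross_coef phi b a (phi a) (psi a) z.

Lemma reorder_coef_seqE phi psi : reorder_coef phi psi = reorder_coef_seq idx_seq phi psi.
Proof.
apply/funext => z; rewrite reorder_coef_seq_pairwise ?pairwise_idx_seq ?uniq_idx_seq //.
rewrite big_idx_seq; apply: eq_bigr => a _.
by rewrite [LHS]big_mkcond [RHS]big_mkcond big_idx_seq.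
Qed.

Lemma adm_reorder_coef phi psi : adm D eta tau (reorder_coef phi psi).
Proof. by rewrite reorder_coef_seqE; apply: adm_reorder_coef_seq => //; exact: uniq_idx_seq. Qed.

Lemma monomial_mul phi psi : e_monomial D eta tau phi * e_monomial D eta tau psi =
  A_mero (reorder_coef phi psi) * e_monomial D eta tau (fun a => phi a + psi a)%N.
Proof. by rewrite !e_monomialE reorder_coef_seqE; apply: monomial_seq_mul => //; exact: uniq_idx_seq. Qed.

(** The translation by which e^phi acts on functions; it moves y_a past the end of
    its string of length phi a. *)
Definition monomial_shift phi : var p -> C := fun k => match k with
  | inl b => (phi b)%:R * sp (tag b) (tag b) * tau
  | inr j => - (2 * Defs.dpair D (deg phi) j * tau) end.

Definition power_shifts s phi : var p -> C := fun k => \sum_(a <- s) power_shift a (phi a) k.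

Lemma off_poles_power_shifts s phi z : off_poles D eta tau z -> off_poles D eta tau (csub id (power_shifts s phi) z).
Proof.
elim: s z => [|a s IH] z oz.
  rewrite (_ : csub _ _ _ = z) //; apply/funext => k.
  by rewrite /csub /power_shifts big_nil addr0.
have := @off_poles_power_shift R h D eta tau p a (phi a) _ (IH _ oz); rewrite csub_csub.
by congr (off_poles _ _ _ (csub _ _ _)); apply/funext => k; rewrite /power_shifts big_cons addrC.
Qed.

Lemma monomial_seq_A_mero s phi F : adm D eta tau F -> monomial_seq s phi * A_mero F =
  A_mero (fun z => F (csub id (power_shifts s phi) z)) * monomial_seq s phi.
Proof.
move=> aF; elim: s => [|a s IH].
  rewrite /monomial_seq big_nil mul1r mulr1; apply: A_mero_ext => z; congr F.
  by apply/funext => k; rewrite /csub /power_shifts big_nil addr0.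
have aG : adm D eta tau (fun z => F (csub id (power_shifts s phi) z)).
  by apply: adm_csub => // z; exact: off_poles_power_shifts.
rewrite /monomial_seq big_cons -/(monomial_seq s phi) -mulrA IH mulrA (eX_A_mero a (phi a) aG) mulrA.
have -> // : (fun z => F (csub id (power_shifts s phi) (csub id (power_shift a (phi a)) z))) = (fun z => F (csub id (power_shifts (a :: s) phi) z)).
by apply/funext => z; rewrite csub_csub; congr (F (csub _ _ _)); apply/funext => k; rewrite /power_shifts big_cons.
Qed.

Lemma power_shifts_idx_seq phi : power_shifts idx_seq phi = monomial_shift phi.
Proof.
apply/funext => -[b|j]; rewrite /power_shifts big_idx_seq /power_shift /shift_of /monomial_shift.
  rewrite (bigD1 b) //= eqxx big1 ?addr0 ?mulrA // => a ab.
  by rewrite eq_sym (negbTE ab) mulr0.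
under eq_bigr do rewrite mulrN; rewrite sumrN; congr (- _).
rewrite /Defs.dpair mulr_sumr mulr_suml /deg.
rewrite big_idx.
apply: eq_bigr => i _; rewrite natr_sum mulr_suml mulr_sumr mulr_suml.
by apply: eq_bigr => al _; ring.
Qed.

Lemma off_poles_monomial_shift phi z : off_poles D eta tau z -> off_poles D eta tau (csub id (monomial_shift phi) z).
Proof. by rewrite -power_shifts_idx_seq; exact: off_poles_power_shifts. Qed.

Lemma adm_monomial_shift phi F : adm D eta tau F -> adm D eta tau (fun z => F (csub id (monomial_shift phi) z)).
Proof. by move=> aF; apply: adm_csub => // z; exact: off_poles_monomial_shift. Qed.

Lemma monomial_A_mero phi F : adm D eta tau F -> e_monomial D eta tau phi * A_mero F =
  A_mero (fun z => F (csub id (monomial_shift phi) z)) * e_monomial D eta tau phi.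
Proof. by move=> aF; rewrite e_monomialE (monomial_seq_A_mero _ _ aF) power_shifts_idx_seq. Qed.

(** Move G to the left of e^phi, which translates it, and reorder the monomials. *)
Lemma term_mul phi psi F G : adm D eta tau F -> adm D eta tau G ->
  (A_mero F * e_monomial D eta tau phi) * (A_mero G * e_monomial D eta tau psi) =
  A_mero (fun z => F z * G (csub id (monomial_shift phi) z) * reorder_coef phi psi z) *
    e_monomial D eta tau (fun a => phi a + psi a)%N.
Proof.
move=> aF aG; have aGs := adm_monomial_shift phi aG; have ac := adm_reorder_coef phi psi.
rewrite (A_meroM (admM aF aGs) ac) (A_meroM aF aGs) -!mulrA -monomial_mul.
by rewrite [e_monomial _ _ _ phi * (A_mero G * _)]mulrA (monomial_A_mero phi aG) !mulrA.
Qed.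

End Monomials.

(** * Permutations and subsets *)

Section PermCount.
Local Open Scope nat_scope.
Variables (m l : nat).
Hypothesis lm : l <= m.

(** Enumerate A, then its complement. *)
Lemma exists_perm_onto (A : {set 'I_m}) : #|A| = l ->
  exists s : 'S_m, forall k, ((s k) \in A) = (k < l).
Proof.
move=> Al.
have sz : size (enum A ++ enum (finset.setC A)) == m.
  by rewrite size_cat -!cardE cardsC card_ord.
have sz' : size (enum 'I_m) == m by rewrite -cardE card_ord.
have : perm_eq (Tuple sz) (Tuple sz').
  apply: uniq_perm; rewrite /= ?enum_uniq //.
    rewrite cat_uniq !enum_uniq andbT /=; apply/hasPn => x.
    by rewrite !mem_enum inE.
  by move=> x; rewrite mem_cat !mem_enum inE orbN.
move=> /tuple_permP [s es].
exists s => k.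
have e : s k = nth k (enum A ++ enum (finset.setC A)) k.
  have := congr1 (fun t => nth k t k) es => /= ->.
  rewrite (nth_map k) ?size_enum_ord // nth_ord_enum.
  by rewrite (tnth_nth k) /= nth_ord_enum.
rewrite e nth_cat -cardE Al; case: ltnP => kl.
  by rewrite -(mem_enum A) mem_nth // -cardE Al.
apply/negbTE; have : nth k (enum (finset.setC A)) (k - l) \in enum (finset.setC A).
  by rewrite mem_nth // -cardE cardsCs finset.setCK Al card_ord ltn_sub2r // (leq_ltn_trans kl).
by rewrite mem_enum inE.
Qed.

Definition perms_onto (A : {set 'I_m}) : {set 'S_m} :=
  finset (fun s : 'S_m => [forall k, (((s^-1)%g k < l) == (k \in A))]).

Lemma perms_ontoP (A : {set 'I_m}) (s : 'S_m) : reflect (forall k, (s k \in A) = (k < l)) (s \in perms_onto A).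
Proof.
rewrite inE; apply: (iffP forallP) => H k; first by have /eqP := H (s k); rewrite permK.
by rewrite -{2}(permKV s k) H.
Qed.

(** All sets A of size l have the same number of permutations, by multiplication
    with a permutation carrying one set to the other; there are C(m,l) such sets
    and m! permutations. *)
Lemma card_perms_onto (A : {set 'I_m}) : #|A| = l -> #|perms_onto A| = l`! * (m - l)`!.
Proof.
pose I0 := finset (fun k : 'I_m => k < l).
have cardI0 : #|I0| = l.
  rewrite -sum1_card (eq_bigl (fun k : 'I_m => k < l)); last by move=> k; rewrite inE.
  by rewrite (big_ord_narrow lm) sum1_card card_ord.
have im (A' : {set 'I_m}) (s : 'S_m) : (s \in perms_onto A') = ((s @: I0)%SET == A').
  apply/perms_ontoP/eqP => [H|<- k]; last by rewrite mem_imset ?inE //; exact: perm_inj.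
  apply/setP => k; rewrite -(permKV s k) mem_imset ?inE; last exact: perm_inj.
  by rewrite H.
have cardE0 (A' : {set 'I_m}) : #|A'| = l -> #|perms_onto A'| = #|perms_onto I0|.
  move=> /exists_perm_onto [t tA'].
  rewrite -(card_imset (mem (perms_onto I0)) (mulIg t)); apply: eq_card => s.
  apply/perms_ontoP/imsetP => [H|[s0 /perms_ontoP s0I -> k]]; last first.
    by rewrite permM tA' -(s0I k) inE.
  exists (s * t^-1)%g; last by rewrite mulgKV.
  apply/perms_ontoP => k; rewrite inE permM -[in RHS]H -tA' permKV //.
move=> Al; rewrite (cardE0 _ Al); apply/eqP; rewrite -(eqn_pmul2l (_ : 0 < 'C(m, l))) ?bin_gt0 //.
have Sm : \sum_(s : 'S_m) 1 = m`! by rewrite sum1_card card_Sn.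
rewrite bin_fact // -Sm.
rewrite (partition_big (fun s : 'S_m => (s @: I0)%SET) (fun A' : {set 'I_m} => #|A'| == l)) /=; last first.
  by move=> s _; rewrite card_imset ?cardI0 //; exact: perm_inj.
rewrite (eq_bigr (fun=> #|perms_onto I0|)); last first.
  move=> A' /eqP /cardE0 <-; rewrite -sum1_card; apply: eq_bigl => s.
  by rewrite im.
rewrite sum_nat_const; apply/eqP; congr (_ * _).
rewrite -[m in LHS](card_ord m) -card_draws; apply: eq_card => A'.
by rewrite inE.
Qed.

Lemma perms_onto_card (A : {set 'I_m}) s : s \in perms_onto A -> #|A| = l.
Proof.
move=> /perms_ontoP H.
have -> : A = (s @: finset (fun k : 'I_m => k < l))%SET.
  apply/setP => k; rewrite -(permKV s k) H mem_imset ?inE //; exact: perm_inj.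
rewrite card_imset; last exact: perm_inj.
rewrite -sum1_card (eq_bigl (fun k : 'I_m => k < l)); last by move=> k; rewrite inE.
by rewrite (big_ord_narrow lm) sum1_card card_ord.
Qed.

End PermCount.

Section SamePoints.
Variables (h : nat) (l : degree h) (T : eqType).

Definition tuple_perm (s : {dffun forall i : 'I_h, 'S_(l i)}) (c : idx l) : idx l :=
  mkidx (s (tag c) (tagged c)).

Lemma tuple_perm_inj s : injective (tuple_perm s).
Proof.
move=> [i k] [j k'] e; have ij : i = j := congr1 tag e.
subst j; move/mkidx_inj: e => /= /perm_inj -> //.
Qed.

(** Two enumerations of the same points differ by permutations of the arguments of
    each type, because each point determines its type. *)
Lemma same_points (f g : idx l -> T) (ty : T -> 'I_h) : injective f -> injective g ->
  (forall c, ty (f c) = tag c) -> (forall c, ty (g c) = tag c) ->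
  (forall c, exists c', f c' = g c) ->
  exists s : {dffun forall i : 'I_h, 'S_(l i)}, forall c, g c = f (tuple_perm s c).
Proof.
move=> f_inj g_inj tf tg fg.
have fg' i (k : 'I_(l i)) : exists k' : 'I_(l i), f (mkidx k') = g (mkidx k).
  have [[j k'] e] := fg (mkidx k).
  have ji : j = i by rewrite -[j]/(tag (mkidx k')) -tf e tg.
  by subst j; exists k'.
have r_inj i : injective (fun k : 'I_(l i) => projT1 (cid (fg' i k))).
  move=> k1 k2 e; have e1 := projT2 (cid (fg' i k1)); have e2 := projT2 (cid (fg' i k2)).
  by move: e1; rewrite e e2 => /g_inj /mkidx_inj.
exists (finfun (fun i => perm (@r_inj i))) => -[i k].
rewrite /tuple_perm /= ffunE permE.
by case: (cid _).
Qed.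

End SamePoints.

(** * The product of F evaluated on strings *)

Section Star.
Variables (R : realType) (h : nat) (D : km_datum R h) (eta tau : R[i]) (p : degree h).
Hypothesis eta0 : 0 < complex.Im eta.
Local Notation C := (R[i]).
Local Notation sp := (sp D).
Local Notation theta := (theta eta).
Local Notation point := (idx p * nat)%type.
Local Notation ptval := (ptval D tau).
Local Notation dpair := (Defs.dpair D).
Implicit Types (P : point) (z : var p -> C).

(** The factor contributed to the product of F by an argument P of f and an argument
    P' of g. *)
Definition star_factor P P' z : C := 
  theta (ptval z P - ptval z P' - sp (tag P.1) (tag P'.1) * tau) / theta (ptval z P - ptval z P').

Definition string_prod (phi : idx p -> nat) (F : point -> C) : C :=
  \prod_(a : idx p) \prod_(mu < phi a) F (a, nat_of_ord mu).

Lemma string_prodE phi (n : degree h) (hn : has_degree phi n) F : string_prod phi F = \prod_(c : idx n) F (pt hn c).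
Proof. by rewrite (big_pt hn). Qed.

Definition at_strings (l : degree h) (f : fn R l) (phi : idx p -> nat) z : C :=
  f (join (fun c : idx l => nth 0 (string_args D tau phi (fun a => z (inl a)) (tag c)) (tagged c : 'I_(l (tag c))))
            (z \o inr)).

Lemma at_stringsE l (f : fn R l) phi (hd : has_degree phi l) z :
  at_strings f phi z = f (join (fun c => ptval z (pt hd c)) (z \o inr)).
Proof. by congr (f (join _ _)); apply/funext => c; rewrite nth_pt. Qed.

Lemma at_strings_msub l (f : fn R l) phi (hd : has_degree phi l) z :
  at_strings f phi z = f (msub D tau (pt hd) (fun=> 0) z).
Proof.
rewrite at_stringsE /msub; congr (f (join _ _)); apply/funext => j.
by rewrite /= addr0.
Qed.

(** By the symmetry of f only the set of its arguments matters. *)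
Lemma Fcomp_points l (f : fn R l) (s1 s2 : idx l -> point) z u : Fcomp f ->
  injective s1 -> injective s2 -> (forall c, tag (s1 c).1 = tag c) -> (forall c, tag (s2 c).1 = tag c) ->
  (forall c, exists c', s1 c' = s2 c) ->
  f (join (fun c => ptval z (s2 c)) u) = f (join (fun c => ptval z (s1 c)) u) /\
  forall F : point -> C, \prod_(c : idx l) F (s2 c) = \prod_(c : idx l) F (s1 c).
Proof.
move=> [_ fs] i1 i2 t1 t2 s12.
have [s Es] := same_points (ty := fun P : point => tag P.1) i1 i2 t1 t2 s12.
split=> [|F]; last first.
  rewrite [RHS](reindex_inj (@tuple_perm_inj _ _ s)).
  by apply: eq_bigr => c _; rewrite Es.
rewrite -[RHS](fs s); congr f; apply/funext => -[c|j] //=.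
by rewrite Es.
Qed.

Section Fixed.
Variables (l l' m : degree h) (lm : forall i, (l i + l' i)%N = m i).
Variables (f : fn R l) (g : fn R l').
Hypotheses (fF : Fcomp f) (gF : Fcomp g).
Variables (Phi : idx p -> nat) (hd : has_degree Phi m).
Implicit Types (s : {dffun forall i : 'I_h, 'S_(m i)}).

Definition lidx s (a : idx l) : idx m :=
  mkidx (s (tag a) (cast_ord (lm (tag a)) (lshift (l' (tag a)) (tagged a)))).
Definition ridx s (b : idx l') : idx m :=
  mkidx (s (tag b) (cast_ord (lm (tag b)) (rshift (l (tag b)) (tagged b)))).

(** Whether the permutation gives the argument u to f. *)
Definition isleft s (u : idx m) : bool := ((s (tag u))^-1%g (tagged u) < l (tag u))%N.

Lemma isleft_lidx s a : isleft s (lidx s a).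
Proof. by rewrite /isleft /lidx /= permK /=; case: a => i k /=. Qed.

Lemma isleft_ridx s b : ~~ isleft s (ridx s b).
Proof. by rewrite /isleft /ridx /= permK /= -leqNgt leq_addr. Qed.

Lemma lidx_surj s u : isleft s u -> exists a, lidx s a = u.
Proof.
case: u => i k; rewrite /isleft /= => kl; exists (mkidx (Ordinal kl)).
rewrite /lidx /=; congr (existT _ _ _).
by rewrite -[RHS](permKV (s i)); congr (s i _); exact: val_inj.
Qed.

Lemma ridx_surj s u : ~~ isleft s u -> exists b, ridx s b = u.
Proof.
case: u => i k; rewrite /isleft /= -leqNgt => kl.
have lt : ((s i)^-1%g k - l i < l' i)%N.
  by have := ltn_ord ((s i)^-1%g k); rewrite -[X in (_ < X)%N -> _](lm i); lia.
exists (mkidx (Ordinal lt)); rewrite /ridx /=; congr (existT _ _ _).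
rewrite -[RHS](permKV (s i)); congr (s i _); apply: val_inj => /=.
by rewrite subnKC.
Qed.

Lemma lidx_inj s : injective (lidx s).
Proof.
move=> [i k] [j k'] e; have ij : i = j := congr1 tag e; subst j.
by move/mkidx_inj: e => /perm_inj /cast_ord_inj /lshift_inj /= -> //.
Qed.

Lemma ridx_inj s : injective (ridx s).
Proof.
move=> [i k] [j k'] e; have ij : i = j := congr1 tag e; subst j.
by move/mkidx_inj: e => /perm_inj /cast_ord_inj /rshift_inj /= -> //.
Qed.

(** Whether the argument u is among the first phi a ones of its string. *)
Definition initial_part (phi : idx p -> nat) (u : idx m) : bool := ((pt hd u).2 < phi (pt hd u).1)%N.

Definition selects s phi := [forall u, isleft s u == initial_part phi u].

Definition summand s z : C :=
  f (join (fun a => ptval z (pt hd (lidx s a))) (z \o inr)) *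
  g (join (fun b => ptval z (pt hd (ridx s b))) (fun j => z (inr j) - 2 * dpair l j * tau)) *
  \prod_(a : idx l) \prod_(b : idx l') star_factor (pt hd (lidx s a)) (pt hd (ridx s b)) z.

Definition sub_len (phi psi : idx p -> nat) : idx p -> nat := fun a => (phi a - psi a)%N.

(** The common value of the summands of the permutations which give to f the first
    phi a points of each string; g is evaluated at the rest of the strings, which
    are strings starting at the translated variables. *)
Definition star_value (phi : idx p -> nat) z : C :=
  at_strings f phi z * at_strings g (sub_len Phi phi) (csub id (monomial_shift D tau phi) z) *
  string_prod phi (fun P => string_prod (sub_len Phi phi) (fun P' => star_factor P (P'.1, (phi P'.1 + P'.2)%N) z)).

Lemma has_degree_sub phi : (forall a, phi a <= Phi a)%N -> has_degree phi l ->
  has_degree (sub_len Phi phi) l'.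
Proof.
move=> le /forallP hp; apply/forallP => i; have /eqP := hp i.
have /forallP/(_ i)/eqP := hd; rewrite -lm => E1 E2; apply/eqP.
apply/eqP; rewrite -(eqn_add2l (l i)) -E1 -[X in (X + _)%N]E2 -big_split /=; apply/eqP.
by apply: eq_bigr => al _; rewrite /sub_len subnKC.
Qed.

(** The arguments of f and of g are the points of the strings of lengths phi and of
    the translated strings, in another order. *)
Lemma selects_value s phi z : (forall a, phi a <= Phi a)%N -> has_degree phi l -> selects s phi ->
  summand s z = star_value phi z.
Proof.
move=> le hp /forallP cs0; have hq := has_degree_sub le hp.
have cs u : isleft s u = initial_part phi u by have /eqP := cs0 u.
have tagpt (n : degree h) (ph : idx p -> nat) (hn : has_degree ph n) c : tag (pt hn c).1 = tag c by exact: tag_pt.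
pose sh (P : point) : point := (P.1, (phi P.1 + P.2)%N).
have sh_inj : injective sh.
  by move=> [a x] [b y] [<-] /eqP; rewrite eqn_add2l => /eqP ->.
have lt_pt u : ((pt hd u).2 < Phi (pt hd u).1)%N by have := mem_pt hd u; rewrite mem_pts => /andP[].
have sl a : exists c', pt hp c' = pt hd (lidx s a).
  by apply: (pt_surj hp); rewrite -[X in is_true X]/(initial_part phi (lidx s a)) -cs isleft_lidx.
have sr b : exists c', sh (pt hq c') = pt hd (ridx s b).
  have := isleft_ridx s b; rewrite cs /initial_part -leqNgt; have := lt_pt (ridx s b).
  case: (pt hd (ridx s b)) => a mu /= mu1 mu2.
  have [c' Ec'] : exists c', pt hq c' = (a, (mu - phi a)%N).
    by apply: (pt_surj hq); rewrite /= /sub_len; lia.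
  by exists c'; rewrite Ec' /sh /= subnKC.
have [Ef PL] := @Fcomp_points l f (pt hp) (fun a => pt hd (lidx s a)) z (z \o inr) fF
   (@pt_inj _ _ _ _ hp) (inj_comp (@pt_inj _ _ _ _ hd) (@lidx_inj s)) (tagpt _ _ hp)
   (fun c => tagpt _ _ hd _) sl.
have [Eg PRr] := @Fcomp_points l' g (fun c => sh (pt hq c)) (fun b => pt hd (ridx s b)) z
   (fun j => z (inr j) - 2 * dpair l j * tau) gF
   (inj_comp sh_inj (@pt_inj _ _ _ _ hq)) (inj_comp (@pt_inj _ _ _ _ hd) (@ridx_inj s)) (tagpt _ _ hq)
   (fun c => tagpt _ _ hd _) sr.
rewrite /summand Ef Eg /star_value (at_stringsE f hp) (at_stringsE g hq); congr (_ * _ * _).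
  congr (g (join _ _)).
    by apply/funext => c; rewrite /ptval /csub /sh /= natrD; ring.
  apply/funext => j; rewrite /csub /=.
  by have /has_degreeP -> := hp.
rewrite (PL (fun P => \prod_b star_factor P (pt hd (ridx s b)) z)) (string_prodE hp).
apply: eq_bigr => a _; rewrite (PRr (fun P => star_factor (pt hp a) P z)) (string_prodE hq).
by [].
Qed.

Definition initial_set (phi : idx p -> nat) i : {set 'I_(m i)} :=
  finset (fun k => initial_part phi (mkidx k)).

Lemma card_initial_set phi i : (forall a, phi a <= Phi a)%N -> #|initial_set phi i| = deg phi i.
Proof.
move=> le; rewrite -sum1_card (eq_bigl (fun k => initial_part phi (mkidx k))); last by move=> k; rewrite inE.
rewrite big_mkcond /=.
rewrite (big_pt_type hd _ (fun P => if (P.2 < phi P.1)%N then 1%N else 0%N) i).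
apply: eq_bigr => al _; rewrite -big_mkcond /= (big_ord_narrow (le _)) sum1_card card_ord //.
Qed.

Lemma le_lm i : (l i <= m i)%N. Proof. by rewrite -lm leq_addr. Qed.

Lemma selectsP s phi : reflect (forall i, s i \in perms_onto (l i) (initial_set phi i)) (selects s phi).
Proof.
apply: (iffP forallP) => H.
  by move=> i; rewrite inE; apply/forallP => k; have := H (mkidx k); rewrite /isleft /= inE.
move=> [i k]; have := H i; rewrite inE => /forallP /(_ k).
by rewrite /isleft /= inE.
Qed.

(** For each type, a permutation sending the first l i indices onto the set of the
    points given to f. *)
Lemma card_selects phi : (forall a, phi a <= Phi a)%N -> has_degree phi l ->
  #|[pred s | selects s phi]| = (\prod_(i < h) ((l i)`! * (l' i)`!))%N.
Proof.
move=> le /has_degreeP dl.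
transitivity #|(family (fun i => mem (perms_onto (l i) (initial_set phi i))) : simpl_pred {dffun forall i : 'I_h, 'S_(m i)})|.
  apply: eq_card => s; rewrite !inE; apply/selectsP/familyP => H i; exact: H.
rewrite card_family foldrE big_map big_enum /=; apply: eq_bigr => i _.
rewrite card_perms_onto ?le_lm ?card_initial_set ?dl //.
by rewrite -lm addKn.
Qed.

Lemma selects_uniq s phi psi : (forall a, phi a <= Phi a)%N -> (forall a, psi a <= Phi a)%N ->
  selects s phi -> selects s psi -> phi =1 psi.
Proof.
move=> le1 le2 /forallP c1 /forallP c2 a.
have c12 mu : (mu < Phi a)%N -> (mu < phi a)%N = (mu < psi a)%N.
  move=> mP; have [u Eu] := pt_surj hd (P := (a, mu)) mP.
  by have /eqP := c1 u; have /eqP -> := c2 u; rewrite /initial_part Eu /= => ->.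
have := le1 a; have := le2 a; move: (phi a) (psi a) c12 => x y c12 yP xP.
apply/eqP; rewrite eqn_leq; apply/andP; split; rewrite leqNgt; apply/negP => lt.
  by have := c12 y (leq_trans lt xP); rewrite lt ltnn.
by have := c12 x (leq_trans lt yP); rewrite lt ltnn.
Qed.

(** If (a, mu+1) goes to f and (a, mu) to g, their difference is
    (delta_i, delta_i) tau and the numerator contains theta(0). *)
Lemma summand_initial s z : summand s z != 0 -> exists phi : idx p -> nat,
  [/\ (forall a, phi a <= Phi a)%N, has_degree phi l & selects s phi].
Proof.
move=> nz; pose L P := [exists u, (pt hd u == P) && isleft s u].
have LE u : L (pt hd u) = isleft s u.
  apply/existsP/idP => [[v /andP[/eqP /pt_inj ->]]//|us]; exists u; exact/andP.
have Ldown a mu : L (a, mu.+1) -> L (a, mu).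
  move=> /existsP[u /andP[/eqP Eu us]]; case: (boolP (L (a, mu))) => // nL; exfalso.
  have lt : (mu.+1 < Phi a)%N by have := mem_pt hd u; rewrite Eu mem_pts => /andP[].
  have [v Ev] := pt_surj hd (P := (a, mu)) (ltnW lt).
  rewrite -Ev LE in nL; have [y Ey] := ridx_surj nL; have [x Ex] := lidx_surj us.
  move/negP: nz; apply; rewrite /summand (bigD1 x) //= (bigD1 y) //= Ex Ey Eu Ev.
  rewrite {1}/star_factor /ptval /= (_ : _ - _ - _ = 0); last by rewrite -natr1; ring.
  by rewrite theta0 // !mul0r mulr0.
have Ldown' a mu nu : (nu <= mu)%N -> L (a, mu) -> L (a, nu).
  move=> /subnKC <-; elim: (mu - nu)%N => [|k IH]; first by rewrite addn0.
  by rewrite addnS => /Ldown.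
(* The number of points given to f on the string of a. *)
pose phi a := find (fun mu => ~~ L (a, mu)) (iota 0 (Phi a)).
have phiP a mu : (mu < Phi a)%N -> (mu < phi a)%N = L (a, mu).
  move=> mP; apply/idP/idP => [lt|Lm].
    by have := before_find 0%N lt; rewrite nth_iota // add0n => /negbFE.
  rewrite ltnNge; apply/negP => le.
  have hs : has (fun mu => ~~ L (a, mu)) (iota 0 (Phi a)).
    by rewrite has_find size_iota; exact: leq_ltn_trans le mP.
  have := nth_find 0%N hs; rewrite nth_iota ?add0n; last exact: leq_ltn_trans le mP.
  by rewrite (Ldown' _ _ _ le Lm).
have le a : (phi a <= Phi a)%N by rewrite /phi -[X in (_ <= X)%N](size_iota 0) find_size.
have cs : selects s phi.
  apply/forallP => u; rewrite /initial_part phiP; last by have := mem_pt hd u; rewrite mem_pts => /andP[].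
  by rewrite -surjective_pairing LE.
exists phi; split => //; apply/has_degreeP/funext => i.
by rewrite -card_initial_set //; have /selectsP /(_ i) /(perms_onto_card (le_lm i)) := cs.
Qed.

Variable M : nat.
Hypothesis PhiM : forall a, (Phi a <= M)%N.

Lemma summand_sum s z : summand s z =
  \sum_(phi : {ffun idx p -> 'I_M.+1} | [forall a, (phi a <= Phi a)%N] && has_degree (fun a => phi a : nat) l)
    (if selects s (fun a => phi a : nat) then star_value (fun a => phi a : nat) z else 0).
Proof.
have [s0|s0] := eqVneq (summand s z) 0.
  rewrite s0 big1 // => phi /andP[/forallP le hp].
  by case: ifP => // cs; rewrite -(selects_value z le hp cs).
have [phi [le hp cs]] := summand_initial s0.
pose fphi : {ffun idx p -> 'I_M.+1} := [ffun a => inord (phi a)].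
have Ephi : (fun a => fphi a : nat) = phi.
  by apply/funext => a; rewrite ffunE inordK // ltnS (leq_trans (le a)).
rewrite (bigD1 fphi) /=; last by rewrite Ephi hp andbT; apply/forallP => a; rewrite -[nat_of_ord _]/((fun a => fphi a : nat) a) Ephi.
rewrite Ephi cs (selects_value z le hp cs) big1 ?addr0 // => psi /andP[/andP[/forallP le' hp'] ne].
case: ifP => // cs'; case/eqP: ne; apply/ffunP => a; apply: val_inj.
by rewrite /= -[RHS]/((fun a => fphi a : nat) a) Ephi; exact: (selects_uniq le' le cs' cs).
Qed.

(** The number of permutations with a given phi is the factor by which the product
    is divided. *)
Lemma star_strings z :
  star D eta tau lm f g (join (fun c => ptval z (pt hd c)) (z \o inr)) =
  \sum_(phi : {ffun idx p -> 'I_M.+1} | [forall a, (phi a <= Phi a)%N] && has_degree (fun a => phi a : nat) l)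
    star_value (fun a => phi a : nat) z.
Proof.
transitivity ((\prod_(i < h) ((l i)`! * (l' i)`!))%:R^-1 * \sum_s summand s z).
  rewrite /star; apply: f_equal; apply: eq_bigr => s _.
  rewrite /summand; congr (_ * _ * _); apply: eq_bigr => a _; apply: eq_bigr => b _.
  by rewrite /star_factor !tag_pt.
rewrite (eq_bigr _ (fun s _ => summand_sum s z)) exchange_big /=.
rewrite mulr_sumr; apply: eq_bigr => phi /andP[/forallP le hp].
rewrite -big_mkcond sumr_const card_selects // -[star_value _ _ *+ _]mulr_natl mulKf //.
by rewrite pnatr_eq0 -lt0n prodn_gt0 // => i; rewrite muln_gt0 !fact_gt0.
Qed.

End Fixed.
End Star.

(** * Comparison of the theta factors *)

Section Pairs.
Variables (R : realType) (h : nat) (D : km_datum R h) (eta tau : R[i]) (p : degree h).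
Hypothesis eta0 : 0 < complex.Im eta.
Hypothesis tau_generic : forall (i : 'I_h) (k : nat), (0 < p i)%N -> (0 < k)%N ->
  ~ Gamma eta (k%:R * Defs.sp D i i * tau).
Local Notation C := (R[i]).
Local Notation sp := (sp D).
Local Notation theta := (theta eta).
Local Notation point := (idx p * nat)%type.
Local Notation ptval := (ptval D tau).
Local Notation B_ratio := (B_ratio D eta tau).
Local Notation B_factor := (B_factor D eta tau).
Local Notation star_factor := (star_factor D eta tau).
Local Notation at_strings := (at_strings D tau).
Local Notation monomial_shift := (monomial_shift D tau).
Local Notation reorder_coef := (reorder_coef D eta tau).
Implicit Types (P Q : point) (z : var p -> C) (phi psi : idx p -> nat).

Definition B_prod phi z : C := string_prod phi (fun P => string_prod phi (fun P' => B_factor P P' z)).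

Definition B_form (l : degree h) (f : fn R l) phi z : C := at_strings f phi z * B_prod phi z.

Lemma B_normalize (l : degree h) (f : fn R l) phi : B D eta tau f phi = normalize (B_form f phi).
Proof.
rewrite /B; congr normalize; apply/funext => z; rewrite /B_form /=; congr (_ * _).
rewrite /B_prod /string_prod; apply: eq_bigr => a _; rewrite [RHS]exchange_big /=.
rewrite big_mkcond /=; apply: eq_bigr => b _.
rewrite /B_factor /before /=; case: (idx_le a b) => /=; last first.
  by rewrite big1 // => mu _; rewrite big1.
apply: eq_bigr => mu _; rewrite big_mkcond /=; apply: eq_bigr => nu _.
by case: (_ ==> _) => //; rewrite /B_ratio /ptval /= !opprD !addrA.
Qed.

Lemma B_formE (l : degree h) (f : fn R l) phi (hd : has_degree phi l) :
  B_form f phi = sub_form D eta tau f (pt hd) (fun=> 0).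
Proof.
apply/funext => z; rewrite /B_form /sub_form (at_strings_msub _ _ _ hd); congr (_ * _).
rewrite /B_prod (string_prodE hd); apply: eq_bigr => c _; exact: (string_prodE hd).
Qed.

Lemma adm_B_form (l : degree h) (f : fn R l) phi : Fcomp f -> Qpoles D eta f -> has_degree phi l ->
  adm D eta tau (B_form f phi).
Proof. by move=> fF fQ hd; rewrite (B_formE f hd); apply: adm_sub_form => // c; exact: tag_pt. Qed.

Lemma string_prodD phi psi (F : point -> C) : string_prod (fun a => phi a + psi a)%N F =
  string_prod phi F * string_prod psi (fun P => F (P.1, (phi P.1 + P.2)%N)).
Proof. by rewrite /string_prod -big_split /=; apply: eq_bigr => a _; rewrite big_split_ord. Qed.

Lemma string_prodM phi (F G : point -> C) : string_prod phi (fun P => F P * G P) = string_prod phi F * string_prod phi G.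
Proof. by rewrite /string_prod -big_split /=; apply: eq_bigr => a _; rewrite big_split. Qed.

Lemma eq_string_prod phi (F G : point -> C) : (forall P, (P.2 < phi P.1)%N -> F P = G P) -> string_prod phi F = string_prod phi G.
Proof. by move=> e; apply: eq_bigr => a _; apply: eq_bigr => mu _; apply: e => /=. Qed.

Lemma string_prod_exchange phi psi (F : point -> point -> C) :
  string_prod phi (fun P => string_prod psi (fun P' => F P P')) = string_prod psi (fun P' => string_prod phi (fun P => F P P')).
Proof.
rewrite /string_prod; under eq_bigr => a _ do rewrite exchange_big /=.
rewrite exchange_big; apply: eq_bigr => b _; under eq_bigr => a _ do rewrite exchange_big /=.
by rewrite exchange_big.
Qed.

Lemma ptval_monomial_shift phi z P : ptval (csub id (monomial_shift phi) z) P = ptval z (P.1, (phi P.1 + P.2)%N).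
Proof. by rewrite /ptval /csub /= natrD; ring. Qed.

Lemma B_factor_shift phi z P P' : B_factor P P' (csub id (monomial_shift phi) z) =
  B_factor (P.1, (phi P.1 + P.2)%N) (P'.1, (phi P'.1 + P'.2)%N) z.
Proof.
rewrite /B_factor /before /B_ratio !ptval_monomial_shift /=.
by have [->|] := eqVneq P.1 P'.1; rewrite //= ltn_add2l.
Qed.

Lemma idx_le_total (a b : idx p) : idx_le a b || idx_le b a.
Proof. by rewrite /idx_le; case: a b => i al [j be] /=; rewrite -!val_eqE /=; lia. Qed.

(** The genericity needed of the base point: no theta factor of two points on
    different strings vanishes. *)
Definition nonresonant phi z := forall P Q, (P.2 < phi P.1)%N -> (Q.2 < phi Q.1)%N -> P.1 != Q.1 ->
  theta (ptval z P - ptval z Q) != 0 /\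
  theta (ptval z P - ptval z Q - sp (tag P.1) (tag Q.1) * tau) != 0.

Lemma gen_nonresonant phi z : gen z (nonresonant phi).
Proof.
have hd : has_degree phi (deg phi) by apply/has_degreeP.
have : gen z (fun w => forall cc : idx (deg phi) * idx (deg phi),
   let P := pt hd cc.1 in let Q := pt hd cc.2 in P.1 != Q.1 ->
   theta (ptval w P - ptval w Q + 0) != 0 /\
   theta (ptval w P - ptval w Q + - (sp (tag P.1) (tag Q.1) * tau)) != 0).
  apply: gen_all => cc /=; have [e|ne] := eqVneq (pt hd cc.1).1 (pt hd cc.2).1.
    exact: genT.
  apply: genS2 (gen_neq0 (nonzero_theta_ptval D tau eta0 0 z ne))
    (gen_neq0 (nonzero_theta_ptval D tau eta0 (- (sp (tag (pt hd cc.1).1) (tag (pt hd cc.2).1) * tau)) z ne)).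
  by [].
apply: genS => w H P Q /(pt_surj hd) [c <-] /(pt_surj hd) [c' <-] ne.
by have := H (c, c') ne; rewrite addr0.
Qed.

Lemma theta_string (i : 'I_h) (k : nat) : (0 < p i)%N -> (0 < k)%N ->
  theta (- (k%:R * sp i i * tau)) != 0.
Proof.
move=> pi k0; apply/eqP => /(theta_eq0 eta0) /GammaN; rewrite opprK.
exact: tau_generic.
Qed.

(** Two points of one string differ by a nonzero multiple of (delta_i, delta_i) tau,
    which is not in the lattice. *)
Lemma nonresonant_theta phi z P Q : nonresonant phi z -> (P.2 < phi P.1)%N -> (Q.2 < phi Q.1)%N -> P != Q ->
  theta (ptval z P - ptval z Q) != 0.
Proof.
have th P1 P2 : P1.1 = P2.1 -> (P1.2 < P2.2)%N -> theta (ptval z P1 - ptval z P2) != 0.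
  case: P1 P2 => a x [b y] /= <- xy.
  have -> : ptval z (a, x) - ptval z (a, y) = - ((y - x)%:R * sp (tag a) (tag a) * tau).
    by rewrite /ptval /= natrB ?(ltnW xy) //; ring.
  by apply: theta_string; rewrite ?subn_gt0 // (leq_ltn_trans _ (ltn_ord (tagged a))).
move=> gz hP hQ PQ; have [e|ne] := eqVneq P.1 Q.1; last by have [] := gz P Q hP hQ ne.
case: (ltngtP P.2 Q.2) => lt; first exact: th.
  rewrite -(opprB (ptval z Q) (ptval z P)) thetaN // mulNr oppr_eq0 mulf_neq0 ?e2pi_neq0 //.
  exact: th.
by case/eqP: PQ; case: P Q e lt {hP hQ} => a x [b y] /= -> ->.
Qed.

(** The factor of [B] is the inverse of the one of the product; both are defined
    because no theta involved vanishes. *)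
Lemma star_cancel phi z P Q : nonresonant phi z -> (P.2 < phi P.1)%N -> (Q.2 < phi Q.1)%N ->
  before P Q -> star_factor P Q z * B_ratio P Q z = 1.
Proof.
move=> gz hP hQ bPQ; have t0 : theta (ptval z P - ptval z Q) != 0.
  apply: (nonresonant_theta gz) => //; apply/eqP => e; move: bPQ.
  by rewrite /before e eqxx ltnn andbF.
suff t1 : theta (ptval z P - ptval z Q - sp (tag P.1) (tag Q.1) * tau) != 0.
  by rewrite /star_factor /B_ratio; field; rewrite t0 t1.
have [e|ne] := eqVneq P.1 Q.1; last by have [] := gz P Q hP hQ ne.
move: bPQ {t0}; rewrite /before e eqxx /= => /andP[_].
case: P Q e {hP hQ} => a x [b y] /= <- xy.
have -> : ptval z (a, x) - ptval z (a, y) - sp (tag a) (tag a) * tau = - ((y - x).+1%:R * sp (tag a) (tag a) * tau).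
  by rewrite /ptval /= -natr1 natrB ?(ltnW xy) //; ring.
by apply: theta_string; rewrite // (leq_ltn_trans _ (ltn_ord (tagged a))).
Qed.

(** The parity theta(-w) = - e2pi(-w) theta(w) turns the quotient into the
    coefficient exchanging the generators. *)
Lemma star_cross phi z P Q : nonresonant phi z -> (P.2 < phi P.1)%N -> (Q.2 < phi Q.1)%N -> P.1 != Q.1 ->
  star_factor P Q z * B_ratio Q P z = exchange_coef D eta tau P Q z.
Proof.
move=> gz hP hQ ne; have [t0 _] := gz P Q hP hQ ne.
rewrite eq_sym in ne; have [_ t1] := gz Q P hQ hP ne.
have E : theta (ptval z Q - ptval z P) = - e2pi (ptval z Q - ptval z P) * theta (ptval z P - ptval z Q).
  by rewrite -(opprB (ptval z P) (ptval z Q)) thetaN.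
rewrite /star_factor /B_ratio /exchange_coef E (sp_sym D (tag Q.1) (tag P.1)) in t1 *.
by field; rewrite t0 t1.
Qed.

Lemma reorder_coefE phi psi z : reorder_coef phi psi z = string_prod phi (fun P => string_prod psi (fun P' =>
  if idx_lt P'.1 P.1 then exchange_coef D eta tau P (P'.1, (phi P'.1 + P'.2)%N) z else 1)).
Proof.
rewrite /reorder_coef /string_prod; under eq_bigr => a _ do rewrite big_mkcond /=.
rewrite exchange_big /=; apply: eq_bigr => b _; rewrite [RHS]exchange_big /=; apply: eq_bigr => a _.
case: (idx_lt a b) => //; last by rewrite big1 // => mu _; rewrite big1.
Qed.

(** Split the pairs of points of the long strings according to whether the two
    points lie in the initial parts or in the rests.  Pairs inside the initial
    parts give the coefficient of f, pairs inside the rests the translated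
    coefficient of g, and mixed pairs are compared with the factors of the
    product of F one by one. *)
Lemma pair_identity phi psi z : nonresonant (fun a => phi a + psi a)%N z ->
  string_prod phi (fun P => string_prod psi (fun P' => star_factor P (P'.1, (phi P'.1 + P'.2)%N) z)) *
    B_prod (fun a => phi a + psi a)%N z =
  B_prod phi z * B_prod psi (csub id (monomial_shift phi) z) * reorder_coef phi psi z.
Proof.
move=> gz; pose sh P : point := (P.1, (phi P.1 + P.2)%N).
have -> : B_prod (fun a => phi a + psi a)%N z = (B_prod phi z * string_prod phi (fun P => string_prod psi (fun P' => B_factor P (sh P') z))) *
   (string_prod phi (fun P => string_prod psi (fun P' => B_factor (sh P') P z)) * B_prod psi (csub id (monomial_shift phi) z)).
  rewrite [LHS]/B_prod string_prodD -[X in _ = _ * (X * _)]string_prod_exchange -!string_prodM; congr (_ * _).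
    by apply: eq_string_prod => P _; rewrite string_prodD.
  apply: eq_string_prod => P _; rewrite string_prodD; congr (_ * _).
  by apply: eq_string_prod => P' _; rewrite B_factor_shift.
rewrite reorder_coefE.
have -> : string_prod phi (fun P => string_prod psi (fun P' => if idx_lt P'.1 P.1 then exchange_coef D eta tau P (sh P') z else 1)) =
  string_prod phi (fun P => string_prod psi (fun P' => star_factor P (sh P') z)) *
  (string_prod phi (fun P => string_prod psi (fun P' => B_factor P (sh P') z)) *
   string_prod phi (fun P => string_prod psi (fun P' => B_factor (sh P') P z))); last by ring.
rewrite -!string_prodM; apply: eq_string_prod => P hP; rewrite -!string_prodM; apply: eq_string_prod => P' hP'.
have hP1 : (P.2 < phi P.1 + psi P.1)%N by exact: leq_trans hP (leq_addr _ _).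
have hQ1 : ((sh P').2 < phi (sh P').1 + psi (sh P').1)%N by rewrite /sh /= ltn_add2l.
have [e|ne] := eqVneq P.1 P'.1.
  have b1 : before P (sh P').
    by rewrite /before /sh /= e eqxx /idx_le ltnn eqxx leqnn /= -e (leq_trans hP) ?leq_addr.
  have b2 : before (sh P') P = false.
    rewrite /before /sh /= e eqxx /= -e; apply/negbTE; rewrite negb_and -leqNgt.
    by rewrite (leq_trans (ltnW hP)) ?leq_addr ?orbT.
  rewrite /idx_lt e eqxx andbF /B_factor b1 b2 mulr1 (star_cancel gz) //.
have bE : before P (sh P') = idx_le P.1 P'.1 by rewrite /before /sh /= (negbTE ne) andbT.
have bE' : before (sh P') P = idx_le P'.1 P.1 by rewrite /before /sh /= eq_sym (negbTE ne) andbT.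
rewrite /B_factor bE bE' /idx_lt [P'.1 == _]eq_sym ne andbT.
have [le'|nle'] := boolP (idx_le P'.1 P.1).
  have -> : idx_le P.1 P'.1 = false.
    have ne' : P'.1 != P.1 by rewrite eq_sym.
    have : idx_lt P'.1 P.1 -> ~~ idx_lt P.1 P'.1 by exact: idx_lt_asym.
    move=> asym; apply/negbTE; move: asym.
    by rewrite /idx_lt le' ne ne' !andbT => /(_ isT).
  by rewrite mul1r (star_cross gz).
have le : idx_le P.1 P'.1 by have := idx_le_total P.1 P'.1; rewrite (negbTE nle') orbF.
rewrite le mulr1 (star_cancel gz) // bE //.
Qed.

End Pairs.

(** * The coefficients of a product *)

Section StarHolo.
Variables (R : realType) (h : nat) (D : km_datum R h) (eta tau : R[i]).
Hypothesis eta0 : 0 < complex.Im eta.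
Local Notation C := (R[i]).
Variables (l l' m : degree h) (lm : forall i, (l i + l' i)%N = m i).
Variables (f : fn R l) (g : fn R l').
Implicit Types (s : {dffun forall i : 'I_h, 'S_(m i)}).

Definition lvar s (k : var l) : var m :=
  match k with inl a => inl (lidx lm s a) | inr j => inr j end.
(** The arguments of g and their translation, as a substitution; [lvar] does the same
    for f. *)
Definition rvar s (k : var l') : var m :=
  match k with inl b => inl (ridx lm s b) | inr j => inr j end.
Definition rcst (k : var l') : C :=
  match k with inl _ => 0 | inr j => - (2 * Defs.dpair D l j * tau) end.

Lemma holo_star z :
  (forall s, holo_at f (csub (lvar s) (fun=> 0) z)) ->
  (forall s, holo_at g (csub (rvar s) rcst z)) ->
  (forall c c' : idx m, c != c' -> theta eta (z (inl c) - z (inl c')) != 0) ->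
  holo_at (star D eta tau lm f g) z.
Proof.
move=> hf hg hth; rewrite /star; apply: holoM; first exact: holo_cst.
apply: holo_sum => s _; apply: holoM; first apply: holoM.
- rewrite (_ : (fun w : var m -> C => _) = fun w => f (csub (lvar s) (fun=> 0) w)); first exact: holo_csub.
  by apply/funext => w; congr f; apply/funext => -[a|j]; rewrite /csub /= addr0.
- rewrite (_ : (fun w : var m -> C => _) = fun w => g (csub (rvar s) rcst w)); first exact: holo_csub.
  by apply/funext => w; congr g; apply/funext => -[a|j]; rewrite /csub /= ?addr0.
apply: holo_prod => a _; apply: holo_prod => b _; apply: holo_div.
- exact: holo_theta_lin.
- by under [X in holo_at X]funext do rewrite -[_ - _]addr0; exact: holo_theta_lin.
apply: hth; apply/eqP => e.
have := isleft_lidx lm s a; have := isleft_ridx lm s b.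
by rewrite /lidx e => /negbTE; rewrite /ridx => ->.
Qed.

End StarHolo.

Section Product.
Variables (R : realType) (h : nat) (D : km_datum R h) (eta tau : R[i]) (p : degree h).
Hypothesis eta0 : 0 < complex.Im eta.
Hypothesis tau_generic : forall (i : 'I_h) (k : nat), (0 < p i)%N -> (0 < k)%N ->
  ~ Gamma eta (k%:R * Defs.sp D i i * tau).
Local Notation C := (R[i]).
Local Notation ptval := (ptval D tau).
Local Notation dpair := (Defs.dpair D).
Local Notation monomial_shift := (monomial_shift D tau).
Local Notation reorder_coef := (reorder_coef D eta tau).
Local Notation B_form := (B_form D eta tau).
Implicit Types (z : var p -> C) (phi psi : idx p -> nat).

Lemma add_sub_len (Phi phi : idx p -> nat) : (forall a, phi a <= Phi a)%N ->
  (fun a => phi a + sub_len Phi phi a)%N = Phi.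
Proof. by move=> le; apply/funext => a; rewrite /sub_len subnKC. Qed.

Lemma star_value_B (l l' : degree h) (f : fn R l) (g : fn R l') Phi phi z :
  (forall a, phi a <= Phi a)%N -> nonresonant D eta tau Phi z ->
  star_value D eta tau f g Phi phi z * B_prod D eta tau Phi z =
  B_form f phi z * B_form g (sub_len Phi phi) (csub id (monomial_shift phi) z) * reorder_coef phi (sub_len Phi phi) z.
Proof.
move=> le; have := @pair_identity R h D eta tau p eta0 tau_generic phi (sub_len Phi phi) z.
rewrite add_sub_len // => H /H {}H; rewrite /star_value /B_form -mulrA H; ring.
Qed.

Variables (f g : Defs.family R h).
Arguments f l : clear implicits.
Arguments g l : clear implicits.
Hypotheses (fF : forall l, Fcomp (f l)) (gF : forall l, Fcomp (g l)).
Hypotheses (fQ : forall l, Qpoles D eta (f l)) (gQ : forall l, Qpoles D eta (g l)).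

(** The coefficient produced by [term_mul] from the terms phi of x(f) and psi of
    x(g). *)
Definition prodB phi psi z : C :=
  B_form (f (deg phi)) phi z * B_form (g (deg psi)) psi (csub id (monomial_shift phi) z) * reorder_coef phi psi z.

Variables (Phi : idx p -> nat) (m : degree h) (hd : has_degree Phi m).
Variable M : nat.
Hypothesis PhiM : forall a, (Phi a <= M)%N.

Local Notation split_type := {dffun forall i : 'I_h, 'I_(m i).+1}.
Definition left_deg (k : split_type) : degree h := fun i => nat_of_ord (k i).
Definition right_deg (k : split_type) : degree h := fun i => (m i - k i)%N.
Definition split_degE (k : split_type) i : (left_deg k i + right_deg k i)%N = m i := subnKC (leq_ord (k i)).

(** The arguments of f and g under each permutation are again points of strings, at
    which f and g are generically holomorphic. *)
Lemma gen_holo_star z0 : gen z0 (fun z => forall k : split_type,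
  holo_at (star D eta tau (split_degE k) (f (left_deg k)) (g (right_deg k))) (join (fun c => ptval z (pt hd c)) (z \o inr))).
Proof.
pose Z z : var m -> C := join (fun c => ptval z (pt hd c)) (z \o inr).
have H1 : gen z0 (fun z => forall k : split_type, forall s : {dffun forall i : 'I_h, 'S_(m i)},
    holo_at (f (left_deg k)) (csub (lvar (split_degE k) s) (fun=> 0) (Z z))).
  apply: gen_all => k; apply: gen_all => s.
  have := @gen_holo_sub R h D eta tau p (left_deg k) (f (left_deg k)) (fF _) (@fQ _)
    (fun a => pt hd (lidx (split_degE k) s a)) (fun=> 0) (fun a => tag_pt hd _) z0.
  apply: genS => z; congr (holo_at _ _); apply/funext => -[a|j] //=.
  by rewrite /csub /= addr0.
have H2 : gen z0 (fun z => forall k : split_type, forall s : {dffun forall i : 'I_h, 'S_(m i)},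
    holo_at (g (right_deg k)) (csub (rvar (split_degE k) s) (@rcst R h D tau (left_deg k) (right_deg k)) (Z z))).
  apply: gen_all => k; apply: gen_all => s.
  have := @gen_holo_sub R h D eta tau p (right_deg k) (g (right_deg k)) (gF _) (@gQ _)
    (fun a => pt hd (ridx (split_degE k) s a)) (fun j => - (2 * dpair (left_deg k) j * tau)) (fun a => tag_pt hd _) z0.
  apply: genS => z; congr (holo_at _ _); apply/funext => -[a|j] //=.
  by rewrite /csub /= addr0.
apply: genS2 (genI H1 H2) (gen_nonresonant D tau eta0 Phi z0) => z [h1 h2] gz k.
apply: holo_star => // c c' cc' /=; apply: (nonresonant_theta eta0 tau_generic gz).
- by have := mem_pt hd c; rewrite mem_pts => /andP[].
- by have := mem_pt hd c'; rewrite mem_pts => /andP[].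
- by apply: contra cc' => /eqP /pt_inj ->.
Qed.

Lemma left_degE k phi : has_degree phi (left_deg k) -> left_deg k = deg phi.
Proof. by move=> /has_degreeP ->. Qed.

Lemma deg_le phi : (forall a, phi a <= Phi a)%N -> forall i, (deg phi i <= m i)%N.
Proof.
move=> le i; have /has_degreeP <- := hd; exact: leq_sum.
Qed.

Lemma right_degE k phi : (forall a, phi a <= Phi a)%N -> has_degree phi (left_deg k) -> right_deg k = deg (sub_len Phi phi).
Proof.
move=> le hk; have := @has_degree_sub h p (left_deg k) (right_deg k) m (split_degE k) Phi hd phi le hk.
by move=> /has_degreeP ->.
Qed.

(** phi determines the degree of the factor f. *)
Lemma unique_split phi (X : C) : (forall a, phi a <= Phi a)%N ->
  \sum_(k : split_type | has_degree phi (left_deg k)) X = X.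
Proof.
(* The only decomposition of the degree m compatible with phi. *)
move=> le; pose k0 : split_type := finfun (fun i => inord (deg phi i)).
rewrite (big_pred1 k0) // => k; apply/idP/eqP => [/left_degE e|->].
  apply/ffunP => i; apply: val_inj; rewrite ffunE /= inordK ?ltnS ?deg_le //.
  by have := congr1 (fun l : degree h => l i) e.
by apply/has_degreeP/funext => i; rewrite /left_deg ffunE inordK ?ltnS ?deg_le.
Qed.

(** [Fmul] is normalized only after the summation, but at generic points the summands
    are holomorphic, so that its value there is the sum of their values. *)
Lemma B_form_Fmul : geneq (B_form (@Fmul R h D eta tau f g m) Phi)
  (fun z => \sum_(phi : {ffun idx p -> 'I_M.+1} | [forall a, (phi a <= Phi a)%N])
     prodB (fun a => nat_of_ord (phi a)) (sub_len Phi (fun a => nat_of_ord (phi a))) z).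
Proof.
move=> z0; apply: genS2 (gen_holo_star z0) (gen_nonresonant D tau eta0 Phi z0) => z hs gz.
rewrite /B_form (at_stringsE _ _ _ hd) /Fmul normalize_holo; last first.
  by apply: holo_sum => k _; exact: hs.
transitivity (\sum_(k : split_type) \sum_(phi : {ffun idx p -> 'I_M.+1} | 
   [forall a, (phi a <= Phi a)%N] && has_degree (fun a => phi a : nat) (left_deg k))
     prodB (fun a => nat_of_ord (phi a)) (sub_len Phi (fun a => nat_of_ord (phi a))) z).
  rewrite mulr_suml; apply: eq_bigr => k _.
  rewrite (star_strings D tau eta0 (split_degE k) (fF _) (gF _) hd PhiM) mulr_suml.
  apply: eq_bigr => phi /andP[/forallP le hk].
  rewrite star_value_B // /prodB.
  have -> : B_form (f (left_deg k)) (fun a => phi a : nat) z = B_form (f (deg (fun a => phi a : nat))) (fun a => phi a : nat) z.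
    by rewrite (left_degE hk).
  have -> // : forall w, B_form (g (right_deg k)) (sub_len Phi (fun a => phi a : nat)) w =
     B_form (g (deg (sub_len Phi (fun a => phi a : nat)))) (sub_len Phi (fun a => phi a : nat)) w.
  by move=> w; rewrite (right_degE le hk).
rewrite (exchange_big_dep (fun phi : {ffun idx p -> 'I_M.+1} => [forall a, (phi a <= Phi a)%N])) /=; last first.
  by move=> k phi _ /andP[].
apply: eq_bigr => phi le; under eq_bigl do rewrite le /=.
by apply: unique_split => a; exact: (forallP le).
Qed.

Lemma adm_prodB phi psi : adm D eta tau (prodB phi psi).
Proof.
have hp : has_degree phi (deg phi) by apply/has_degreeP.
have hq : has_degree psi (deg psi) by apply/has_degreeP.
apply: admM; last exact: adm_reorder_coef.
apply: admM; first exact: adm_B_form.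
by apply: adm_monomial_shift; exact: adm_B_form.
Qed.

Lemma A_mero_Fmul : A_mero D eta tau (B_form (@Fmul R h D eta tau f g m) Phi) =
  \sum_(phi : {ffun idx p -> 'I_M.+1} | [forall a, (phi a <= Phi a)%N])
    A_mero D eta tau (prodB (fun a => nat_of_ord (phi a)) (sub_len Phi (fun a => nat_of_ord (phi a)))).
Proof.
rewrite (A_mero_geneq _ _ _ B_form_Fmul) A_mero_sum // => phi _; exact: adm_prodB.
Qed.

End Product.

(** * Sums over exponents *)

Section Boxes.
Variables (I : finType) (V : nmodType).
Implicit Types (phi psi : I -> nat).

Definition to_box M phi : {ffun I -> 'I_M.+1} := [ffun a => inord (phi a)].

Lemma to_boxK M phi : (forall a, phi a <= M)%N -> (fun a => to_box M phi a : nat) = phi.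
Proof. by move=> le; apply/funext => a; rewrite ffunE inordK // ltnS. Qed.

Lemma of_boxK M (phi : {ffun I -> 'I_M.+1}) : to_box M (fun a => phi a : nat) = phi.
Proof. by apply/ffunP => a; rewrite ffunE inord_val. Qed.

Lemma box_le M (phi : {ffun I -> 'I_M.+1}) a : (phi a <= M)%N.
Proof. by rewrite -ltnS. Qed.

(** A sum over exponents only depends on the support of the summand, not on the box
    containing it. *)
Lemma box_change K M (P : pred (I -> nat)) (F : (I -> nat) -> V) :
  (forall phi, P phi -> forall a, (phi a <= K)%N /\ (phi a <= M)%N) ->
  \sum_(phi : {ffun I -> 'I_K.+1} | P (fun a => phi a : nat)) F (fun a => phi a : nat) =
  \sum_(phi : {ffun I -> 'I_M.+1} | P (fun a => phi a : nat)) F (fun a => phi a : nat).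
Proof.
move=> le; rewrite (reindex_onto (fun psi : {ffun I -> 'I_M.+1} => to_box K (fun a => psi a : nat))
  (fun phi : {ffun I -> 'I_K.+1} => to_box M (fun a => phi a : nat))) /=; last first.
  by move=> phi /le H; rewrite to_boxK ?of_boxK // => a; have [] := H a.
have E (psi : {ffun I -> 'I_M.+1}) : P (fun a => to_box K (fun a => psi a : nat) a : nat) &&
    (to_box M (fun a => to_box K (fun a => psi a : nat) a : nat) == psi) = P (fun a => psi a : nat).
  apply/idP/idP => [/andP[H /eqP e]|H].
    by rewrite -e to_boxK // => a; have [] := le _ H a.
  have EK : (fun a => to_box K (fun a => psi a : nat) a : nat) = (fun a => psi a : nat).
    by apply: to_boxK => a; have [] := le _ H a.
  by rewrite EK of_boxK eqxx H.
apply: eq_big => [psi|psi]; first exact: E.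
rewrite E => H; rewrite to_boxK // => a; by have [] := le _ H a.
Qed.

(** The substitution Phi = phi + psi in a sum over exponents at most M; the terms for
    which it leaves the box vanish. *)
Lemma box_shift M phi (G : (I -> nat) -> V) :
  (forall psi, ~~ [forall a, (phi a + psi a <= M)%N] -> G psi = 0) ->
  \sum_(Phi : {ffun I -> 'I_M.+1} | [forall a, (phi a <= Phi a)%N]) G (fun a => (Phi a - phi a)%N) =
  \sum_(psi : {ffun I -> 'I_M.+1}) G (fun a => psi a : nat).
Proof.
move=> G0; rewrite [RHS](bigID (fun psi : {ffun I -> 'I_M.+1} => [forall a, (phi a + psi a <= M)%N])) /=.
rewrite [X in _ + X]big1 ?addr0; last by move=> psi; exact: G0.
rewrite (reindex_onto (fun psi : {ffun I -> 'I_M.+1} => to_box M (fun a => phi a + psi a)%N)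
  (fun Phi : {ffun I -> 'I_M.+1} => to_box M (fun a => Phi a - phi a)%N)) /=; last first.
  move=> Phi /forallP le; rewrite -[RHS]of_boxK; congr to_box; apply/funext => a.
  by rewrite ffunE inordK ?subnKC // ltnS (leq_trans (leq_subr _ _)) ?box_le.
have key (psi : {ffun I -> 'I_M.+1}) : (forall a, phi a + psi a <= M)%N ->
    (fun a => to_box M (fun a => phi a + psi a)%N a - phi a)%N = (fun a => psi a : nat).
  by move=> le; apply/funext => a; rewrite ffunE inordK ?ltnS ?addKn.
apply: eq_big => psi.
  apply/andP/forallP => [[/forallP le /eqP e] a|le].
    have := le a; rewrite ffunE; case: (leqP (phi a + psi a) M) => // gt.
    have -> : inord (phi a + psi a) = ord0 :> 'I_M.+1.
      by rewrite /inord /insubd insubN // -ltnNge ltnS.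
    rewrite leqn0 => /eqP phi0.
    have := ltn_ord (psi a); rewrite phi0 add0n ltnS in gt *; by rewrite leqNgt gt.
  split; last by rewrite key // of_boxK.
  by apply/forallP => a; rewrite ffunE inordK ?ltnS ?leq_addr.
move=> /andP[/forallP le /eqP e]; congr G; apply: key => a.
have := le a; rewrite ffunE; case: (leqP (phi a + psi a) M) => // gt.
have -> : inord (phi a + psi a) = ord0 :> 'I_M.+1.
  by rewrite /inord /insubd insubN // -ltnNge ltnS.
rewrite leqn0 => /eqP phi0; have := ltn_ord (psi a).
by rewrite phi0 add0n in gt; rewrite ltnS leqNgt gt.
Qed.

End Boxes.

(** * The map x *)

Section Map.
Variables (R : realType) (h : nat) (D : km_datum R h) (eta tau : R[i]) (p : degree h).
Hypothesis eta0 : 0 < complex.Im eta.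
Hypothesis tau_generic : forall (i : 'I_h) (k : nat), (0 < p i)%N -> (0 < k)%N ->
  ~ Gamma eta (k%:R * Defs.sp D i i * tau).
Local Notation C := (R[i]).
Local Notation A := (algA D eta tau p).
Local Notation A_mero := (@A_mero R h D eta tau p).
Local Notation e_monomial := (@e_monomial R h D eta tau p).
Local Notation x := (@x_map R h D eta tau p).
Local Notation B_form := (@B_form R h D eta tau p).
Local Notation family := (Defs.family R h).
Local Notation box M := {ffun idx p -> 'I_M.+1}.
Implicit Types (z : var p -> C) (phi psi : idx p -> nat).

(** Families in Q have finitely many nonzero components, so the sum defining x may be
    taken over all exponents at most M, for any M large enough. *)
Definition bounded (f : family) N := forall l : degree h, f l <> (fun=> 0) -> forall i, (l i <= N)%N.

Lemma finite_bounded (f : family) : finite_set [set l : degree h | f l <> (fun=> 0)] -> exists N, bounded f N.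
Proof.
move=> /finite_seqP [s es]; exists (\sum_(l <- s) \sum_i l i)%N => l fl i.
have ls : l \in s.
  have : [set l : degree h | f l <> (fun=> 0)] l by [].
  by rewrite es.
by rewrite (big_rem l ls) /= (bigD1 i) //= -addnA leq_addr.
Qed.

(** The term of x(f) with exponents phi; f enters through its component of degree
    [deg phi]. *)
Definition xterm (f : family) phi : A := A_mero (B_form (f (deg phi)) phi) * e_monomial phi.

Lemma B_form0 (l : degree h) phi : B_form (fun _ : var l -> C => 0) phi = fun=> 0.
Proof. by apply/funext => z; rewrite /B_form /at_strings mul0r. Qed.

Lemma xterm0 (f : family) phi : f (deg phi) = (fun=> 0) -> xterm f phi = 0.
Proof. by rewrite /xterm => ->; rewrite B_form0 A_mero0 mul0r. Qed.

Lemma leq_deg phi a : (phi a <= deg phi (tag a))%N.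
Proof. by case: a => i al /=; rewrite /deg (bigD1 al) //= leq_addr. Qed.

Lemma xterm_bound (f : family) N phi a : bounded f N -> (N < phi a)%N -> xterm f phi = 0.
Proof.
move=> bf lt; apply: xterm0; apply: contrapT => /bf /(_ (tag a)).
by rewrite leqNgt (leq_trans lt (leq_deg _ _)).
Qed.

Lemma x_compE (f : family) M (l : degree h) : bounded f M ->
  x_comp D eta tau p (f l) = \sum_(phi : box M | has_degree (fun a => phi a : nat) l) xterm f (fun a => phi a : nat).
Proof.
move=> bf; pose F phi : A := A_mero (B_form (f l) phi) * e_monomial phi.
transitivity (\sum_(phi : box M | has_degree (fun a => phi a : nat) l) F (fun a => phi a : nat)); last first.
  by apply: eq_bigr => phi /has_degreeP; rewrite /F /xterm => ->.
transitivity (\sum_(phi : box (\sum_i l i)%N | has_degree (fun a => phi a : nat) l) F (fun a => phi a : nat)).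
  by apply: eq_bigr => phi _; rewrite /F /A_mero -B_normalize.
have [fl|fl] := pselect (f l = (fun=> 0)).
  have F0 phi : F phi = 0 by rewrite /F fl B_form0 A_mero0 mul0r.
  rewrite big1; last by move=> phi _; exact: F0.
  by rewrite big1 // => phi _; exact: F0.
apply: (@box_change (idx p) A (\sum_i l i)%N M (fun phi => has_degree phi l) F).
move=> phi /has_degreeP dl a.
have le : (phi a <= l (tag a))%N by rewrite -dl leq_deg.
split; last exact: leq_trans le (bf _ fl _).
by rewrite (leq_trans le) // (bigD1 (tag a)) //= leq_addr.
Qed.

(** The degrees l and the exponents of degree l are summed together: every exponent
    has exactly one degree. *)
Lemma x_mapE (f : family) M : bounded f M -> x f = \sum_(phi : box M) xterm f (fun a => phi a : nat).
Proof.
(* N bounds the degrees of all the exponents at most M, and those of the components of f. *)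
move=> bf; pose N := ((\sum_i p i) * M + M)%N.
pose toL (L : {ffun 'I_h -> 'I_N.+1}) : degree h := fun i => nat_of_ord (L i).
have toL_inj : injective toL.
  by move=> L L' e; apply/ffunP => i; apply: val_inj; exact: (congr1 (fun l : degree h => l i) e).
pose s := [seq toL L | L <- enum {ffun 'I_h -> 'I_N.+1}].
have us : uniq s by rewrite map_inj_uniq // enum_uniq.
have -> : x f = \sum_(L : {ffun 'I_h -> 'I_N.+1}) x_comp D eta tau p (f (toL L)).
  rewrite /x_map -(fsbig_widen [set` s] setT) //; last first.
    move=> l [_ /= ls]; apply: contrapT => xl; apply: ls.
    have fl : f l <> (fun=> 0).
      move=> fl; apply: xl; rewrite (x_compE _ bf) big1 // => phi /has_degreeP dl.
      by apply: xterm0; rewrite dl.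
    apply/mapP; exists (to_box N l); first by rewrite mem_enum.
    by rewrite /toL to_boxK // => i; rewrite (leq_trans (bf _ fl i)) // leq_addl.
  by rewrite -fsbig_seq // /s big_map big_enum.
transitivity (\sum_(L : {ffun 'I_h -> 'I_N.+1}) \sum_(phi : box M | has_degree (fun a => phi a : nat) (toL L)) xterm f (fun a => phi a : nat)).
  by apply: eq_bigr => L _; exact: x_compE.
rewrite (exchange_big_dep xpredT) //=; apply: eq_bigr => phi _.
have dN i : (deg (fun a => phi a : nat) i <= N)%N.
  rewrite (@leq_trans (\sum_(al < p i) M)%N) //; first by apply: leq_sum => al _; exact: box_le.
  rewrite sum_nat_const card_ord (leq_trans _ (leq_addr _ _)) // leq_mul2r.
  by rewrite (bigD1 i) //= leq_addr orbT.
rewrite (big_pred1 (to_box N (deg (fun a => phi a : nat)))) // => L; apply/has_degreeP/eqP => [e|->].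
  by apply: toL_inj; rewrite -e /toL to_boxK.
by rewrite /toL to_boxK.
Qed.

Section Linear.
Variables (c : C) (f g : family).
Arguments f l : clear implicits.
Arguments g l : clear implicits.
Hypotheses (fF : forall l, Fcomp (f l)) (gF : forall l, Fcomp (g l)).
Hypotheses (fQ : forall l, Qpoles D eta (f l)) (gQ : forall l, Qpoles D eta (g l)).

Lemma xterm_Flin phi : xterm (Flin c f g) phi = c *: xterm f phi + xterm g phi.
Proof.
have hd : has_degree phi (deg phi) by apply/has_degreeP.
have af := @adm_B_form R h D eta tau p eta0 (deg phi) (f (deg phi)) phi (fF _) (@fQ _) hd.
have ag := @adm_B_form R h D eta tau p eta0 (deg phi) (g (deg phi)) phi (gF _) (@gQ _) hd.
rewrite /xterm A_scaleAl -mulrDl -A_meroZ // -A_meroD //; last by apply: admM => //; exact: adm_cst.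
rewrite (@A_mero_geneq R h D eta tau p _ (fun z => c * B_form (f (deg phi)) phi z + B_form (g (deg phi)) phi z)) //.
move=> z0; apply: genS2 (@gen_holo_sub R h D eta tau p (deg phi) (f (deg phi)) (fF _) (@fQ _) (pt hd) (fun=> 0) (tag_pt hd) z0)
  (@gen_holo_sub R h D eta tau p (deg phi) (g (deg phi)) (gF _) (@gQ _) (pt hd) (fun=> 0) (tag_pt hd) z0) => z hf hg.
rewrite /B_form !(at_strings_msub _ _ _ hd) /Flin normalize_holo; first by ring.
by apply: holoD => //; apply: holoM => //; exact: holo_cst.
Qed.

Lemma bounded_Flin N N' : bounded f N -> bounded g N' -> bounded (Flin c f g) (N + N').
Proof.
move=> bf bg l fl i; have [f0|f0] := pselect (f l = (fun=> 0)); last exact: leq_trans (bf _ f0 i) (leq_addr _ _).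
have [g0|g0] := pselect (g l = (fun=> 0)); last exact: leq_trans (bg _ g0 i) (leq_addl _ _).
case: fl; rewrite /Flin f0 g0.
under [X in normalize X]funext do rewrite mulr0 addr0.
exact: normalize_cst.
Qed.

Lemma x_Flin N N' : bounded f N -> bounded g N' -> x (Flin c f g) = c *: x f + x g.
Proof.
move=> bf bg; have bl := bounded_Flin bf bg.
have bf' : bounded f (N + N') by move=> l fl i; exact: leq_trans (bf _ fl i) (leq_addr _ _).
have bg' : bounded g (N + N') by move=> l gl i; exact: leq_trans (bg _ gl i) (leq_addl _ _).
rewrite (x_mapE bl) (x_mapE bf') (x_mapE bg') scaler_sumr -big_split /=.
by apply: eq_bigr => phi _; exact: xterm_Flin.
Qed.

Lemma star0 (l l' m : degree h) (lm : forall i, (l i + l' i)%N = m i) (F : fn R l) (G : fn R l') (z : var m -> C) :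
  F = (fun=> 0) \/ G = (fun=> 0) -> star D eta tau lm F G z = 0.
Proof.
by move=> [] ->; rewrite /star [X in _ * X]big1 ?mulr0 // => s _ /=; rewrite ?mul0r ?mulr0 ?mul0r.
Qed.

Lemma bounded_Fmul N N' : bounded f N -> bounded g N' -> bounded (Fmul D eta tau f g) (N + N').
Proof.
move=> bf bg m fm i; rewrite leqNgt; apply/negP => lt; apply: fm.
rewrite /Fmul (_ : (fun _ => _) = fun=> 0); first exact: normalize_cst.
apply/funext => z; rewrite big1 // => k _; apply: star0.
have [f0|f0] := pselect (f (fun i => nat_of_ord (k i)) = (fun=> 0)); first by left.
have [g0|g0] := pselect (g (fun i => m i - k i)%N = (fun=> 0)); first by right.
have := bf _ f0 i; have := bg _ g0 i; rewrite leq_subLR => le1 le2.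
by move: lt; rewrite ltnNge (leq_trans le1) // leq_add2r.
Qed.

Lemma xterm_mul phi psi : xterm f phi * xterm g psi =
  A_mero (prodB D eta tau f g phi psi) * e_monomial (fun a => phi a + psi a)%N.
Proof.
rewrite /xterm term_mul //.
  by apply: adm_B_form => //; apply/has_degreeP.
by apply: adm_B_form => //; apply/has_degreeP.
Qed.

Lemma xterm_Fmul M (Phi : box M) : xterm (Fmul D eta tau f g) (fun a => Phi a : nat) =
  \sum_(phi : box M | [forall a, (phi a <= Phi a)%N])
    xterm f (fun a => phi a : nat) * xterm g (fun a => (Phi a - phi a)%N).
Proof.
have hd : has_degree (fun a => Phi a : nat) (deg (fun a => Phi a : nat)) by apply/has_degreeP.
rewrite /xterm (@A_mero_Fmul R h D eta tau p eta0 tau_generic f g fF gF fQ gQ _ _ hd M (@box_le _ M Phi)).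
rewrite mulr_suml; apply: eq_bigr => phi /forallP le; rewrite -!/(xterm _ _) xterm_mul.
by rewrite (add_sub_len le).
Qed.

(** Both sides are sums over pairs (phi, psi), the left one grouped by phi + psi. *)
Lemma x_Fmul N N' : bounded f N -> bounded g N' -> x (Fmul D eta tau f g) = x f * x g.
Proof.
move=> bf bg; have bl := bounded_Fmul bf bg.
have bf' : bounded f (N + N') by move=> l fl i; exact: leq_trans (bf _ fl i) (leq_addr _ _).
have bg' : bounded g (N + N') by move=> l gl i; exact: leq_trans (bg _ gl i) (leq_addl _ _).
rewrite (x_mapE bl) (x_mapE bf') (x_mapE bg') mulr_suml.
rewrite (eq_bigr _ (fun Phi _ => xterm_Fmul Phi)).
rewrite (exchange_big_dep xpredT) //=; apply: eq_bigr => phi _; rewrite mulr_sumr.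
apply: (@box_shift (idx p) A (N + N')%N (fun a => phi a : nat) (fun psi => xterm f (fun a => phi a : nat) * xterm g psi)).
move=> psi /forallPn [a]; rewrite -ltnNge => lt.
have [le|gt] := leqP (phi a) N.
  rewrite (xterm_bound (a := a) bg) ?mulr0 // -(ltn_add2l (phi a)).
  by apply: leq_ltn_trans lt; rewrite leq_add2r.
by rewrite (xterm_bound (a := a) bf) ?mul0r.
Qed.

End Linear.

Lemma x_Fone : x (@Fone R h) = 1.
Proof.
have b1 : bounded (@Fone R h) 0.
  move=> l fl i; rewrite leqn0; case: (boolP [forall i, l i == 0%N]) => [/forallP //|nl].
  by case: fl; apply/funext => z; rewrite /Fone (negbTE nl).
rewrite (x_mapE b1) (bigD1 [ffun=> ord0]) //= big1 ?addr0; last first.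
  by move=> phi /eqP []; apply/ffunP => a; rewrite ffunE ord1.
have E : (fun a => ([ffun=> ord0] : box 0) a : nat) = fun=> 0%N.
  by apply/funext => a; rewrite ffunE.
rewrite E /xterm /Defs.e_monomial big1 ?mulr1; last by move=> i _; rewrite big1 // => al _; rewrite expr0.
rewrite -[RHS](@A_mero1 R h D eta tau p); apply: A_mero_ext => z.
rewrite /B_form /B_prod /string_prod big1 ?mulr1; last by move=> a _; rewrite big_ord0.
rewrite /at_strings /Fone; case: forallP => // -[] i.
by rewrite /deg big1.
Qed.

End Map.
(** * Homomorphism property *)

Theorem proposition4 (R : realType) (h : nat) (D : km_datum R h)
    (eta tau : R[i]) (n : {additive 'rV[int]_h -> int}) (p : degree h)
    (eta_gt0 : 0 < complex.Im eta)
    (tau_generic : forall (i : 'I_h) (k : nat), (0 < p i)%N -> (0 < k)%N ->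
       ~ Gamma eta (k%:R * sp D i i * tau)) :
  let Q := inQ D eta tau (fun i => n (delta_mx 0 i)) in
  let x := x_map D eta tau p in
  [/\ forall f, Q f -> forall (l : degree h) (phi : idx p -> nat),
        has_degree phi l -> admissible D eta tau (B D eta tau (f l) phi),
      forall c f g, Q f -> Q g -> x (Flin c f g) = c *: x f + x g,
      x (@Fone R h) = 1 &
      forall f g, Q f -> Q g -> x (Fmul D eta tau f g) = x f * x g].
Proof.
move=> Q x.
have QF (f : Defs.family R h) : Q f -> [/\ forall l : degree h, Fcomp (f l),
    forall l : degree h, Qpoles D eta (f l) & exists N, bounded f N].
  move=> [[fF ff] fQ]; split => // [l|]; last exact: finite_bounded.
  by have [] := fQ l.
split.
- move=> f /QF [fF fQ _] l phi hd; rewrite B_normalize.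
  by apply: adm_admissible; apply: adm_B_form.
- move=> c f g /QF [fF fQ [N bf]] /QF [gF gQ [N' bg]].
  exact: (x_Flin tau p eta_gt0 c fF gF fQ gQ bf bg).
- exact: x_Fone.
- move=> f g /QF [fF fQ [N bf]] /QF [gF gQ [N' bg]].
  exact: (x_Fmul eta_gt0 tau_generic fF gF fQ gQ bf bg).
Qed.
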